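(* Let $n\ge 1$, let $m\in[1,2)$ and $\sigma\ge 0$, and suppose that $\lambda,\rho,\omega$ satisfy all the conditions (A1)-(A5) and (B1)-(B6) listed in the context. Put $B_\lambda(0,t):=\int_0^t\frac{\lambda^2(\tau)}{\rho(\tau)}\,d\tau$. Then the Sobolev solutions $u$ of the Cauchy problem $$u_{tt}-\lambda^2(t)\omega^2(t)\Delta u+\rho(t)\omega(t)u_t=0,\quad (t,x)\in[0,\infty)\times\mathbb{R}^n,\qquad u(0,x)=u_0(x),\quad u_t(0,x)=u_1(x),$$ satisfy, for all $t\ge 0$ and whenever the data belong to the spaces on the right-hand side, the estimates $$\|u(t,\cdot)\|_{\dot H^{\sigma}}\lesssim \big(1+B_\lambda(0,t)\big)^{-\frac{\sigma}{2}-\frac n2\left(\frac1m-\frac12\right)}\big(\|u_0\|_{L^m\cap H^{\sigma}}+\|u_1\|_{L^m\cap H^{[\sigma-1]_+}}\big),$$ $$\|u_t(t,\cdot)\|_{\dot H^{\sigma}}\lesssim \lambda(t)\big(1+B_\lambda(0,t)\big)^{-\frac{\sigma}{2}-\frac n2\left(\frac1m-\frac12\right)-\frac12}\big(\|u_0\|_{L^m\cap H^{\sigma+1}}+\|u_1\|_{L^m\cap H^{\sigma}}\big),$$ with implicit constants independent of $t$ and of the data.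
   Context: Notation: $f\lesssim g$ means $f\le Cg$ with a constant $C>0$; $[x]_+=\max\{x,0\}$; $H^\sigma$ and $\dot H^\sigma$ are the Bessel and Riesz potential spaces based on $L^2(\mathbb{R}^n)$; $f=o(g)$ is understood as $t\to\infty$. A Sobolev solution is one given through its partial Fourier transform in $x$, $\hat u(t,\xi)$, solving $\hat u_{tt}+\lambda^2\omega^2|\xi|^2\hat u+\rho\omega\hat u_t=0$, $\hat u(0,\xi)=\hat u_0(\xi)$, $\hat u_t(0,\xi)=\hat u_1(\xi)$. Coefficients: $\lambda,\rho,\omega$ are strictly positive smooth functions of $t$; $\lambda,\omega\in C^M$ with an integer $M\ge2$. (A1) $\lambda(t)>0$, $\lambda'(t)>0$ for $t>0$, and with $\Lambda(t)=1+\int_0^t\lambda(\tau)d\tau$: $\lambda_0\frac{\lambda(t)}{\Lambda(t)}\le\frac{\lambda'(t)}{\lambda(t)}\le\lambda_1\frac{\lambda(t)}{\Lambda(t)}$ and $|d_t^k\lambda(t)|\le\lambda_k\lambda(t)\big(\frac{\lambda(t)}{\Lambda(t)}\big)^k$ for $k=1,\dots,M$, with positive constants $\lambda_0,\lambda_k$. (A2) $0<c_0\le\omega(t)\le c_1$ and $|d_t^k\omega(t)|\le\omega_k\Xi(t)^{-k}$ for $k=1,\dots,M$, with positive constants $\omega_k$, where $\Xi$ is a positive, monotonous, continuous function with $C_1\Theta(t)\le\lambda(t)\Xi(t)\le C_2\Lambda(t)$, and $\Theta$ is a strictly increasing continuous function with $\Theta(0)=1$, $\Theta(t)<\Lambda(t)$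 for $t>0$ and $\Theta(t)=o(\Lambda(t))$. (A3) $\int_0^t\lambda(\tau)|\omega(\tau)-1|d\tau\le C_3\Theta(t)$. (A4) $\int_t^\infty\lambda^{-M}(\tau)\Xi^{-M-1}(\tau)d\tau\le C_4\Theta^{-M}(t)$. (A5) The function $F=F(\Lambda(t))$ is defined by $\Xi(t)=\frac{F(\Lambda(t))}{\lambda(t)\sqrt{F'(\Lambda(t))}}$, so that $\frac1{F(\Lambda(t))}=\int_t^\infty\lambda^{-1}(\tau)\Xi^{-2}(\tau)d\tau$ (this integral is assumed to exist for all $t\ge0$) and $F(\Lambda(t))\to\infty$ as $t\to\infty$. (B1) $\rho(t)>0$, $\rho(t)=\mu(t)\frac{\lambda(t)}{\Lambda(t)}$. (B2) $|d_t^k\mu(t)|\le\mu_k\mu(t)\big(\frac{\lambda(t)}{\Lambda(t)}\big)^k$ for $k=1,\dots,M$, with positive constants $\mu_k$. (B3) $\frac{\mu(t)}{\Lambda(t)}$ is monotonic and $\mu(t)\to\infty$ as $t\to\infty$. (B4) $\frac{\lambda^2(t)}{\rho(t)}=\frac{\lambda(t)\Lambda(t)}{\mu(t)}\notin L^1(\mathbb{R}_+)$. (B5) $|(\rho(t)\omega(t))'|=o\big((\rho(t)\omega(t))^2\big)$ and $\mu(t)\frac{\Theta(t)}{\Lambda(t)}\to\infty$ as $t\to\infty$. (B6) $\int_0^t\frac{\lambda^2(\tau)}{\rho(\tau)}d\tau\le C_5F^2(\Lambda(t))$ with a positive constant $C_5$. *)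

(* Defs.v *)
From HB Require Import structures.
From mathcomp Require Import all_boot all_order all_algebra.
From mathcomp Require Import all_classical all_reals all_analysis.
From mathcomp.real_closed Require Import complex.

Set Implicit Arguments.
Unset Strict Implicit.
Unset Printing Implicit Defensive.

Import Order.TTheory GRing.Theory Num.Theory.
Import numFieldNormedType.Exports.

Local Open Scope classical_set_scope.
Local Open Scope ring_scope.
Local Open Scope complex_scope.

(* Points of R^n are n-tuples; their sigma-algebra is the product one, and
   Lebesgue measure is built by induction on n as a product measure. *)
Section LebesgueMeasureRn.
Context {R : realType}.
Local Open Scope ereal_scope.

Definition cons_pair n (p : R * n.-tuple R) : n.+1.-tuple R :=
  [tuple of p.1 :: p.2].

Lemma measurable_cons_pair n : measurable_fun [set: R * n.-tuple R] (@cons_pair n).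
Proof. exact: measurable_cons. Qed.

Section step.
Variables (n : nat) (nu : {sigma_finite_measure set (n.-tuple R) -> \bar R}).

Definition cons_measure : set (n.+1.-tuple R) -> \bar R :=
  pushforward (lebesgue_measure \x nu) (@cons_pair n).

Let cons_measure0 : cons_measure set0 = 0.
Proof. by rewrite /cons_measure /pushforward preimage_set0 measure0. Qed.

Let cons_measure_ge0 A : 0 <= cons_measure A.
Proof. exact: (measure_ge0 (lebesgue_measure \x nu)). Qed.

Let cons_measure_sigma_additive : semi_sigma_additive cons_measure.
Proof.
move=> A mA tA mUA; rewrite /cons_measure /pushforward preimage_bigcup.
have mp B : measurable B -> measurable (@cons_pair n @^-1` B).
  by move=> mB; rewrite -[X in measurable X]setTI; exact: measurable_cons_pair.
apply: (measure_semi_sigma_additive (s := lebesgue_measure \x nu)).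
- by move=> k; exact: mp.
- apply/trivIsetP => /= i j _ _ ij; rewrite -preimage_setI.
  by move/trivIsetP : tA => /(_ _ _ _ _ ij) ->//; rewrite preimage_set0.
- by rewrite -preimage_bigcup; exact: mp.
Qed.

HB.instance Definition _ := isMeasure.Build _ _ _ cons_measure
  cons_measure0 cons_measure_ge0 cons_measure_sigma_additive.

Lemma cons_measureX (A : set R) (B : set (n.-tuple R)) :
  measurable A -> measurable B ->
  cons_measure [set x | A (thead x) /\ B [tuple of behead x]] =
  lebesgue_measure A * nu B.
Proof.
move=> mA mB; rewrite -product_measure1E//; congr (product_measure1 _ _ _).
apply/seteqP; split=> -[a b] /=; rewrite /cons_pair theadE /=.
  by move=> [? Bb]; split => //=; congr B : Bb; exact: val_inj.
by move=> [? Bb]; split => //=; congr B : Bb; exact: val_inj.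
Qed.

Let cons_measure_sigma_finite : sigma_finite [set: n.+1.-tuple R] cons_measure.
Proof.
have /sigma_finiteP[A [AT And mA]] :=
  sigma_finiteT (@lebesgue_measure R).
have /sigma_finiteP[B [BT Bnd mB]] := sigma_finiteT nu.
exists (fun k => [set x | A k (thead x) /\ B k [tuple of behead x]]).
  apply/esym; rewrite -subTset => x _.
  have : [set: R] (thead x) by []. rewrite {1}AT => -[i _ Ai].
  have : [set: n.-tuple R] [tuple of behead x] by [].
  rewrite {1}BT => -[j _ Bj].
  exists (maxn i j) => //=; split.
  - by apply: (subsetPset _ _ (And _ _ (leq_maxl i j))).
  - by apply: (subsetPset _ _ (Bnd _ _ (leq_maxr i j))).
move=> k; split; last first.
  have [[mAk Ak] [mBk Bk]] := (mA k, mB k).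
  by rewrite cons_measureX//; apply: lte_mul_pinfty; rewrite ?ge0_fin_numE.
have -> : [set x : n.+1.-tuple R | A k (thead x) /\ B k [tuple of behead x]] =
    ((@tnth n.+1 R)^~ ord0 @^-1` A k) `&`
    ((fun x : n.+1.-tuple R => [tuple of behead x]) @^-1` B k) by [].
apply: measurableI; rewrite -[X in measurable X]setTI.
- by apply: measurable_tnth => //; exact: (mA k).1.
- by apply: measurable_behead => //; exact: (mB k).1.
Qed.

HB.instance Definition _ := @Measure_isSigmaFinite.Build _ _ _ cons_measure
  cons_measure_sigma_finite.

End step.

Fixpoint lebesgue_measure_n n : {sigma_finite_measure set (n.-tuple R) -> \bar R} :=
  match n with
  | 0 => dirac ([tuple] : 0.-tuple R)
  | n.+1 => cons_measure (lebesgue_measure_n n)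
  end.

Lemma lebesgue_measure_n_box n (A : 'I_n -> set R) :
  (forall i, measurable (A i)) ->
  lebesgue_measure_n n [set x | forall i, A i (tnth x i)] =
  \prod_(i < n) lebesgue_measure (A i).
Proof.
elim: n A => [|n IH] A mA.
  rewrite big_ord0 /= diracE mem_set//=; by case.
have mB : measurable [set x : n.-tuple R | forall i, A (lift ord0 i) (tnth x i)].
  have -> : [set x : n.-tuple R | forall i, A (lift ord0 i) (tnth x i)] =
      \bigcap_(i in [set: 'I_n]) ((@tnth n R)^~ i @^-1` A (lift ord0 i)).
    by apply/seteqP; split => x /= h i => [_|]; exact: h.
  apply: fin_bigcap_measurable => // i _; rewrite -[X in measurable X]setTI.
  exact: measurable_tnth.
rewrite big_ord_recl -IH; last by move=> i.
rewrite -cons_measureX//=; congr (cons_measure _ _).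
apply/seteqP; split => x /=.
  move=> h; split => [|i]; first exact: h.
  have := h (lift ord0 i).
  by rewrite [x]tuple_eta tnthS; congr (A _ (tnth _ _)); exact: val_inj.
move=> [h0 h] i; case: (unliftP ord0 i) => [j|] ->//.
by have := h j; rewrite [x]tuple_eta tnthS; congr (A _ (tnth _ _)); exact: val_inj.
Qed.

End LebesgueMeasureRn.

(* One-sided calculus on the closed half-line [a, +oo): every limit is taken
   along points of the half-line, so the values of f on (-oo, a) are
   irrelevant and the derivative at a is the right derivative. *)
Section HalfLineCalculus.
Context {R : realType}.
Variable a : R.
Implicit Types (f : R -> R) (t : R).

Definition derivable_from f t :=
  cvg ((fun h => h^-1 * (f (t + h) - f t)) @ within [set h | a <= t + h] 0^').

Definition derive_from f t : R :=
  lim ((fun h => h^-1 * (f (t + h) - f t)) @ within [set h | a <= t + h] 0^').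

Definition nderive_from k f : R -> R := iter k derive_from f.

Definition Ck_from k f :=
  (forall j t, (j < k)%N -> a <= t -> derivable_from (nderive_from j f) t) /\
  {within `[a, +oo[, continuous (nderive_from k f)}.

Definition monotonic_from f :=
  {in `[a, +oo[ &, {homo f : x y / x <= y}} \/
  {in `[a, +oo[ &, {homo f : x y /~ x <= y}}.

End HalfLineCalculus.

(* Lets the little-o notation be used at +oo. *)
Canonical pinfty_filter_on (R : numFieldType) :=
  FilterType (pinfty_nbhs R) (@filter_filter R _ (@proper_pinfty_nbhs R)).

Section Coefficients.
Context {R : realType}.
Implicit Types (lam om rho mu Xi Th F : R -> R) (M : nat).

Local Notation leb := (@lebesgue_measure R).

Definition Lambda lam t : R := 1 + \int[leb]_(s in `[0, t]) lam s.

Definition condA1 M lam :=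
  [/\ Ck_from 0 M lam,
      forall t, 0 <= t -> 0 < lam t,
      forall t, 0 < t -> 0 < derive_from 0 lam t &
      exists c : nat -> R,
      [/\ forall k, 0 < c k,
          forall t, 0 <= t ->
            c 0 * (lam t / Lambda lam t) <= derive_from 0 lam t / lam t
              <= c 1 * (lam t / Lambda lam t) &
          forall k t, (1 <= k <= M)%N -> 0 <= t ->
            `|nderive_from 0 k lam t| <= c k * lam t * (lam t / Lambda lam t) ^+ k]].

Definition condTheta lam Th :=
  [/\ {within `[0, +oo[, continuous Th},
      {in `[0, +oo[ &, {homo Th : s t / s < t}},
      Th 0 = 1,
      forall t, 0 < t -> Th t < Lambda lam t &
      Th =o_+oo (Lambda lam)].

Definition condXi lam Xi Th :=
  [/\ forall t, 0 <= t -> 0 < Xi t,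
      monotonic_from 0 Xi,
      {within `[0, +oo[, continuous Xi} &
      exists C1 C2 : R, [/\ 0 < C1, 0 < C2 &
        forall t, 0 <= t -> C1 * Th t <= lam t * Xi t <= C2 * Lambda lam t]].

Definition condA2 M lam om Xi Th :=
  [/\ Ck_from 0 M om,
      exists c0 c1 : R, 0 < c0 /\ forall t, 0 <= t -> c0 <= om t <= c1,
      exists c : nat -> R, (forall k, 0 < c k) /\
        forall k t, (1 <= k <= M)%N -> 0 <= t ->
          `|nderive_from 0 k om t| <= c k * Xi t ^- k,
      condXi lam Xi Th & condTheta lam Th].

Definition condA3 lam om Th :=
  exists2 C3 : R, 0 < C3 & forall t, 0 <= t ->
    \int[leb]_(s in `[0, t]) (lam s * `|om s - 1|) <= C3 * Th t.

Definition condA4 M lam Xi Th :=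
  exists2 C4 : R, 0 < C4 & forall t, 0 <= t ->
    (\int[leb]_(s in `[t, +oo[) (lam s ^- M * Xi s ^- M.+1)%:E
       <= (C4 * Th t ^- M)%:E)%E.

(* F is a function of Lambda(t), hence lives on [1, +oo).  The second equation
   is one between extended reals: it includes the finiteness of the integral. *)
Definition condA5 lam Xi F :=
  [/\ forall s, 1 <= s -> derivable_from 1 F s,
      forall t, 0 <= t -> Xi t =
        F (Lambda lam t) / (lam t * Num.sqrt (derive_from 1 F (Lambda lam t))),
      forall t, 0 <= t -> ((F (Lambda lam t))^-1)%:E =
        (\int[leb]_(s in `[t, +oo[) ((lam s)^-1 * Xi s ^- 2)%:E)%E &
      F (Lambda lam t) @[t --> +oo] --> +oo].

Definition condB1 lam rho mu :=
  forall t, 0 <= t -> 0 < rho t /\ rho t = mu t * (lam t / Lambda lam t).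

Definition condB2 M lam mu :=
  Ck_from 0 M mu /\
  exists c : nat -> R, (forall k, 0 < c k) /\
    forall k t, (1 <= k <= M)%N -> 0 <= t ->
      `|nderive_from 0 k mu t| <= c k * mu t * (lam t / Lambda lam t) ^+ k.

Definition condB3 lam mu :=
  monotonic_from 0 (fun t => mu t / Lambda lam t) /\
  mu t @[t --> +oo] --> +oo.

Definition condB4 lam rho :=
  ~ leb.-integrable `[0, +oo[ (fun t => (lam t ^+ 2 / rho t)%:E).

Definition condB5 lam om rho mu Th :=
  (fun t => `|derive_from 0 (fun s => rho s * om s) t|)
    =o_+oo (fun t => (rho t * om t) ^+ 2) /\
  mu t * (Th t / Lambda lam t) @[t --> +oo] --> +oo.

Definition Blam lam rho t : R :=
  \int[leb]_(s in `[0, t]) (lam s ^+ 2 / rho s).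

Definition condB6 lam rho F :=
  exists2 C5 : R, 0 < C5 & forall t, 0 <= t ->
    Blam lam rho t <= C5 * F (Lambda lam t) ^+ 2.

End Coefficients.

Section FunctionSpaces.
Context {R : realType} {n : nat}.
Implicit Types (f g : n.-tuple R -> R[i]) (x xi : n.-tuple R) (p s r : R).

Local Notation leb := (@lebesgue_measure_n R n).

Definition dotv x y : R := \sum_(i < n) tnth x i * tnth y i.
Definition enorm x : R := Num.sqrt (dotv x x).

Definition cLnorm p f : \bar R :=
  ('N[leb]_(p%:E)[EFin \o (@Normc.normc R \o f)])%E.

Definition in_Lp p f :=
  [/\ measurable_fun setT (fun x => complex.Re (f x)),
      measurable_fun setT (fun x => complex.Im (f x)) &
      (cLnorm p f < +oo)%E].

Definition fourier_trunc r f xi : R[i] :=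
  let c := (2 * pi) `^ (- (n%:R / 2)) in
  let a x := complex.Re (f x) in let b x := complex.Im (f x) in
  let th x := dotv x xi in
  let ball := [set x | enorm x <= r] in
  (c * \int[leb]_(x in ball) (a x * cos (th x) + b x * sin (th x)))
  +i* (c * \int[leb]_(x in ball) (b x * cos (th x) - a x * sin (th x))).

(* g is (a representative of) the Plancherel transform of f in L^2: the L^2
   limit, as r -> oo, of the unitarily normalised integrals
   (2 pi)^(-n/2) int_{|x| <= r} f(x) exp(-i x.xi) dx. *)
Definition is_fourier f g :=
  [/\ in_Lp 2 f, in_Lp 2 g &
      cLnorm 2 (fun xi => g xi - fourier_trunc N%:R f xi) @[N --> \oo] --> 0%E].

(* The Plancherel transform is unique up to a null set, so each infimum below
   ranges over at most one value; it is +oo when f is not in L^2.  For s >= 0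
   one has H^s = {f | sobolev_norm s f < +oo}. *)
Definition sobolev_norm s f : \bar R :=
  ereal_inf [set cLnorm 2 (fun xi => ((1 + enorm xi ^+ 2) `^ (s / 2))%:C * g xi)
            | g in is_fourier f].

Definition dot_sobolev_norm s f : \bar R :=
  ereal_inf [set cLnorm 2 (fun xi => (enorm xi `^ s)%:C * g xi)
            | g in is_fourier f].

Definition LpHs_norm p s f : \bar R := (cLnorm p f + sobolev_norm s f)%E.

Definition in_LpHs p s f := in_Lp p f /\ (sobolev_norm s f < +oo)%E.

End FunctionSpaces.

Section Solutions.
Context {R : realType} {n : nat}.
Implicit Types (lam om rho : R -> R) (v : R -> R[i]).
Implicit Types (u ut uhat : R -> n.-tuple R -> R[i]).

Local Notation leb := (@lebesgue_measure_n R n).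

Definition cderivable v t :=
  derivable_from 0 (fun s => complex.Re (v s)) t /\
  derivable_from 0 (fun s => complex.Im (v s)) t.

Definition cderive v t : R[i] :=
  derive_from 0 (fun s => complex.Re (v s)) t
  +i* derive_from 0 (fun s => complex.Im (v s)) t.

(* u is given through its partial Fourier transform uhat, which for almost
   every frequency solves the transformed Cauchy problem. *)
Definition sobolev_solution lam om rho (u0 u1 : n.-tuple R -> R[i]) u uhat :=
  (forall t, 0 <= t -> is_fourier (u t) (uhat t)) /\
  exists u0hat u1hat, [/\ is_fourier u0 u0hat, is_fourier u1 u1hat &
  {ae leb, forall xi, let v t := uhat t xi in
    [/\ forall t, 0 <= t -> cderivable v t /\ cderivable (cderive v) t,
        forall t, 0 <= t ->
          cderive (cderive v) t
          + (lam t ^+ 2 * om t ^+ 2 * enorm xi ^+ 2)%:C * v t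
          + (rho t * om t)%:C * cderive v t = 0,
        v 0 = u0hat xi &
        cderive v 0 = u1hat xi]}].

(* ut is the time derivative of the function with partial transform uhat. *)
Definition time_derivative uhat ut :=
  forall t, 0 <= t -> exists2 w, is_fourier (ut t) w &
    {ae leb, forall xi, w xi = cderive (fun s => uhat s xi) t}.

End Solutions.

(* Main.v *)
Require Import Defs.
From HB Require Import structures.
From mathcomp Require Import all_boot all_order all_algebra.
From mathcomp Require Import all_classical all_reals all_analysis.
From mathcomp Require Import measurable_realfun.
From mathcomp.real_closed Require Import complex.
From mathcomp Require Import ring lra.
Set Implicit Arguments.
Unset Strict Implicit.
Unset Printing Implicit Defensive.
Import Order.TTheory GRing.Theory Num.Theory.
Import numFieldNormedType.Exports.
Local Open Scope classical_set_scope.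
Local Open Scope ring_scope.

(** The equation is damped so strongly that it behaves like the heat equation
    [b u_t = lam^2 om^2 Delta u] with [b = rho om], whose frequency [xi] decays like
    [exp (- c |xi|^2 B)] where [B = Blam lam rho]. The proof makes this precise with
    polynomial instead of exponential decay, which is all that the estimates need.

    Fixed frequency. Put [k2 = |xi|^2] and [a2 = k2 lam^2 om^2], so that
    [y'' + b y' + a2 y = 0]. As [b'] is small against [b^2] for large times, the
    equation [q' = b q - 1] has a solution close to [1 / b] ([damping_multiplier]), and
    [y + q y'] then has the derivative [- q a2 y]. The functional
    [(y + q y')^2 / 2 + q^2 y'^2 / 2 + q^2 a2 y^2] decreases at a rate which leaves room
    for the factor [1 / (1 + k2 lam^2 / rho^2)], responsible for the gain of one
    derivative on the velocity, and for the weight [(K + min 1 k2 * B)^N]. It can be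
    used for all frequencies and all large times, without a division of the phase
    space into zones ([amplitude_decay]). The velocity follows from a comparison
    argument with the amplitude as source ([velocity_decay]), bounded times from
    Gronwall's inequality, and together they give [frequency_estimate]: decay of any
    order [N] in [1 + min 1 k2 * B].

    Data in L^m. The usual argument combines the Hausdorff-Young and the Hoelder
    inequality to bound the low frequencies in L^2. Here both are replaced by
    [fourier_weighted], a bound by [S^(- n (1/m - 1/2)) |f|_m^2] for the integral of
    [|f^|^2] against the product weight [\prod_i 1 / (1 + S xi_i^2)]. It is obtained
    by splitting [f] at a height depending on [S]: the transform of the large part
    is bounded, and the small part is in L^2. For the latter the inequality
    [|f^|_2 <= C |f|_2] is needed for integrable [f]; it is proved in [bessel] by the
    TT* method, since the integral of [|f^|^2] against a window [V] is a quadratic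
    form in [f] with kernel the transform of [V], to which Schur's test applies
    uniformly in the size of the window.

    Conclusion. Take [S = 1 + B]. For [k2 <= 1] the factor [k2^sigma] times the decay at
    frequency [k2] is at most [S^(-sigma)] times the product weight; for [k2 > 1] the
    decay is [S^(-N)] and the Sobolev norms of the data absorb the powers of [k2]
    ([displacement_splitting], [velocity_splitting]). Integrating over the
    frequencies gives both estimates ([norm_of_frequency_bound]). *)

(** * Calculus on the half-line *)

Section PointwiseDerivatives.
Context {R : realType}.
Implicit Types (f g : R -> R) (x : R).

Lemma is_derive_mul f g x (df dg : R) : is_derive x 1 f df -> is_derive x 1 g dg ->
  is_derive x 1 (fun t => f t * g t) (df * g x + f x * dg).
Proof.
move=> hf hg; have h := is_deriveM hf hg.
suff -> : df * g x + f x * dg = f x *: dg + g x *: df by exact: h.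
by rewrite /GRing.scale /=; ring.
Qed.

Lemma is_derive_add f g x (df dg : R) : is_derive x 1 f df -> is_derive x 1 g dg ->
  is_derive x 1 (fun t => f t + g t) (df + dg).
Proof. by move=> hf hg; have h := is_deriveD hf hg. Qed.

Lemma is_derive_sub f g x (df dg : R) : is_derive x 1 f df -> is_derive x 1 g dg ->
  is_derive x 1 (fun t => f t - g t) (df - dg).
Proof. by move=> hf hg; have h := is_deriveB hf hg. Qed.

Lemma is_derive_const (c : R) x : is_derive x 1 (fun=> c) 0.
Proof. exact: is_derive_cst. Qed.

Lemma is_derive_pow f n x (df : R) : is_derive x 1 f df ->
  is_derive x 1 (fun t => f t ^+ n) (n%:R * f x ^+ n.-1 * df).
Proof.
move=> hf; have h := is_deriveX n hf.
have <- : f ^+ n = (fun t => f t ^+ n) by apply/funext => t; rewrite exprfctE.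
exact: h.
Qed.

Lemma is_derive_inv f x (df : R) : f x != 0 -> is_derive x 1 f df ->
  is_derive x 1 (fun t => (f t)^-1) (- df / f x ^+ 2).
Proof.
move=> f0 hf; have h := is_deriveV f0 hf.
suff -> : - df / f x ^+ 2 = - (f x) ^- 2 *: df by exact: h.
by rewrite /GRing.scale /=; field.
Qed.

Lemma is_derive_exp f x (df : R) : is_derive x 1 f df ->
  is_derive x 1 (fun t => expR (f t)) (expR (f x) * df).
Proof.
move=> hf.
have h : is_derive (f x) 1 (@expR R) (expR (f x)) by exact: is_derive_expR.
have := @is_derive1_comp R (@expR R) f x _ _ h hf.
by move=> k; apply: is_derive_eq k _; rewrite /GRing.scale /=; ring.
Qed.

Lemma derive_le0_nonincreasing f (df : R -> R) (a b : R) : a <= b ->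
  {within `[a, b], continuous f} ->
  (forall x, a < x < b -> is_derive x 1 f (df x)) ->
  (forall x, a < x < b -> df x <= 0) -> f b <= f a.
Proof.
move=> ab cf hd hle.
have hx x : x \in `]a, b[ -> a < x < b by rewrite in_itv.
apply: (@ler0_derive1_le_cc R f a b) => //; rewrite ?in_itv /= ?lexx ?ab//.
- by move=> x /hx xab; have [] := hd _ xab.
- move=> x /hx xab; rewrite derive1E.
  by have [_ ->] := hd _ xab; exact: hle.
Qed.

Lemma is_derive_continuous f x (df : R) : is_derive x 1 f df -> {for x, continuous f}.
Proof. by move=> [hd _]; apply: differentiable_continuous; exact/derivable1_diffP. Qed.

End PointwiseDerivatives.

Section WithinContinuous.
Context {R : realType}.
Implicit Types (A : set R) (f g : R -> R).

Lemma within_continuous_cst A (c : R) : {within A, continuous (fun=> c)}.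
Proof. by move=> x; exact: cst_continuous. Qed.

Lemma within_continuous_mul A f g : {within A, continuous f} ->
  {within A, continuous g} -> {within A, continuous (fun x => f x * g x)}.
Proof. by move=> cf cg x; apply: continuousM; [exact: cf|exact: cg]. Qed.

Lemma within_continuous_add A f g : {within A, continuous f} ->
  {within A, continuous g} -> {within A, continuous (fun x => f x + g x)}.
Proof. by move=> cf cg x; apply: continuousD; [exact: cf|exact: cg]. Qed.

Lemma within_continuous_opp A f : {within A, continuous f} ->
  {within A, continuous (fun x => - f x)}.
Proof. by move=> cf x; apply: continuousN; exact: cf. Qed.

Lemma within_continuous_sub A f g : {within A, continuous f} ->
  {within A, continuous g} -> {within A, continuous (fun x => f x - g x)}.
Proof. by move=> cf cg; apply/within_continuous_add/within_continuous_opp. Qed.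

Lemma within_continuous_exp A f : {within A, continuous f} ->
  {within A, continuous (fun x => expR (f x))}.
Proof. by move=> cf x; apply: continuous_comp; [exact: cf|exact: continuous_expR]. Qed.

End WithinContinuous.

Section HalfLine.
Context {R : realType}.
Implicit Types (f g : R -> R) (t : R).

Local Notation leb := (@lebesgue_measure R).

(** At an interior point the half-line is a neighbourhood, so the one-sided
    notions reduce to the two-sided ones. *)
Lemma within_derivable_from_nbhs t : 0 < t ->
  within [set h | 0 <= t + h] 0^' = (0 : R)^'.
Proof.
move=> t0; apply/funext => P; apply/propext; split.
- rewrite /within /= => h.
  have hn : \forall h \near (0 : R)^', 0 <= t + h.
    near=> h1; rewrite -lerBlDl sub0r.
    have : `|h1| < t by near: h1; exact: dnbhs0_lt.
    by rewrite ltr_norml => /andP[+ _] => /ltW.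
  near=> x; near: x.
  by apply: filterS2 h hn => x; apply.
- by move=> h; apply: filterS h => x.
Unshelve. all: by end_near. Qed.

Lemma difference_quotientE f t :
  (fun h => h^-1 *: ((f \o shift t) (h *: (1 : R)) - f t)) =
  (fun h => h^-1 * (f (t + h) - f t)).
Proof. by apply/funext => h; rewrite /= /GRing.scale /= mulr1 [h + t]addrC. Qed.

Lemma derive_fromE f t : 0 < t -> derive_from 0 f t = 'D_1 f t.
Proof.
by move=> t0; rewrite /derive_from within_derivable_from_nbhs// /derive difference_quotientE.
Qed.

Lemma derivable_fromE f t : 0 < t -> derivable_from 0 f t = derivable f t 1.
Proof.
by move=> t0; rewrite /derivable_from (within_derivable_from_nbhs t0) -difference_quotientE.
Qed.

Lemma derivable_from_is_derive f t : 0 < t -> derivable_from 0 f t ->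
  is_derive t 1 f (derive_from 0 f t).
Proof. by move=> t0; rewrite derivable_fromE// derive_fromE//; exact: derivableP. Qed.

Lemma is_derive_derive_from f t (df : R) : 0 < t -> is_derive t 1 f df ->
  derive_from 0 f t = df.
Proof. by move=> t0 [_ <-]; rewrite derive_fromE. Qed.

Lemma derivable_from_cvg_right f : derivable_from 0 f 0 -> f x @[x --> 0^'+] --> f 0.
Proof.
move=> cf.
have cf' : (fun h => h^-1 * (f h - f 0)) @ 0^'+ --> derive_from 0 f 0.
  rewrite /derivable_from /derive_from in cf *.
  move: cf; under eq_fun do rewrite add0r.
  move=> cf.
  apply: cvg_trans cf; apply: cvg_app => P [e /= e0 he]; exists e => //= x xe x0.
  apply: he => //=; last by rewrite add0r ltW.
  by rewrite gt_eqF.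
have c0 : (fun h : R => h) @ 0^'+ --> (0 : R) by apply: cvg_at_right_filter; exact: cvg_id.
have : (fun h => h * (h^-1 * (f h - f 0)) + f 0) @ 0^'+ --> 0 * derive_from 0 f 0 + f 0.
  by apply: cvgD; [exact: cvgM|exact: cvg_cst].
rewrite mul0r add0r; apply: cvg_trans; apply: near_eq_cvg; near=> h.
have h0 : h != 0 by near: h; exact: nbhs_right_neq.
by rewrite /=; field.
Unshelve. all: by end_near. Qed.

Lemma derivable_from_continuous f : (forall t, 0 <= t -> derivable_from 0 f t) ->
  {within `[0, +oo[, continuous f}.
Proof.
move=> hd; apply/continuous_within_itvcyP; split.
  move=> x; rewrite in_itv /= andbT => x0.
  exact: is_derive_continuous (derivable_from_is_derive x0 (hd _ (ltW x0))).
exact/derivable_from_cvg_right/hd.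
Qed.

Lemma continuous_half_line_integrable f a b : 0 <= a ->
  {within `[0, +oo[, continuous f} -> leb.-integrable `[a, b] (EFin \o f).
Proof.
move=> a0 cf; apply: continuous_compact_integrable; first exact: segment_compact.
apply: continuous_subspaceW cf => x /=; rewrite !in_itv /= andbT => /andP[ax _].
exact: le_trans a0 ax.
Qed.

Lemma continuous_half_line_at f t : {within `[0, +oo[, continuous f} -> 0 < t ->
  {for t, continuous f}.
Proof.
by move=> /continuous_within_itvcyP[+ _] t0; apply; rewrite in_itv /= t0.
Qed.

Lemma is_derive_half_line_integral f t : {within `[0, +oo[, continuous f} -> 0 < t ->
  is_derive t 1 (fun x => \int[leb]_(s in `[0, x]) f s) (f t).
Proof.
move=> cf t0.
have tt1 : t < t + 1 by rewrite ltrDl.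
have [] := @continuous_FTC1_closed R f 0 t (t + 1) tt1
  (continuous_half_line_integrable (t + 1) (lexx 0) cf) t0 (continuous_half_line_at cf t0).
by rewrite derive1E => d1 d2; split.
Qed.

Lemma continuous_half_line_integral f : {within `[0, +oo[, continuous f} ->
  {within `[0, +oo[, continuous (fun x => \int[leb]_(s in `[0, x]) f s)}.
Proof.
move=> cf; apply/continuous_within_itvcyP; split.
  move=> x; rewrite in_itv /= andbT => x0.
  exact: is_derive_continuous (is_derive_half_line_integral cf x0).
rewrite set_itv1 Rintegral_set1; apply: cvg_at_right_filter.
have := @parameterized_integral_cvg_left R 0 1 f ltr01
  (continuous_half_line_integrable 1 (lexx 0) cf).
exact.
Qed.

End HalfLine.

(** * An exact multiplier for the damping *)

Section MoreDerivatives.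
Context {R : realType}.

Lemma is_derive_val (f : R -> R) (x d d' : R) :
  is_derive x 1 f d -> d = d' -> is_derive x 1 f d'.
Proof. by move=> h <-. Qed.

(** The logarithmic form of the power rule is uniform in [N], whereas the
    exponent [N.-1] would force a case split. *)
Lemma is_derive_pow_log (f : R -> R) (N : nat) (x df : R) : f x != 0 ->
  is_derive x 1 f df ->
  is_derive x 1 (fun t => f t ^+ N) (N%:R * (df / f x) * f x ^+ N).
Proof.
move=> f0 hf; apply: is_derive_val (is_derive_pow N hf) _.
by case: N => [|N]; rewrite ?mul0r//= exprS; field.
Qed.

Lemma is_derive_on_continuous (f df : R -> R) (a b : R) :
  (forall x, a <= x <= b -> is_derive x 1 f (df x)) -> {within `[a, b], continuous f}.
Proof.
move=> h; apply: derivable_within_continuous => x; rewrite in_itv /= => xab.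
by have [] := h _ xab.
Qed.

End MoreDerivatives.

(** The rules for explicit abstractions let unification compute a derivative as
    an existential variable, which [is_derive_val] then compares with the
    intended closed form. *)
Ltac derive_step :=
  first [ eassumption | notypeclasses refine (is_derive_const _ _)
        | notypeclasses refine (is_derive_mul _ _)
        | notypeclasses refine (is_derive_sub _ _)
        | notypeclasses refine (is_derive_add _ _)
        | notypeclasses refine (is_derive_pow _ _)
        | notypeclasses refine (is_derive_exp _) ].

Section Multiplier.
Context {R : realType}.
Variables (b db : R -> R) (T T1 : R).
Hypotheses (T0 : 0 < T) (TT1 : T <= T1).
Hypothesis cb : {within `[0, +oo[, continuous b}.
Hypothesis b0 : forall t : R, 0 <= t -> 0 < b t.
Hypothesis hdb : forall t : R, T <= t -> is_derive t 1 b (db t).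
Hypothesis slow : forall t : R, T <= t -> `|db t| <= b t ^+ 2 / 16.

Lemma antiderivative_exists (f : R -> R) : {within `[0, +oo[, continuous f} ->
  exists F : R -> R, {within `[0, +oo[, continuous F} /\
    forall t : R, 0 < t -> is_derive t 1 F (f t).
Proof.
move=> cf; eexists; split; first exact: continuous_half_line_integral cf.
by move=> t t0; exact: is_derive_half_line_integral.
Qed.

(** Along solutions of [y'' + b y' + a2 y = 0] the equation [q' = b q - 1] gives
    [(y + q y')' = - a2 q y] without any error term. Its solutions diverge
    exponentially from [1 / b] forwards in time, hence stay close to [1 / b] when
    solved backwards from [q T1 = 1 / b T1]: as [b'] is small against [b ^+ 2],
    the comparison functions [e / b] with [e] slightly below or above [1] are
    barriers. *)
Lemma damping_multiplier : exists q : R -> R,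
  [/\ forall t : R, T <= t -> is_derive t 1 q (b t * q t - 1),
      q T1 = (b T1)^-1 &
      forall t : R, T <= t <= T1 -> 7/8 <= b t * q t <= 9/8].
Proof.
have [beta [cbeta dbeta]] := antiderivative_exists cb.
have [G [_ dG]] : exists G : R -> R, {within `[0, +oo[, continuous G} /\
    forall t : R, 0 < t -> is_derive t 1 G (expR (- beta t)).
  apply: (@antiderivative_exists (fun t => expR (- beta t))).
  move=> x; apply: continuous_comp; last exact: continuous_expR.
  by apply: continuousN; exact: cbeta.
pose c := expR (- beta T1) / b T1 + G T1.
pose q t := expR (beta t) * (c - G t).
have posT t : T <= t -> 0 < t by move=> Tt; exact: lt_le_trans T0 Tt.
have eN t : expR (beta t) * expR (- beta t) = 1 by rewrite -expRD subrr expR0.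
have dq t : T <= t -> is_derive t 1 q (b t * q t - 1).
  move=> Tt; have t0 := posT _ Tt; have := dbeta _ t0; have := dG _ t0 => h1 h2.
  notypeclasses refine (is_derive_val _ _); first by rewrite /q; repeat derive_step.
  by rewrite /= -[in RHS](eN t) /q; ring.
have qT1 : q T1 = (b T1)^-1.
  by rewrite /q /c addrK mulrA eN mul1r.
exists q; split => // t /andP[Tt tT1].
have bt t' : T <= t' -> 0 < b t' by move=> h; apply/b0/ltW/posT.
have bT1 := bt _ TT1.
(* [exp (- beta)] is an integrating factor for [q - e / b]. *)
pose phi e s := (q s - e * (b s)^-1) * expR (- beta s).
have dphi e s : T <= s -> is_derive s 1 (phi e)
    ((e - 1 + e * (db s / b s ^+ 2)) * expR (- beta s)).
  move=> Ts; have s0 := posT _ Ts; have h1 := dq _ Ts; have h2 := dbeta _ s0.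
  have bs := bt _ Ts.
  have h3 := is_derive_inv (lt0r_neq0 bs) (hdb Ts).
  have h4 : is_derive s 1 (fun s => - beta s) (- b s) by exact: is_deriveN.
  notypeclasses refine (is_derive_val _ _); first by rewrite /phi; repeat derive_step.
  by rewrite /=; field; rewrite lt0r_neq0.
have small s : T <= s -> -(1/16) <= db s / b s ^+ 2 <= 1/16.
  move=> Ts; have bs := bt _ Ts; rewrite -ler_norml normrM.
  rewrite [`|(_ ^+ 2)^-1|]ger0_norm ?invr_ge0 ?sqr_ge0//.
  by rewrite ler_pdivrMr ?exprn_gt0//; have := slow Ts; lra.
have tT b' : t < b' < T1 -> T <= b' by move=> /andP[/ltW h _]; exact: le_trans Tt h.
have cphi e : {within `[t, T1], continuous (phi e)}.
  apply: is_derive_on_continuous => x /andP[tx _].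
  by apply: dphi; exact: le_trans Tt tx.
have eb s : 0 < expR (- beta s) := expR_gt0 _.
have bt0 := bt _ Tt.
apply/andP; split.
- have : phi (7/8) T1 <= phi (7/8) t.
    apply: (derive_le0_nonincreasing tT1 (cphi _)) => [x /tT Tx|x /tT Tx]; first exact: dphi.
    rewrite pmulr_lle0//; have := small _ Tx; lra.
  have : 0 <= phi (7/8) T1.
    rewrite /phi pmulr_lge0// qT1; have : 0 <= (b T1)^-1 by rewrite invr_ge0 ltW.
    lra.
  move=> h1 h2; have := le_trans h1 h2; rewrite /phi pmulr_lge0//.
  by rewrite subr_ge0 ler_pdivrMr// [q t * _]mulrC.
- have : - phi (9/8) T1 <= - phi (9/8) t.
    apply: (derive_le0_nonincreasing (f := fun s => - phi (9/8) s) tT1) => [|x /tT Tx|x /tT Tx].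
    + by move=> x; apply: continuousN; exact: cphi.
    + exact/is_deriveN/dphi.
    + rewrite oppr_le0 pmulr_lge0//; have := small _ Tx; lra.
  have : phi (9/8) T1 <= 0.
    rewrite /phi pmulr_lle0// qT1; have : 0 <= (b T1)^-1 by rewrite invr_ge0 ltW.
    lra.
  move=> h1 h2; have : phi (9/8) t <= 0 by lra.
  by rewrite /phi pmulr_lle0// subr_le0 ler_pdivlMr// [q t * _]mulrC.
Qed.

End Multiplier.

(** * Decay of a slowly varying damped oscillator *)

Ltac nonneg :=
  repeat (first [ done | exact: ltW | exact: sqr_ge0 | exact: exprn_ge0
                | apply: mulr_ge0 | apply: divr_ge0 | apply: addr_ge0
                | rewrite invr_ge0 ]).

Section OscillatorDecay.
Context {R : realType}.

Lemma eq_ler (x y : R) : x = y -> x <= y.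
Proof. by move=> ->. Qed.

(** Half of the dissipation [q * (p ^+ 2 + a2 * y ^+ 2)], with
    [a2 = om ^+ 2 * rho * L], absorbs [s] times the energy under two conditions of
    different nature. That [s] lies below the damping rate takes care of the terms
    carrying [q ^+ 2]; that it lies below the parabolic rate [L] takes care of
    the bare [y ^+ 2]. *)
Lemma energy_absorption (y p q rho om L s c0 : R) :
  0 < q -> 0 < c0 -> c0 <= om -> 0 < rho -> 0 <= L ->
  7/8 <= rho * om * q <= 9/8 -> s <= c0 / 8 * rho -> s <= c0 / 8 * L ->
  s * ((y + q * p) ^+ 2 / 2 + q ^+ 2 * p ^+ 2 / 2 + q ^+ 2 * (om ^+ 2 * rho * L) * y ^+ 2)
  <= q * (p ^+ 2 + om ^+ 2 * rho * L * y ^+ 2) / 2.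
Proof.
move=> q0 c00 com r0 L0 /andP[h1 h2] s1 s2.
have om0 := lt_le_trans c00 com.
set a2 := om ^+ 2 * rho * L.
have a20 : 0 <= a2 by rewrite /a2 !mulr_ge0 ?sqr_ge0// ltW.
have y0 : 0 <= y ^+ 2 := sqr_ge0 _.
have p0 : 0 <= p ^+ 2 := sqr_ge0 _.
have H0 : 0 <= (y + q * p) ^+ 2 / 2 + q ^+ 2 * p ^+ 2 / 2 + q ^+ 2 * a2 * y ^+ 2.
  have h0 : 0 <= q ^+ 2 * a2 by nonneg.
  have h3 : 0 <= q ^+ 2 * p ^+ 2 by nonneg.
  have h4 : 0 <= q ^+ 2 * a2 * y ^+ 2 by nonneg.
  have := sqr_ge0 (y + q * p); lra.
have R0 : 0 <= q * (p ^+ 2 + a2 * y ^+ 2) / 2.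
  have h0 : 0 <= a2 * y ^+ 2 by nonneg.
  by rewrite divr_ge0// mulr_ge0 ?(ltW q0)// addr_ge0.
have [sneg|spos] := leP s 0; first by apply: le_trans R0; rewrite mulr_le0_ge0.
have Hle : (y + q * p) ^+ 2 / 2 + q ^+ 2 * p ^+ 2 / 2 + q ^+ 2 * a2 * y ^+ 2 <=
    y ^+ 2 + 3/2 * (q ^+ 2 * p ^+ 2) + q ^+ 2 * a2 * y ^+ 2.
  have := sqr_ge0 (y - q * p); nra.
apply: le_trans (ler_wpM2l (ltW spos) Hle) _.
(* As [rho * om * q] is close to one, [s * q] is small and [s] is small against [q * a2]. *)
have k1 : s * q <= 9/64.
  apply: (@le_trans _ _ (c0 / 8 * rho * q)); first by rewrite ler_wpM2r// ltW.
  have : c0 * (rho * q) <= om * (rho * q) by rewrite ler_wpM2r// mulr_ge0 ?ltW.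
  lra.
have k2 : s <= q * a2 / 7.
  apply: le_trans s2 _.
  have : c0 * L * (7/8) <= om * L * (rho * om * q).
    apply: ler_pM => //; first by nonneg.
    by rewrite ler_wpM2r.
  rewrite /a2; lra.
have e1 : s * y ^+ 2 <= q * a2 / 7 * y ^+ 2 by rewrite ler_wpM2r.
have e2 : s * q * (q * p ^+ 2) <= 9/64 * (q * p ^+ 2).
  by rewrite ler_wpM2r// mulr_ge0// ltW.
have e3 : s * q * (q * a2 * y ^+ 2) <= 9/64 * (q * a2 * y ^+ 2).
  by apply: ler_wpM2r => //; nonneg.
have f1 : 0 <= q * a2 * y ^+ 2 by nonneg.
have f2 : 0 <= q * p ^+ 2 by nonneg.
nra.
Qed.

Variables (lam om rho B dlam dom drho : R -> R) (c0 c1 : R) (N : nat) (K T : R).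
Hypotheses (T0 : 0 < T) (c00 : 0 < c0).
Let b t := rho t * om t.
Let db t := drho t * om t + rho t * dom t.
Hypothesis cb : {within `[0, +oo[, continuous b}.
Hypothesis lam0 : forall t : R, 0 <= t -> 0 < lam t.
Hypothesis rho0 : forall t : R, 0 <= t -> 0 < rho t.
Hypothesis om0 : forall t : R, 0 <= t -> c0 <= om t <= c1.
Hypothesis B0 : forall t : R, 0 <= t -> 0 <= B t.
Hypothesis hlam : forall t : R, 0 < t -> is_derive t 1 lam (dlam t).
Hypothesis hom : forall t : R, 0 < t -> is_derive t 1 om (dom t).
Hypothesis hrho : forall t : R, 0 < t -> is_derive t 1 rho (drho t).
Hypothesis hB : forall t : R, 0 < t -> is_derive t 1 B (lam t ^+ 2 / rho t).
Hypothesis slow_b : forall t : R, T <= t -> `|db t| <= b t ^+ 2 / 16.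
Hypothesis slow_lam : forall t : R, T <= t -> `|dlam t| <= b t * lam t / 40.
Hypothesis slow_om : forall t : R, T <= t -> `|dom t| <= b t * om t / 40.
Hypothesis slow_r : forall t : R, T <= t ->
  `|dlam t * rho t - lam t * drho t| <= c0 / 32 * (rho t ^+ 2 * lam t).
Hypothesis Nr2 : forall t : R, T <= t ->
  N%:R * (lam t ^+ 2 / rho t ^+ 2) <= c0 / 16 * (1 + B t).
Hypothesis K1 : 1 <= K.
Hypothesis KN : N%:R <= c0 / 16 * K.

Variables (k2 : R) (y p : R -> R).
Hypothesis k20 : 0 <= k2.
Hypothesis hy : forall t : R, 0 < t -> is_derive t 1 y (p t).
Hypothesis hp : forall t : R, 0 < t ->
  is_derive t 1 p (- (b t * p t) - k2 * lam t ^+ 2 * om t ^+ 2 * y t).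

Let kt2 := Num.min 1 k2.
Let w k t := K + k * B t.
Let r2 t := (lam t / rho t) ^+ 2.
Let posT (t : R) : T <= t -> 0 < t. Proof. exact: lt_le_trans. Qed.

Let w0 k t : 0 <= k -> 0 <= t -> 0 < w k t.
Proof.
move=> k0 t0; rewrite /w; have : 0 <= k * B t by rewrite mulr_ge0// B0.
have := K1; lra.
Qed.

(** The rate of [w k ^+ N] stays below both thresholds of [energy_absorption]:
    below the damping because [N * r2] is dominated by [1 + B], below the
    parabolic rate because the offset [K] is of the order of [N]. *)
Lemma weight_rate k t : 0 <= k -> k <= 1 -> T <= t ->
  0 <= N%:R * (k * (lam t ^+ 2 / rho t) / w k t) /\
  N%:R * (k * (lam t ^+ 2 / rho t) / w k t) <= c0 / 16 * rho t /\
  N%:R * (k * (lam t ^+ 2 / rho t) / w k t) <= c0 / 16 * (k * (lam t ^+ 2 / rho t)).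
Proof.
move=> k0 k1 Tt; have t0 := ltW (posT Tt).
have wp := w0 k0 t0; have rp := rho0 t0; have lp := lam0 t0; have Bp := B0 t0.
have Lp : 0 <= lam t ^+ 2 / rho t by rewrite divr_ge0 ?sqr_ge0 ?ltW.
split; first by nonneg.
have -> : N%:R * (k * (lam t ^+ 2 / rho t) / w k t) =
  (N%:R * k * (lam t ^+ 2 / rho t)) / w k t by ring.
split; rewrite ler_pdivrMr//.
- have -> : N%:R * k * (lam t ^+ 2 / rho t) = k * rho t * (N%:R * (lam t ^+ 2 / rho t ^+ 2)).
    by field; rewrite lt0r_neq0.
  apply: le_trans (ler_wpM2l _ (Nr2 Tt)) _; first by nonneg.
  have -> : k * rho t * (c0 / 16 * (1 + B t)) = c0 / 16 * rho t * (k * (1 + B t)) by ring.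
  apply: ler_wpM2l; first by nonneg.
  by rewrite /w mulrDr mulr1 lerD2r; exact: le_trans k1 K1.
- have -> : N%:R * k * (lam t ^+ 2 / rho t) = k * (lam t ^+ 2 / rho t) * N%:R by ring.
  have -> : c0 / 16 * (k * (lam t ^+ 2 / rho t)) * w k t =
     k * (lam t ^+ 2 / rho t) * (c0 / 16 * w k t) by ring.
  apply: ler_wpM2l; first by nonneg.
  apply: le_trans KN _; apply: ler_wpM2l; first by nonneg.
  by rewrite /w lerDl mulr_ge0.
Qed.

Let X t := y t ^+ 2 + p t ^+ 2 / (b t ^+ 2 * (1 + r2 t * k2)).

(** The functional [H] of the proof is chosen so that
    [H' = - q * (p ^+ 2 + a2 * y ^+ 2)] up to terms carrying [b * q - 1] or the
    logarithmic derivative of [a2], both small. It works at all frequencies at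
    once. When [q = 1 / b] it is of the size of [(1 + r2 * k2) * y ^+ 2] plus
    [(p / b) ^+ 2]; multiplying it by [g = (1 + r2 * k2)^-1] therefore bounds [y]
    at the final time and, at the initial time, leaves in [X] a velocity that has
    gained one derivative. The slack in the energy inequality pays for the slow
    change of [g] and for the growing weight [w kt2 ^+ N], which encodes the
    decay. *)
Lemma amplitude_decay T1 : T <= T1 ->
  y T1 ^+ 2 <= 8 * (w kt2 T / w kt2 T1) ^+ N * X T.
Proof.
move=> TT1.
have kt0 : 0 <= kt2 by rewrite le_min ler01.
have kt1 : kt2 <= 1 by rewrite ge_min lexx.
have ktk : kt2 <= k2 by rewrite ge_min lexx orbT.
have bp t : 0 <= t -> 0 < b t.
  by move=> t0; rewrite mulr_gt0 ?rho0//; have /andP[+ _] := om0 t0; exact: lt_le_trans.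
have hb t : T <= t -> is_derive t 1 b (db t).
  move=> /posT t0; have h1 := hrho t0; have h2 := hom t0.
  exact: is_derive_mul.
have [q [hq qT1 bq]] := damping_multiplier T0 TT1 cb bp hb slow_b.
pose a2 t := k2 * (lam t ^+ 2 * om t ^+ 2).
pose H t := (y t + q t * p t) ^+ 2 / 2 + q t ^+ 2 * p t ^+ 2 / 2 + q t ^+ 2 * a2 t * y t ^+ 2.
pose g t := (1 + (lam t / rho t) ^+ 2 * k2)^-1.
have r20 t : 0 <= r2 t * k2 by nonneg.
have g0 t : 0 < g t by rewrite invr_gt0; have := r20 t; rewrite /r2; lra.
pose Phi t := H t * g t * w kt2 t ^+ N.
have dH t : T <= t -> is_derive t 1 H (- q t * (p t ^+ 2 + a2 t * y t ^+ 2) +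
   2 * ((b t * q t - 1) * q t * a2 t * y t ^+ 2 + q t ^+ 2 *
    (k2 * lam t * om t * (dlam t * om t + lam t * dom t)) * y t ^+ 2)).
  move=> Tt; have t0 := posT Tt.
  have h1 := hy t0; have h2 := hp t0; have h3 := hq _ Tt.
  have h4 := hlam t0; have h5 := hom t0.
  notypeclasses refine (is_derive_val _ _); first by rewrite /H /a2; repeat derive_step.
  by rewrite /= /a2; field.
have dg t : T <= t -> is_derive t 1 g
   (g t * (- 2 * k2 * (lam t / rho t) * ((dlam t * rho t - lam t * drho t) / rho t ^+ 2) * g t)).
  move=> Tt; have t0 := posT Tt; have rp := rho0 (ltW t0).
  have h1 := hlam t0; have h2 := is_derive_inv (lt0r_neq0 rp) (hrho t0).
  have gt0 : 1 + (lam t / rho t) ^+ 2 * k2 != 0.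
    by apply: lt0r_neq0; have := r20 t; rewrite /r2; lra.
  notypeclasses refine (is_derive_val _ _).
    notypeclasses refine (@is_derive_inv R (fun s => 1 + (lam s / rho s) ^+ 2 * k2) t _ gt0 _).
    by repeat derive_step.
  rewrite /= /g; field; rewrite lt0r_neq0//=.
  have -> : rho t ^+ 2 + lam t ^+ 2 * k2 = (1 + (lam t / rho t) ^+ 2 * k2) * rho t ^+ 2.
    by field; rewrite lt0r_neq0.
  by rewrite mulf_neq0// sqrf_eq0 lt0r_neq0.
have dw t : T <= t -> is_derive t 1 (fun s => w kt2 s ^+ N)
   (N%:R * (kt2 * (lam t ^+ 2 / rho t) / w kt2 t) * w kt2 t ^+ N).
  move=> Tt; have t0 := posT Tt.
  apply: is_derive_pow_log; first by rewrite lt0r_neq0// w0// ltW.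
  have h1 := hB t0.
  notypeclasses refine (is_derive_val _ _); first by rewrite /w; repeat derive_step.
  by rewrite /=; ring.
pose s t := - 2 * k2 * (lam t / rho t) * ((dlam t * rho t - lam t * drho t) / rho t ^+ 2) * g t
   + N%:R * (kt2 * (lam t ^+ 2 / rho t) / w kt2 t).
pose dHt t := - q t * (p t ^+ 2 + a2 t * y t ^+ 2) +
   2 * ((b t * q t - 1) * q t * a2 t * y t ^+ 2 + q t ^+ 2 *
    (k2 * lam t * om t * (dlam t * om t + lam t * dom t)) * y t ^+ 2).
have dPhi t : T <= t -> is_derive t 1 Phi ((dHt t + s t * H t) * (g t * w kt2 t ^+ N)).
  move=> Tt; have h1 := dH _ Tt; have h2 := dg _ Tt; have h3 := dw _ Tt.
  notypeclasses refine (is_derive_val _ _); first by rewrite /Phi; repeat derive_step.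
  by rewrite /= /dHt /s; ring.
have qpos t : T <= t <= T1 -> 0 < q t.
  move=> tT; have /andP[Tt _] := tT; have := bp _ (ltW (posT Tt)).
  have /andP[h _] := bq _ tT => bt.
  by rewrite -(pmulr_rgt0 _ bt); lra.
have Phile : Phi T1 <= Phi T.
  apply: (derive_le0_nonincreasing TT1).
  - by apply: is_derive_on_continuous => x /andP[Tx _]; exact: dPhi.
  - by move=> x /andP[/ltW Tx _]; exact: dPhi.
  move=> x /andP[/ltW Tx /ltW xT1]; have x0 := ltW (posT Tx).
  have lp := lam0 x0; have rp := rho0 x0; have bx := bp _ x0.
  have TxT : T <= x <= T1 by rewrite Tx.
  have qx := qpos _ TxT; have /andP[q1 q2] := bq _ TxT.
  have /andP[co _] := om0 x0; have op := lt_le_trans c00 co.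
  rewrite pmulr_lle0; last by rewrite mulr_gt0// exprn_gt0// w0.
  set L := k2 * (lam x ^+ 2 / rho x).
  have L0 : 0 <= L by rewrite mulr_ge0// divr_ge0 ?sqr_ge0// ltW.
  have a2E : a2 x = om x ^+ 2 * rho x * L.
    by rewrite /a2 /L; field; rewrite lt0r_neq0.
  have [w1 [w2 w3]] := weight_rate kt0 kt1 Tx.
  have w3' : N%:R * (kt2 * (lam x ^+ 2 / rho x) / w kt2 x) <= c0 / 16 * L.
    apply: le_trans w3 _; apply: ler_wpM2l; first by nonneg.
    by apply: ler_wpM2r => //; nonneg.
  (* [g] varies at most at the damping rate times [r2 * k2 * g], itself at most [1] and [r2 * k2]. *)
  set u := - 2 * k2 * (lam x / rho x) * ((dlam x * rho x - lam x * drho x) / rho x ^+ 2) * g x.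
  have uu : `|u| <= c0 / 16 * rho x * (r2 x * k2 * g x).
    have gx0 : 0 < g x := g0 x.
    rewrite /u -mulrA -[- 2 * k2 * _]mulrA !mulNr normrN.
    have -> : 2 * (k2 * (lam x / rho x)) * ((dlam x * rho x - lam x * drho x) / rho x ^+ 2 * g x) =
      (2 * k2 * (lam x / rho x) / rho x ^+ 2 * g x) * (dlam x * rho x - lam x * drho x) by ring.
    rewrite normrM ger0_norm; last first.
      by nonneg.
    apply: le_trans (ler_wpM2l _ (slow_r Tx)) _.
      by nonneg.
    by apply: eq_ler; rewrite /r2; field; rewrite lt0r_neq0.
  have g1 : r2 x * k2 * g x <= 1.
    by rewrite /g ler_pdivrMr ?mul1r /r2; have := r20 x; rewrite /r2; lra.
  have g2 : r2 x * k2 * g x <= r2 x * k2.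
    by rewrite ler_piMr ?r20// /g invf_le1; have := r20 x; rewrite /r2; lra.
  have s1 : s x <= c0 / 8 * rho x.
    rewrite /s -/u; have := ler_norm u.
    have : c0 / 16 * rho x * (r2 x * k2 * g x) <= c0 / 16 * rho x * 1.
      by apply: ler_wpM2l => //; nonneg.
    lra.
  have s2 : s x <= c0 / 8 * L.
    rewrite /s -/u; have := ler_norm u.
    have : c0 / 16 * rho x * (r2 x * k2 * g x) <= c0 / 16 * rho x * (r2 x * k2).
      by apply: ler_wpM2l => //; nonneg.
    have : rho x * (r2 x * k2) = L by rewrite /L /r2; field; rewrite lt0r_neq0.
    move=> e; rewrite -[c0 / 16 * _ * (r2 x * k2)]mulrA e; lra.
  have := energy_absorption (y x) (p x) qx c00 co rp L0 (bq _ TxT) s1 s2.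
  rewrite -a2E -/(H x) => hs.
  (* The error terms of [H'] take at most half of the dissipation. *)
  have a20 : 0 <= a2 x by rewrite a2E; nonneg.
  have y20 := sqr_ge0 (y x); have p20 := sqr_ge0 (p x).
  have e1 : (b x * q x - 1) * q x * a2 x * y x ^+ 2 <= 1/8 * (q x * a2 x * y x ^+ 2).
    have -> : (b x * q x - 1) * q x * a2 x * y x ^+ 2 =
      (b x * q x - 1) * (q x * a2 x * y x ^+ 2) by ring.
    apply: ler_wpM2r; last by lra.
    by nonneg.
  have e2 : q x ^+ 2 * (k2 * lam x * om x * (dlam x * om x + lam x * dom x)) * y x ^+ 2
      <= 9/160 * (q x * a2 x * y x ^+ 2).
    have m1 : dlam x * om x + lam x * dom x <= b x * lam x * om x / 20.
      have := le_trans (ler_norm _) (slow_lam Tx); have := le_trans (ler_norm _) (slow_om Tx).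
      move=> n1 n2.
      have := ler_wpM2r (ltW op) n2; have := ler_wpM2l (ltW lp) n1; lra.
    apply: (@le_trans _ _ (q x ^+ 2 * (k2 * lam x * om x * (b x * lam x * om x / 20)) * y x ^+ 2)).
      apply: ler_wpM2r => //; apply: ler_wpM2l; first exact: sqr_ge0.
      by apply: ler_wpM2l m1; nonneg.
    have -> : q x ^+ 2 * (k2 * lam x * om x * (b x * lam x * om x / 20)) * y x ^+ 2 =
      (b x * q x) / 20 * (q x * a2 x * y x ^+ 2) by rewrite /a2; ring.
    apply: ler_wpM2r; last by lra.
    by nonneg.
  have f1 : 0 <= q x * a2 x * y x ^+ 2 by nonneg.
  have f2 : 0 <= q x * p x ^+ 2 by nonneg.
  rewrite /dHt; lra.
have TT : T <= T <= T1 by rewrite lexx.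
have T10 : 0 <= T1 by apply: le_trans TT1; exact: ltW.
have wT := w0 kt0 (ltW T0); have wT1 := w0 kt0 T10.
(* At [T1] the multiplier is exactly [1 / b], hence [q ^+ 2 * a2 = r2 * k2] there. *)
have low : y T1 ^+ 2 / 4 * w kt2 T1 ^+ N <= Phi T1.
  rewrite /Phi; apply: ler_wpM2r; first by rewrite exprn_ge0// ltW.
  rewrite /g ler_pdivlMr; last by have := r20 T1; rewrite /r2; lra.
  have -> : H T1 = (y T1 + q T1 * p T1) ^+ 2 / 2 + q T1 ^+ 2 * p T1 ^+ 2 / 2 +
      r2 T1 * k2 * y T1 ^+ 2.
    rewrite /H; congr (_ + _ * _); rewrite qT1 /a2 /r2 /b; field.
    have := rho0 T10; have /andP[co _] := om0 T10; have := lt_le_trans c00 co.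
    by move=> /lt0r_neq0 -> /lt0r_neq0 ->.
  have : 0 <= r2 T1 * k2 * y T1 ^+ 2 by nonneg.
  rewrite -/(r2 T1).
  have := sqr_ge0 (y T1 / 2 + q T1 * p T1); nra.
have up : Phi T <= 2 * X T * w kt2 T ^+ N.
  rewrite /Phi; apply: ler_wpM2r; first by rewrite exprn_ge0// ltW.
  have bT := bp _ (ltW T0).
  have qT := qpos _ TT; have /andP[q1 q2] := bq _ TT.
  have qb : q T <= 9/8 / b T by rewrite ler_pdivlMr// mulrC.
  have q2b : q T ^+ 2 <= 81/64 / b T ^+ 2.
    apply: (@le_trans _ _ ((9/8 / b T) ^+ 2)).
      by rewrite ler_pXn2r ?nnegrE ?divr_ge0// ltW.
    by apply: eq_ler; field; rewrite lt0r_neq0.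
  have qa : q T ^+ 2 * a2 T <= 81/64 * (r2 T * k2).
    apply: le_trans (ler_wpM2r _ q2b) _.
      by rewrite /a2 mulr_ge0// mulr_ge0 ?sqr_ge0.
    apply: eq_ler; rewrite /a2 /r2 /b; field.
    have := rho0 (ltW T0); have /andP[co _] := om0 (ltW T0); have := lt_le_trans c00 co.
    by move=> /lt0r_neq0 -> /lt0r_neq0 ->.
  have y20 := sqr_ge0 (y T); have p20 := sqr_ge0 (p T).
  rewrite /g ler_pdivrMr; last by have := r20 T; rewrite /r2; lra.
  rewrite -/(r2 T).
  have -> : 2 * X T * (1 + r2 T * k2) = 2 * (1 + r2 T * k2) * y T ^+ 2 + 2 / b T ^+ 2 * p T ^+ 2.
    rewrite /X; field; rewrite lt0r_neq0//= -/(r2 T) lt0r_neq0//; have := r20 T; lra.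
  have m1 : q T ^+ 2 * p T ^+ 2 <= 81/64 / b T ^+ 2 * p T ^+ 2 by apply: ler_wpM2r.
  have m2 : q T ^+ 2 * a2 T * y T ^+ 2 <= 81/64 * (r2 T * k2) * y T ^+ 2 by apply: ler_wpM2r.
  have m3 : 0 <= p T ^+ 2 / b T ^+ 2 by rewrite divr_ge0// sqr_ge0.
  have m4 : 0 <= r2 T * k2 * y T ^+ 2 by nonneg.
  rewrite /H; have := sqr_ge0 (y T - q T * p T); nra.
have := le_trans low (le_trans Phile up).
rewrite exprMn exprVn => h.
have wN : 0 < w kt2 T1 ^+ N by rewrite exprn_gt0.
have -> : 8 * (w kt2 T ^+ N / w kt2 T1 ^+ N) * X T = 8 * w kt2 T ^+ N * X T / w kt2 T1 ^+ N.
  by ring.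
by rewrite ler_pdivlMr//; lra.
Qed.

(** The energy [E = (p / lam) ^+ 2 + om ^+ 2 * k2 * y ^+ 2] obeys
    [E' <= - b * E + 2 * b * om ^+ 2 * k2 * y ^+ 2]. By [amplitude_decay] the source
    is a multiple of the first weight, and both weights decay more slowly than
    [exp (- \int b / 2)], so that a combination of them is a supersolution. *)
Lemma velocity_decay T1 : T <= T1 ->
  p T1 ^+ 2 / lam T1 ^+ 2 <=
    32 * c1 ^+ 2 * k2 * X T * (w kt2 T / w kt2 T1) ^+ N +
    (p T ^+ 2 / lam T ^+ 2 + om T ^+ 2 * k2 * y T ^+ 2) * (w 1 T / w 1 T1) ^+ N.
Proof.
move=> TT1.
have [beta [_ dbeta]] := antiderivative_exists cb.
have kt0 : 0 <= kt2 by rewrite le_min ler01.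
have kt1 : kt2 <= 1 by rewrite ge_min lexx.
have T10 : 0 <= T1 by apply: le_trans TT1; exact: ltW.
pose E t := p t ^+ 2 * (lam t ^+ 2)^-1 + om t ^+ 2 * k2 * y t ^+ 2.
pose D k t := (w k T / w k t) ^+ N.
pose A := 32 * c1 ^+ 2 * k2 * X T.
pose S t := A * D kt2 t + E T * D 1 t.
pose Psi t := (E t - S t) * expR (beta t).
have bp t : 0 <= t -> 0 < b t.
  by move=> t0; rewrite mulr_gt0 ?rho0//; have /andP[+ _] := om0 t0; exact: lt_le_trans.
have X0 : 0 <= X T.
  rewrite addr_ge0 ?sqr_ge0// divr_ge0 ?sqr_ge0// mulr_ge0 ?sqr_ge0//.
  by rewrite addr_ge0// mulr_ge0 ?sqr_ge0.
have A0 : 0 <= A by rewrite /A; nonneg.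
have E0 t : 0 <= t -> 0 <= E t.
  by move=> t0; rewrite /E; apply: addr_ge0; nonneg.
have D0 k t : 0 <= k -> 0 <= t -> 0 <= D k t.
  by move=> k0 t0; rewrite /D; apply/exprn_ge0/divr_ge0; apply/ltW/w0 => //; exact: ltW.
have dE t : T <= t -> is_derive t 1 E
   (- 2 * (b t + dlam t / lam t) * (p t ^+ 2 / lam t ^+ 2) + 2 * om t * dom t * k2 * y t ^+ 2).
  move=> Tt; have t0 := posT Tt; have lp := lam0 (ltW t0).
  have h1 := hy t0; have h2 := hp t0; have h5 := hom t0.
  have l2 : lam t ^+ 2 != 0 by rewrite sqrf_eq0 lt0r_neq0.
  have h4 : is_derive t 1 (fun s => (lam s ^+ 2)^-1) (- (2 * lam t * dlam t) / (lam t ^+ 2) ^+ 2).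
    apply: (@is_derive_inv R (fun s => lam s ^+ 2)) => //.
    by apply: is_derive_val (is_derive_pow 2 (hlam t0)) _; rewrite /= expr1.
  notypeclasses refine (is_derive_val _ _); first by rewrite /E; repeat derive_step.
  by rewrite /=; field; rewrite lt0r_neq0.
have dD k t : 0 <= k -> T <= t -> is_derive t 1 (D k)
   (- (N%:R * (k * (lam t ^+ 2 / rho t) / w k t)) * D k t).
  move=> k0 Tt; have t0 := posT Tt.
  have wt := w0 k0 (ltW t0); have wT := w0 k0 (ltW T0).
  have h1 := hB t0.
  have h2 : is_derive t 1 (w k) (k * (lam t ^+ 2 / rho t)).
    notypeclasses refine (is_derive_val _ _); first by rewrite /w; repeat derive_step.
    by rewrite /=; ring.
  have h3 := is_derive_inv (lt0r_neq0 wt) h2.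
  have q0 : w k T / w k t != 0 by rewrite lt0r_neq0// divr_gt0.
  have h4 := is_derive_mul (is_derive_const (w k T) t) h3.
  refine (is_derive_val (f := D k) (@is_derive_pow_log R (fun s => w k T / w k s) N t _ q0 h4) _).
  rewrite /= -/(D k t); field; rewrite (lt0r_neq0 wt) (lt0r_neq0 wT) lt0r_neq0 ?rho0//.
  exact: ltW.
have dPsi t : T <= t -> is_derive t 1 Psi ((
   - 2 * (b t + dlam t / lam t) * (p t ^+ 2 / lam t ^+ 2) + 2 * om t * dom t * k2 * y t ^+ 2
   + A * (N%:R * (kt2 * (lam t ^+ 2 / rho t) / w kt2 t)) * D kt2 t
   + E T * (N%:R * (1 * (lam t ^+ 2 / rho t) / w 1 t)) * D 1 t
   + b t * (E t - S t)) * expR (beta t)).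
  move=> Tt; have t0 := posT Tt.
  have h1 := dE _ Tt; have h2 := dD _ _ kt0 Tt; have h3 := dD _ _ ler01 Tt.
  have h4 := dbeta _ t0.
  notypeclasses refine (is_derive_val _ _); first by rewrite /Psi /S; repeat derive_step.
  by rewrite /= /S; ring.
have Psile : Psi T1 <= Psi T.
  apply: (derive_le0_nonincreasing TT1).
  - by apply: is_derive_on_continuous => x /andP[Tx _]; exact: dPsi.
  - by move=> x /andP[/ltW Tx _]; exact: dPsi.
  move=> x /andP[/ltW Tx /ltW xT1]; have x0 := ltW (posT Tx).
  have lp := lam0 x0; have rp := rho0 x0; have bx := bp _ x0.
  have /andP[co c1o] := om0 x0; have op := lt_le_trans c00 co.
  rewrite pmulr_lle0 ?expR_gt0//.
  have [_ [wa _]] := weight_rate kt0 kt1 Tx.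
  have [_ [wb _]] := weight_rate ler01 (lexx 1) Tx.
  have Da := D0 _ _ kt0 x0; have Db := D0 _ _ ler01 x0.
  have ET := E0 _ (ltW T0).
  have crb : c0 / 16 * rho x <= b x / 2.
    by rewrite /b; have := ler_wpM2r (ltW rp) co; have := mulr_ge0 (ltW rp) (ltW op); lra.
  have m1 : A * (N%:R * (kt2 * (lam x ^+ 2 / rho x) / w kt2 x)) * D kt2 x
     <= b x / 2 * (A * D kt2 x).
    rewrite mulrAC mulrC; apply: ler_wpM2r; first exact: mulr_ge0.
    exact: le_trans wa crb.
  have m2 : E T * (N%:R * (1 * (lam x ^+ 2 / rho x) / w 1 x)) * D 1 x
     <= b x / 2 * (E T * D 1 x).
    rewrite mulrAC mulrC; apply: ler_wpM2r; first exact: mulr_ge0.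
    exact: le_trans wb crb.
  have P0 : 0 <= p x ^+ 2 / lam x ^+ 2 by nonneg.
  have Y0 : 0 <= k2 * y x ^+ 2 by nonneg.
  have m3 : - 2 * (b x + dlam x / lam x) * (p x ^+ 2 / lam x ^+ 2)
     <= - b x * (p x ^+ 2 / lam x ^+ 2).
    apply: ler_wpM2r => //.
    have : - (b x / 40) <= dlam x / lam x.
      rewrite ler_pdivlMr//; have := slow_lam Tx; rewrite ler_norml => /andP[+ _]; lra.
    lra.
  have m4 : 2 * om x * dom x * k2 * y x ^+ 2 <= b x * om x ^+ 2 * (k2 * y x ^+ 2).
    rewrite -[2 * _ * _ * k2 * _]mulrA; apply: ler_wpM2r => //.
    have h := ler_wpM2l (ltW op) (le_trans (ler_norm _) (slow_om Tx)).
    have : 0 <= b x * om x ^+ 2 by nonneg.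
    move: h; lra.
  (* The factor [32] in [A] is what the source, of size [2 * 8] against [b / 2], requires. *)
  have m5 : 2 * (b x * om x ^+ 2 * (k2 * y x ^+ 2)) <= b x / 2 * (A * D kt2 x).
    have -> : b x / 2 * (A * D kt2 x) = 2 * (b x * c1 ^+ 2 * (k2 * (8 * D kt2 x * X T))).
      by rewrite /A; field.
    apply: ler_wpM2l => //; apply: ler_pM => //; first by nonneg.
      apply: ler_wpM2l; first exact: ltW.
      by rewrite ler_pXn2r ?nnegrE// ?(le_trans _ c1o)// ltW.
    by apply: ler_wpM2l => //; exact: amplitude_decay.
  have SE : S x = A * D kt2 x + E T * D 1 x by [].
  have EE : E x = p x ^+ 2 / lam x ^+ 2 + om x ^+ 2 * (k2 * y x ^+ 2) by rewrite /E; ring.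
  rewrite SE EE.
  have := mulr_ge0 (ltW bx) (mulr_ge0 ET Db).
  have := mulr_ge0 (ltW bx) (mulr_ge0 A0 Da).
  lra.
have DT k : 0 <= k -> D k T = 1.
  by move=> k0; rewrite /D divff ?expr1n// lt0r_neq0// w0// ltW.
have PsiT : Psi T <= 0.
  rewrite /Psi pmulr_lle0 ?expR_gt0// /S !DT//; lra.
have := le_trans Psile PsiT; rewrite /Psi pmulr_lle0 ?expR_gt0//.
have -> : E T1 = p T1 ^+ 2 / lam T1 ^+ 2 + om T1 ^+ 2 * k2 * y T1 ^+ 2 by [].
have : 0 <= om T1 ^+ 2 * k2 * y T1 ^+ 2 by nonneg.
by rewrite /S /A -/(E T) -/(D kt2 T1) -/(D 1 T1); lra.
Qed.

End OscillatorDecay.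

(** * Consequences of the conditions on the coefficients *)

Lemma summand_le (R : realFieldType) (a b c d e : R) :
  0 <= a -> 0 <= b -> 0 <= c -> 0 <= d -> 0 <= e ->
  let s := a + (b + (c + (d + e))) in [/\ a <= s, b <= s, c <= s, d <= s & e <= s].
Proof. by move=> a0 b0 c0 d0 e0 /=; split; lra. Qed.

Section WeightRatio.
Context {R : realType}.
Variables (N : nat) (K b c k : R).
Hypotheses (K1 : 1 <= K) (b0 : 0 <= b) (c0 : 0 <= c) (k01 : 0 <= k <= 1).

Let k0 : 0 <= k. Proof. by case/andP: k01. Qed.
Let K0 : 0 < K. Proof. exact: lt_le_trans K1. Qed.
Let Kb : 0 <= K + k * b. Proof. exact: addr_ge0 (ltW K0) (mulr_ge0 k0 b0). Qed.
Let Kc : 0 < K + k * c. Proof. exact: ltr_pwDl K0 (mulr_ge0 k0 c0). Qed.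

Lemma weight_ratio_ge0 : 0 <= ((K + k * b) / (K + k * c)) ^+ N.
Proof. exact: exprn_ge0 (divr_ge0 Kb (ltW Kc)). Qed.

Lemma weight_ratio_le : ((K + k * b) / (K + k * c)) ^+ N <= (K + b) ^+ N * (1 + k * c) ^- N.
Proof.
have /andP[_ k1] := k01.
have h1 : 0 < 1 + k * c by exact: ltr_pwDl ltr01 (mulr_ge0 k0 c0).
rewrite exprMn exprVn; apply: ler_pM.
- exact: exprn_ge0.
- by rewrite invr_ge0; apply/exprn_ge0/ltW.
- apply: lerXn2r; rewrite ?nnegrE ?Kb ?(addr_ge0 (ltW K0) b0)//.
  by rewrite lerD2l ler_piMl.
- rewrite lef_pV2 ?posrE ?exprn_gt0//.
  by apply: lerXn2r; rewrite ?nnegrE ?(ltW h1) ?(ltW Kc)// lerD2r.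
Qed.

End WeightRatio.

(** The transformed equation at the squared frequency [k2], as a system for the
    displacement [y] and the velocity [p]. *)
Definition oscillation (R : realType) (lam om rho : R -> R) (k2 : R) (y p : R -> R) : Prop :=
  [/\ {within `[0, +oo[, continuous y}, {within `[0, +oo[, continuous p},
      forall t : R, 0 < t -> is_derive t 1 y (p t) &
      forall t : R, 0 < t ->
        is_derive t 1 p (- (rho t * om t * p t) - k2 * lam t ^+ 2 * om t ^+ 2 * y t)].

Section CoefficientFacts.
Context {R : realType}.
Variables (M : nat) (lam om rho mu Xi Th : R -> R).
Hypotheses (hM : (2 <= M)%N) (hA1 : condA1 M lam) (hA2 : condA2 M lam om Xi Th).
Hypotheses (hB1 : condB1 lam rho mu) (hB2 : condB2 M lam mu) (hB3 : condB3 lam mu).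
Hypothesis hB5 : condB5 lam om rho mu Th.

Local Notation leb := (@lebesgue_measure R).
Let Lam := Lambda lam.
Let dlam := derive_from 0 lam.
Let dom := derive_from 0 om.
Let dmu := derive_from 0 mu.
Let B := Blam lam rho.
Let drho t := dmu t * (lam t / Lam t) + mu t * ((dlam t * Lam t - lam t * lam t) / Lam t ^+ 2).

Lemma Ck_from_continuous k (f : R -> R) : (0 < k)%N -> Ck_from 0 k f ->
  {within `[0, +oo[, continuous f}.
Proof.
move=> k0 [h _]; apply: derivable_from_continuous => t t0; exact: (h 0%N).
Qed.

Lemma Ck_from_is_derive k (f : R -> R) (t : R) : (0 < k)%N -> Ck_from 0 k f -> 0 < t ->
  is_derive t 1 f (derive_from 0 f t).
Proof.
by move=> k0 [h _] t0; apply: derivable_from_is_derive => //; exact: (h 0%N _ k0 (ltW t0)).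
Qed.

Let M0 : (0 < M)%N. Proof. by apply: leq_trans hM. Qed.

Lemma lam_continuous : {within `[0, +oo[, continuous lam}.
Proof. by case: hA1 => h _ _ _; exact: (Ck_from_continuous M0 h). Qed.
Lemma om_continuous : {within `[0, +oo[, continuous om}.
Proof. by case: hA2 => h _ _ _ _; exact: (Ck_from_continuous M0 h). Qed.
Lemma mu_continuous : {within `[0, +oo[, continuous mu}.
Proof. by case: hB2 => h _; exact: (Ck_from_continuous M0 h). Qed.
Lemma lam_derive (t : R) : 0 < t -> is_derive t 1 lam (dlam t).
Proof. by case: hA1 => h _ _ _; exact: (Ck_from_is_derive M0 h). Qed.
Lemma om_derive (t : R) : 0 < t -> is_derive t 1 om (dom t).
Proof. by case: hA2 => h _ _ _ _; exact: (Ck_from_is_derive M0 h). Qed.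
Lemma mu_derive (t : R) : 0 < t -> is_derive t 1 mu (dmu t).
Proof. by case: hB2 => h _; exact: (Ck_from_is_derive M0 h). Qed.

Lemma lam_gt0 (t : R) : 0 <= t -> 0 < lam t.
Proof. by case: hA1 => _ h _ _; exact: h. Qed.
Lemma dlam_gt0 (t : R) : 0 < t -> 0 < dlam t.
Proof. by case: hA1 => _ _ h _; exact: h. Qed.
Lemma rho_gt0 (t : R) : 0 <= t -> 0 < rho t.
Proof. by move=> /hB1[]. Qed.
Lemma rhoE (t : R) : 0 <= t -> rho t = mu t * (lam t / Lam t).
Proof. by move=> /hB1[]. Qed.

Lemma Lam_ge1 (t : R) : 0 <= t -> 1 <= Lam t.
Proof.
move=> t0; rewrite /Lam /Lambda lerDl; apply: Rintegral_ge0 => x /=.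
by rewrite in_itv /= => /andP[x0 _]; exact/ltW/lam_gt0.
Qed.
Lemma Lam_gt0 (t : R) : 0 <= t -> 0 < Lam t.
Proof. by move=> /Lam_ge1; exact: lt_le_trans. Qed.
Lemma mu_gt0 (t : R) : 0 <= t -> 0 < mu t.
Proof.
move=> t0; have := rho_gt0 t0; rewrite rhoE// pmulr_lgt0//.
by rewrite divr_gt0 ?lam_gt0 ?Lam_gt0.
Qed.
Lemma Lam_derive (t : R) : 0 < t -> is_derive t 1 Lam (lam t).
Proof.
move=> t0; have h := is_derive_half_line_integral lam_continuous t0.
by apply: is_derive_val (is_derive_add (is_derive_const 1 t) h) _; rewrite add0r.
Qed.
Lemma Lam_continuous : {within `[0, +oo[, continuous Lam}.
Proof.
have h := continuous_half_line_integral lam_continuous.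
suff : {within `[0, +oo[, continuous (fun t => 1 + \int[leb]_(s in `[0, t]) lam s)} by [].
by apply: within_continuous_add h; exact: within_continuous_cst.
Qed.

Lemma within_continuous_inv (f : R -> R) : (forall t : R, 0 <= t -> 0 < f t) ->
  {within `[0, +oo[, continuous f} -> {within `[0, +oo[, continuous (fun x => (f x)^-1)}.
Proof.
move=> f0 /continuous_within_itvcyP[c1 c2]; apply/continuous_within_itvcyP; split.
  move=> x xp; apply: continuousV; last exact: c1.
  by rewrite gt_eqF// f0// ltW//; move: xp; rewrite in_itv /= andbT.
by apply: cvgV => //; rewrite gt_eqF// f0.
Qed.

Lemma within_continuous_eq (f g : R -> R) : (forall t : R, 0 <= t -> f t = g t) ->
  {within `[0, +oo[, continuous f} -> {within `[0, +oo[, continuous g}.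
Proof.
move=> fg; apply: subspace_eq_continuous => x; rewrite inE /= in_itv /= andbT.
exact: fg.
Qed.

Lemma rho_continuous : {within `[0, +oo[, continuous rho}.
Proof.
apply: (@within_continuous_eq (fun t => mu t * (lam t * (Lam t)^-1))).
  by move=> t t0; rewrite rhoE.
apply: within_continuous_mul; first exact: mu_continuous.
apply: within_continuous_mul; first exact: lam_continuous.
by apply: within_continuous_inv; [exact: Lam_gt0|exact: Lam_continuous].
Qed.

Lemma rho_derive (t : R) : 0 < t -> is_derive t 1 rho (drho t).
Proof.
move=> t0; have L0 := Lam_gt0 (ltW t0).
have h1 := lam_derive t0; have h2 := mu_derive t0; have h3 := Lam_derive t0.
have h4 := is_derive_inv (lt0r_neq0 L0) h3.
apply: (near_eq_is_derive (f := fun t => mu t * (lam t * (Lam t)^-1))).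
  near=> s; rewrite rhoE//; apply: ltW; near: s; exact: lt_nbhsr.
notypeclasses refine (is_derive_val _ _); first by repeat derive_step.
by rewrite /= /drho; field; rewrite lt0r_neq0.
Unshelve. all: by end_near. Qed.

Lemma Blam_rate_continuous : {within `[0, +oo[, continuous (fun t => lam t ^+ 2 / rho t)}.
Proof.
apply: within_continuous_mul.
  exact (within_continuous_mul lam_continuous lam_continuous).
by apply: within_continuous_inv; [exact: rho_gt0|exact: rho_continuous].
Qed.
Lemma B_derive (t : R) : 0 < t -> is_derive t 1 B (lam t ^+ 2 / rho t).
Proof. exact: is_derive_half_line_integral Blam_rate_continuous. Qed.
Lemma B_continuous : {within `[0, +oo[, continuous B}.
Proof. exact: continuous_half_line_integral Blam_rate_continuous. Qed.
Lemma B_ge0 (t : R) : 0 <= t -> 0 <= B t.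
Proof.
move=> t0; apply: Rintegral_ge0 => x /=; rewrite in_itv /= => /andP[x0 _].
by rewrite divr_ge0 ?sqr_ge0// ltW// rho_gt0.
Qed.

Lemma half_line_nondecreasing (f df : R -> R) : {within `[0, +oo[, continuous f} ->
  (forall t : R, 0 < t -> is_derive t 1 f (df t)) ->
  (forall t : R, 0 < t -> 0 <= df t) -> forall s t : R, 0 <= s -> s <= t -> f s <= f t.
Proof.
move=> cf hf f0 s t s0 st; rewrite -lerN2.
apply: (@derive_le0_nonincreasing R (fun x => - f x) (fun x => - df x) s t st).
- move=> x; apply: continuousN; apply: continuous_subspaceW cf x => y /=.
  by rewrite !in_itv /= andbT => /andP[sy _]; exact: le_trans sy.
- by move=> x /andP[sx _]; apply/is_deriveN/hf/(le_lt_trans s0).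
- by move=> x /andP[sx _]; rewrite oppr_le0; apply/f0/(le_lt_trans s0).
Qed.

Lemma lam_nondecreasing (s t : R) : 0 <= s -> s <= t -> lam s <= lam t.
Proof.
by apply: half_line_nondecreasing lam_continuous lam_derive _ _ _ => x /dlam_gt0/ltW.
Qed.
Lemma B_nondecreasing (s t : R) : 0 <= s -> s <= t -> B s <= B t.
Proof.
apply: half_line_nondecreasing B_continuous B_derive _ _ _ => x x0.
by rewrite divr_ge0 ?sqr_ge0// ltW// rho_gt0// ltW.
Qed.
Lemma Lam_nondecreasing (s t : R) : 0 <= s -> s <= t -> Lam s <= Lam t.
Proof.
by apply: half_line_nondecreasing Lam_continuous Lam_derive _ _ _ => x /ltW/lam_gt0/ltW.
Qed.

Lemma dlam_bound : exists2 c : R, 0 < c & forall t : R, 0 < t ->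
  `|dlam t| <= c * lam t * (lam t / Lam t).
Proof.
case: hA1 => _ _ _ [c [c0 _ h]]; exists (c 1%N) => // t t0.
by have := h 1%N t; rewrite expr1 M0 => /(_ isT (ltW t0)).
Qed.

Lemma dmu_bound : exists2 c : R, 0 < c & forall t : R, 0 < t ->
  `|dmu t| <= c * mu t * (lam t / Lam t).
Proof.
case: hB2 => _ [c [c0 h]]; exists (c 1%N) => // t t0.
by have := h 1%N t; rewrite expr1 M0 => /(_ isT (ltW t0)).
Qed.

Lemma Th_ge1 (t : R) : 0 <= t -> 1 <= Th t.
Proof.
case: hA2 => _ _ _ _ [_ hi <- _ _]; rewrite le_eqVlt => /predU1P[<-//|t0].
by apply/ltW/hi; rewrite ?in_itv /= ?andbT ?lexx// ltW.
Qed.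

Lemma dom_bound : exists2 c : R, 0 < c & forall t : R, 0 < t ->
  `|dom t| <= c * (lam t / Th t).
Proof.
case: hA2 => _ _ [c [c0 h]] [Xi0 _ _ [C1 [C2 [C10 C20 hC]]]] _.
exists (c 1%N / C1); first by rewrite divr_gt0.
move=> t t0; have t0' := ltW t0.
have := h 1%N t; rewrite expr1 M0 => /(_ isT t0') h1; apply: le_trans h1 _.
have X0 := Xi0 _ t0'; have T1 : 0 < Th t by apply: lt_le_trans (Th_ge1 t0').
have /andP[h2 _] := hC _ t0'.
rewrite -mulrA; apply: ler_wpM2l; first exact/ltW.
rewrite mulrA -(ler_pM2r X0) mulVf ?lt0r_neq0//.
have -> : C1^-1 * lam t / Th t * Xi t = (lam t * Xi t) / (C1 * Th t).
  by field; rewrite !lt0r_neq0.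
by rewrite ler_pdivlMr ?mulr_gt0// mul1r.
Qed.

Lemma om_bounds : exists c0 c1 : R, 0 < c0 /\ forall t : R, 0 <= t -> c0 <= om t <= c1.
Proof. by case: hA2. Qed.

(** The left side is [mu * r ^+ 2] with [r = lam / rho = Lam / mu]. Its derivative is
    at most a multiple of [lam * Lam / mu], which is the derivative of [B]. Since
    [mu] tends to infinity, [r ^+ 2] itself is negligible against [1 + B]. *)
Lemma ratio_bound : exists2 c : R, 0 < c & forall t : R, 0 <= t ->
  Lam t ^+ 2 / mu t <= c * (1 + B t).
Proof.
have [c c0 hc] := dmu_bound.
pose Q t := (2 + c) * B t - Lam t ^+ 2 * (mu t)^-1.
exists ((mu 0)^-1 + (2 + c)); first by rewrite addr_gt0 ?invr_gt0 ?mu_gt0// addr_gt0.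
move=> t t0.
have Q0t : Q 0 <= Q t.
  apply: (half_line_nondecreasing (f := Q) (df := fun t => (2 + c) * (lam t ^+ 2 / rho t) -
    (2 * Lam t * lam t / mu t - Lam t ^+ 2 * dmu t / mu t ^+ 2))) => //.
  - apply: within_continuous_sub.
      by apply: within_continuous_mul B_continuous; exact: within_continuous_cst.
    apply: within_continuous_mul.
      exact (within_continuous_mul Lam_continuous Lam_continuous).
    by apply: within_continuous_inv; [exact: mu_gt0|exact: mu_continuous].
  - move=> x x0; have m0 := mu_gt0 (ltW x0); have h1 := B_derive x0.
    have h2 := Lam_derive x0; have h3 := is_derive_inv (lt0r_neq0 m0) (mu_derive x0).
    notypeclasses refine (is_derive_val _ _); first by rewrite /Q; repeat derive_step.
    by rewrite /=; field; rewrite !lt0r_neq0// rho_gt0// ltW.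
  - move=> x x0; have m0 := mu_gt0 (ltW x0); have L0 := Lam_gt0 (ltW x0).
    have l0 := lam_gt0 (ltW x0).
    have -> : lam x ^+ 2 / rho x = lam x * Lam x / mu x.
      by rewrite rhoE ?ltW//; field; rewrite !lt0r_neq0.
    have h : - (Lam x ^+ 2 * dmu x / mu x ^+ 2) <= c * (lam x * Lam x / mu x).
      have := hc _ x0; rewrite ler_norml => /andP[h _].
      have := ler_wpM2l (ltW (divr_gt0 (exprn_gt0 2 L0) (exprn_gt0 2 m0))) h.
      have -> : Lam x ^+ 2 / mu x ^+ 2 * - (c * mu x * (lam x / Lam x)) =
         - (c * (lam x * Lam x / mu x)) by field; rewrite !lt0r_neq0.
      lra.
    lra.
have : Q 0 = - (mu 0)^-1.
  by rewrite /Q /B /Blam /Lam /Lambda set_itv1 !Rintegral_set1 mulr0 addr0 expr1n mul1r sub0r.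
move=> Q0; rewrite Q0 /Q in Q0t.
have := B_ge0 t0; have : 0 < (mu 0)^-1 by rewrite invr_gt0 mu_gt0.
move=> m0 Bt; have := mulr_ge0 (ltW m0) Bt; lra.
Qed.

Let b t := rho t * om t.
Let db t := drho t * om t + rho t * dom t.

Lemma b_continuous : {within `[0, +oo[, continuous b}.
Proof. exact: within_continuous_mul rho_continuous om_continuous. Qed.

(** Compared with the damping, [lam], [rho] and [r] vary at the rate [lam / Lam]
    and are slow because [mu] tends to infinity; [om] may oscillate at the faster
    rate [lam / Th] and is slow because [mu * Th / Lam] tends to infinity. *)
Lemma eventually_slow (c0 : R) (N : nat) : 0 < c0 ->
  (forall t : R, 0 <= t -> c0 <= om t) -> exists2 T : R, 0 < T &
  forall t : R, T <= t -> [/\ `|db t| <= b t ^+ 2 / 16,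
    `|dlam t| <= b t * lam t / 40, `|dom t| <= b t * om t / 40,
    `|dlam t * rho t - lam t * drho t| <= c0 / 32 * (rho t ^+ 2 * lam t) &
    N%:R * (lam t ^+ 2 / rho t ^+ 2) <= c0 / 16 * (1 + B t)].
Proof.
move=> c00 hc0.
have [cl cl0 hl] := dlam_bound; have [cm cm0 hm] := dmu_bound.
have [co co0 ho] := dom_bound; have [cr cr0 hr] := ratio_bound.
case: hB3 => _ mu_oo; case: hB5 => small muTh_oo.
have n1 : \forall t \near +oo, 40 * cl / c0 <= mu t by move/cvgryPge : mu_oo; exact.
have n2 : \forall t \near +oo, 32 * (1 + cm) / c0 <= mu t by move/cvgryPge : mu_oo; exact.
have n3 : \forall t \near +oo, 16 * N%:R * cr / c0 <= mu t by move/cvgryPge : mu_oo; exact.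
have n4 : \forall t \near +oo, 40 * co / c0 ^+ 2 <= mu t * (Th t / Lam t).
  by move/cvgryPge : muTh_oo; exact.
have n5 : \forall t \near +oo, `| `|derive_from 0 (fun s => rho s * om s) t| | <=
   16^-1 * `|(rho t * om t) ^+ 2|.
  have /eqoP := small; apply; lra.
have [T [_ hT]] : \forall t \near +oo, [/\ 40 * cl / c0 <= mu t, 32 * (1 + cm) / c0 <= mu t,
   16 * N%:R * cr / c0 <= mu t, 40 * co / c0 ^+ 2 <= mu t * (Th t / Lam t) &
   `| `|derive_from 0 (fun s => rho s * om s) t| | <= 16^-1 * `|(rho t * om t) ^+ 2| ].
  by near=> t; split; near: t.
exists (Num.max 1 (T + 1)); first by rewrite lt_max ltr01.
move=> t; rewrite ge_max => /andP[t1 tT].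
have t0 : 0 < t by exact: lt_le_trans t1.
have t0' := ltW t0.
have [k1 k2 k3 k4 k5] : [/\ 40 * cl / c0 <= mu t, 32 * (1 + cm) / c0 <= mu t,
   16 * N%:R * cr / c0 <= mu t, 40 * co / c0 ^+ 2 <= mu t * (Th t / Lam t) &
   `| `|derive_from 0 (fun s => rho s * om s) t| | <= 16^-1 * `|(rho t * om t) ^+ 2| ].
  by apply: hT; apply: lt_le_trans tT; rewrite ltrDl.
have lp := lam_gt0 t0'; have Lp := Lam_gt0 t0'; have mp := mu_gt0 t0'.
have rp := rho_gt0 t0'; have op := lt_le_trans c00 (hc0 _ t0').
have Tp : 0 < Th t by apply: lt_le_trans (Th_ge1 t0').
have lL : 0 < lam t / Lam t by rewrite divr_gt0.
split.
- move: k5; rewrite normr_id (is_derive_derive_from t0 (is_derive_mul (rho_derive t0) (om_derive t0))).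
  by rewrite [X in _ <= _ * X]ger0_norm ?sqr_ge0// [16^-1 * _]mulrC.
- apply: le_trans (hl _ t0) _; rewrite /b rhoE//.
  have -> : mu t * (lam t / Lam t) * om t * lam t / 40 = (mu t * om t / 40) * lam t * (lam t / Lam t) by ring.
  do 2!(apply: ler_wpM2r; first exact: ltW).
  move: k1; rewrite ler_pdivrMr// => k1.
  have := ler_wpM2l (ltW mp) (hc0 _ t0'); lra.
- apply: le_trans (ho _ t0) _; rewrite /b rhoE//.
  have -> : mu t * (lam t / Lam t) * om t * om t / 40 =
    (mu t * (Th t / Lam t) * om t ^+ 2 / 40) * (lam t / Th t).
    by field; rewrite !lt0r_neq0.
  apply: ler_wpM2r; first by rewrite ltW// divr_gt0.
  move: k4; rewrite ler_pdivrMr ?exprn_gt0// => k4.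
  have : 0 <= mu t * (Th t / Lam t) by nonneg.
  have : c0 ^+ 2 <= om t ^+ 2 by rewrite ler_pXn2r ?nnegrE ?hc0// ltW.
  move=> h1 h2; have := ler_wpM2l h2 h1; lra.
- have -> : dlam t * rho t - lam t * drho t =
    lam t ^+ 2 * mu t * lam t / Lam t ^+ 2 - lam t ^+ 2 / Lam t * dmu t.
    by rewrite rhoE// /drho; field; rewrite lt0r_neq0.
  apply: le_trans (ler_normB _ _) _.
  rewrite ger0_norm; last by nonneg.
  rewrite normrM ger0_norm; last by nonneg.
  have := ler_wpM2l (ltW (divr_gt0 (exprn_gt0 2 lp) Lp)) (hm _ t0).
  have -> : lam t ^+ 2 / Lam t * (cm * mu t * (lam t / Lam t)) =
    cm * (lam t ^+ 2 * mu t * lam t / Lam t ^+ 2) by field; rewrite lt0r_neq0.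
  set Z := lam t ^+ 2 * mu t * lam t / Lam t ^+ 2.
  have -> : c0 / 32 * (rho t ^+ 2 * lam t) = (c0 / 32 * mu t) * Z.
    by rewrite rhoE// /Z; field; rewrite lt0r_neq0.
  have Z0 : 0 <= Z by rewrite /Z; nonneg.
  have : 1 + cm <= c0 / 32 * mu t by move: k2; rewrite ler_pdivrMr//; lra.
  move=> h1; have := ler_wpM2r Z0 h1; lra.
- have -> : lam t ^+ 2 / rho t ^+ 2 = (Lam t ^+ 2 / mu t) / mu t.
    by rewrite rhoE//; field; rewrite !lt0r_neq0.
  have N0 : 0 <= N%:R / mu t :> R by rewrite divr_ge0// ltW.
  have := ler_wpM2l N0 (hr _ t0').
  have -> : N%:R / mu t * (Lam t ^+ 2 / mu t) = N%:R * (Lam t ^+ 2 / mu t / mu t) by ring.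
  move=> h; apply: le_trans h _; rewrite mulrA; apply: ler_wpM2r.
    by have := B_ge0 t0'; lra.
  rewrite mulrAC ler_pdivrMr//; move: k3; rewrite ler_pdivrMr//; lra.
Unshelve. all: by end_near. Qed.

(** * Estimates at a fixed frequency *)

Section Frequency.
Variables (k2 : R) (y p : R -> R).
Hypothesis k20 : 0 <= k2.
Hypotheses (cy : {within `[0, +oo[, continuous y}) (cp : {within `[0, +oo[, continuous p}).
Hypothesis hy : forall t : R, 0 < t -> is_derive t 1 y (p t).
Hypothesis hp : forall t : R, 0 < t ->
  is_derive t 1 p (- (b t * p t) - k2 * lam t ^+ 2 * om t ^+ 2 * y t).

Let E t := p t ^+ 2 + (1 + k2 * (lam t ^+ 2 * om t ^+ 2)) * y t ^+ 2.

(** A crude Gronwall bound for the times at which the damping does not yet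
    dominate. The additional [y ^+ 2] in [E] controls the solution down to
    frequency zero. *)
Lemma energy_growth (c : R) : 0 <= c ->
  (forall t : R, 0 < t -> `|dlam t * om t + lam t * dom t| <= c * lam t * (lam t * om t)) ->
  (forall t : R, 0 <= t -> 0 < om t) ->
  forall t : R, 0 <= t -> E t <= E 0 * expR (t + 2 * c * Lam t).
Proof.
move=> c0 hc om0 t t0.
pose Psi s := E s * expR (- (s + 2 * c * Lam s)).
have PsiE : Psi t <= Psi 0.
  apply: (derive_le0_nonincreasing (f := Psi) (df := fun s =>
     (- 2 * b s * p s ^+ 2 + 2 * y s * p s +
      2 * k2 * (lam s * om s) * (dlam s * om s + lam s * dom s) * y s ^+ 2
      - (1 + 2 * c * lam s) * E s) * expR (- (s + 2 * c * Lam s))) t0).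
  - have sub : `[0, t] `<=` `[0, +oo[%classic.
      by move=> x /=; rewrite !in_itv /= andbT => /andP[].
    apply: continuous_subspaceW sub _.
    have cid : {within `[0, +oo[, continuous (fun s : R => s)}.
      by apply: continuous_subspaceT => x; exact: cvg_id.
    have cl := lam_continuous; have co := om_continuous.
    have sq (f : R -> R) : {within `[0, +oo[, continuous f} ->
      {within `[0, +oo[, continuous (fun s => f s ^+ 2)}.
      by move=> cf; exact (within_continuous_mul cf cf).
    apply: within_continuous_mul.
      apply: within_continuous_add; first exact: sq.
      apply: within_continuous_mul; last exact: sq.
      apply: within_continuous_add; first exact: within_continuous_cst.
      apply: within_continuous_mul; first exact: within_continuous_cst.
      by apply: within_continuous_mul; exact: sq.
    apply/within_continuous_exp/within_continuous_opp/within_continuous_add => //.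
    by apply: within_continuous_mul Lam_continuous; exact: within_continuous_cst.
  - move=> x /andP[x0 _].
    have h1 := hy x0; have h2 := hp x0; have h3 := lam_derive x0; have h4 := om_derive x0.
    have h5 := Lam_derive x0.
    have h6 : is_derive x 1 (fun s : R => s) 1 by exact: is_derive_id.
    have h7 : is_derive x 1 (fun s => - (s + 2 * c * Lam s)) (- (1 + 2 * c * lam x)).
      have h8 := is_derive_add h6 (is_derive_mul (is_derive_const (2 * c) x) h5).
      by apply: is_derive_val (is_deriveN h8) _; ring.
    notypeclasses refine (is_derive_val _ _); first by rewrite /Psi /E; repeat derive_step.
    by rewrite /= /E; ring.
  move=> x /andP[x0 _]; have x0' := ltW x0.
  rewrite pmulr_lle0 ?expR_gt0//.
  have op := om0 _ x0'; have lp := lam_gt0 x0'; have rp := rho_gt0 x0'.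
  have m1 : 2 * k2 * (lam x * om x) * (dlam x * om x + lam x * dom x) * y x ^+ 2 <=
    2 * c * lam x * (k2 * (lam x ^+ 2 * om x ^+ 2) * y x ^+ 2).
    have -> : 2 * c * lam x * (k2 * (lam x ^+ 2 * om x ^+ 2) * y x ^+ 2) =
      2 * k2 * (lam x * om x) * (c * lam x * (lam x * om x)) * y x ^+ 2 by ring.
    apply: ler_wpM2r; first exact: sqr_ge0.
    apply: ler_wpM2l; first by nonneg.
    exact: le_trans (ler_norm _) (hc _ x0).
  have m2 : 0 <= b x * p x ^+ 2 by rewrite /b; nonneg.
  have m3 : 0 <= c * lam x * (p x ^+ 2 + y x ^+ 2) by nonneg.
  have m4 : 0 <= k2 * (lam x ^+ 2 * om x ^+ 2) * y x ^+ 2 by nonneg.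
  have := sqr_ge0 (y x - p x); rewrite /E; lra.
have : Psi 0 <= E 0.
  rewrite /Psi ler_piMr//.
    by rewrite /E; nonneg; apply: mulr_ge0 => //; nonneg.
  rewrite -expR0 ler_expR oppr_le0 add0r.
  by have := Lam_gt0 (lexx 0) => L0; nonneg.
move=> h; have := le_trans PsiE h; rewrite /Psi expRN ler_pdivrMr ?expR_gt0//.
Qed.

End Frequency.

Let initial_size (k2 : R) (y p : R -> R) := p 0 ^+ 2 + (1 + k2) * y 0 ^+ 2.

(** On a bounded time interval [energy_growth] is uniform in the frequency, because
    the coefficient of [y ^+ 2] in the energy stays comparable to [1 + k2]. *)
Lemma early_estimate (T : R) : 0 < T -> exists2 G : R, 0 < G &
  forall (k2 : R) (y p : R -> R), 0 <= k2 -> oscillation lam om rho k2 y p ->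
  forall t : R, 0 <= t -> t <= T ->
  y t ^+ 2 <= G * (initial_size k2 y p / (1 + k2)) /\ p t ^+ 2 <= G * initial_size k2 y p.
Proof.
move=> T0.
have [c0 [c1 [c00 hom]]] := om_bounds.
have om0 t : 0 <= t -> 0 < om t.
  by move=> t0; have /andP[+ _] := hom _ t0; exact: lt_le_trans.
have [cl cl0 hcl] := dlam_bound; have [co co0 hco] := dom_bound.
pose cg := cl + co / c0.
have cg0 : 0 <= cg by rewrite /cg; nonneg.
have hcg t : 0 < t -> `|dlam t * om t + lam t * dom t| <= cg * lam t * (lam t * om t).
  move=> t0; have t0' := ltW t0.
  have lp := lam_gt0 t0'; have op := om0 _ t0'; have Lp := Lam_gt0 t0'.
  have Tp : 0 < Th t by apply: lt_le_trans (Th_ge1 t0').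
  apply: le_trans (ler_normD _ _) _; rewrite !normrM (gtr0_norm lp) (gtr0_norm op).
  rewrite /cg -mulrA mulrDl; apply: lerD.
    have -> : cl * (lam t * (lam t * om t)) = cl * lam t * lam t * om t by ring.
    apply: ler_wpM2r; first exact: ltW.
    apply: le_trans (hcl _ t0) _; apply: ler_wpM2l; first by nonneg.
    by rewrite ler_pdivrMr// ler_peMr ?Lam_ge1// ltW.
  have -> : co / c0 * (lam t * (lam t * om t)) = lam t * (co * (lam t * (om t / c0))) by ring.
  apply: ler_wpM2l; first exact: ltW.
  apply: le_trans (hco _ t0) _; apply: ler_wpM2l; first exact: ltW.
  apply: ler_wpM2l; first exact: ltW.
  apply: (@le_trans _ _ 1); first by rewrite invf_le1// Th_ge1.
  by rewrite ler_pdivlMr// mul1r; have /andP[] := hom _ t0'.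
pose g := expR (T + 2 * cg * Lam T) * (1 + lam 0 ^+ 2 * om 0 ^+ 2).
have q0 : 0 <= lam 0 ^+ 2 * om 0 ^+ 2 by nonneg.
have g0 : 0 < g by rewrite mulr_gt0 ?expR_gt0// ltr_pwDl.
(* [a0 * (1 + k2)] bounds the coefficient of [y ^+ 2] in the energy from below. *)
pose a0 := Num.min 1 (lam 0 ^+ 2 * c0 ^+ 2).
have a00 : 0 < a0 by rewrite lt_min ltr01 mulr_gt0// exprn_gt0// lam_gt0.
have a01 : a0 <= 1 by rewrite ge_min lexx.
exists (g / a0); first exact: divr_gt0.
move=> k2 y p k20 [cy cp hy hp] s s0 sT.
set Z0 := initial_size k2 y p.
have k1 : 0 < 1 + k2 by rewrite ltr_pwDl.
have Z00 : 0 <= Z0 by rewrite /Z0 /initial_size; nonneg.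
have := energy_growth k20 cy cp hy hp cg0 hcg om0 s0.
set Es := (X in X <= _); set E0 := (X in _ <= X * _) => hE.
have EsG : Es <= g * Z0.
  apply: le_trans hE _; rewrite /g [leRHS]mulrC mulrA.
  have E0Z : E0 <= Z0 * (1 + lam 0 ^+ 2 * om 0 ^+ 2).
    rewrite /E0 /Z0 /initial_size.
    rewrite [leRHS](_ : _ = p 0 ^+ 2 + (1 + k2 * (lam 0 ^+ 2 * om 0 ^+ 2)) * y 0 ^+ 2 +
      (lam 0 ^+ 2 * om 0 ^+ 2 * p 0 ^+ 2 + (k2 + lam 0 ^+ 2 * om 0 ^+ 2) * y 0 ^+ 2)); last by ring.
    by rewrite lerDl; nonneg.
  have E0p : 0 <= E0 by rewrite /E0; nonneg; apply: mulr_ge0 => //; nonneg.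
  rewrite [leRHS]mulrAC; apply: ler_pM; rewrite ?expR_ge0//.
  rewrite ler_expR lerD//; apply: ler_wpM2l; first by nonneg.
  exact: Lam_nondecreasing.
have lamle : lam 0 <= lam s by exact: lam_nondecreasing.
have kk : a0 * (1 + k2) <= 1 + k2 * (lam s ^+ 2 * om s ^+ 2).
  rewrite mulrDr mulr1; apply: lerD => //; rewrite mulrC; apply: ler_wpM2l => //.
  apply: (@le_trans _ _ (lam 0 ^+ 2 * c0 ^+ 2)); first by rewrite ge_min lexx orbT.
  have /andP[cs _] := hom _ s0; have ls := lam_gt0 s0; have os := om0 _ s0.
  have l0 := lam_gt0 (lexx 0).
  by apply: ler_pM; rewrite ?sqr_ge0// ler_pXn2r ?nnegrE// ltW.
split.
- have -> : g / a0 * (Z0 / (1 + k2)) = g * Z0 / (a0 * (1 + k2)) by field; rewrite !lt0r_neq0.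
  rewrite ler_pdivlMr ?mulr_gt0//; apply: le_trans EsG; rewrite /Es.
  apply: le_trans (ler_wpM2l (sqr_ge0 (y s)) kk) _.
  by rewrite mulrC lerDr sqr_ge0.
- apply: (@le_trans _ _ (g * Z0)).
    apply: le_trans EsG; rewrite /Es lerDl; apply: mulr_ge0; last exact: sqr_ge0.
    by nonneg.
  by apply: ler_wpM2r => //; rewrite ler_pdivlMr// ler_piMr// ltW.
Qed.

(** Before a time [T] from which on all coefficients are slow, no decay has to be
    proved and [early_estimate] suffices; after [T] the two decay lemmas apply,
    with the state at [T] controlled by [early_estimate]. The division of [Z0] by
    [1 + k2] is the gain of one derivative on the velocity. *)
Lemma frequency_estimate (N : nat) : exists2 C : R, 0 < C &
  forall (k2 : R) (y p : R -> R), 0 <= k2 -> oscillation lam om rho k2 y p ->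
  forall t : R, 0 <= t ->
  let Z0 := p 0 ^+ 2 + (1 + k2) * y 0 ^+ 2 in
  y t ^+ 2 <= C * (1 + Num.min 1 k2 * B t) ^- N * (Z0 / (1 + k2)) /\
  p t ^+ 2 <= C * lam t ^+ 2 * (k2 * (1 + Num.min 1 k2 * B t) ^- N * (Z0 / (1 + k2))
     + (1 + B t) ^- N * Z0).
Proof.
have [c0 [c1 [c00 hom]]] := om_bounds.
have [T T0 slow] := eventually_slow N c00 (fun t t0 => (andP (hom t t0)).1).
have [G G0 early] := early_estimate T0.
have T0' := ltW T0.
have l0 := lam_gt0 (lexx 0); have lT := lam_gt0 T0'; have rT := rho_gt0 T0'.
have /andP[oT _] := hom _ T0'; have {}oT := lt_le_trans c00 oT.
have bT : 0 < b T by rewrite mulr_gt0.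
have BT := B_ge0 T0'.
(* [rr * (1 + k2) <= 1 + r ^+ 2 * k2] holds with [r] taken at [T], uniformly in [k2]. *)
pose rr := Num.min 1 ((lam T / rho T) ^+ 2).
have rr0 : 0 < rr by rewrite lt_min ltr01 exprn_gt0// divr_gt0.
have r1 : rr <= 1 by rewrite ge_min lexx.
have r2 : rr <= (lam T / rho T) ^+ 2 by rewrite ge_min lexx orbT.
pose K := 1 + 16 / c0 * N%:R.
have K1 : 1 <= K by rewrite lerDl; nonneg.
have KN : N%:R <= c0 / 16 * K.
  rewrite /K mulrDr; have -> : c0 / 16 * (16 / c0 * N%:R) = N%:R by field; rewrite lt0r_neq0.
  by rewrite lerDr; nonneg.
pose V := (K + B T) ^+ N.
have KB : 1 <= K + B T by rewrite -[1]addr0 lerD.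
have V1 : 1 <= V by exact: exprn_ege1.
have V0 : 0 <= V by exact: le_trans V1.
pose x0 := G + G / (b T ^+ 2 * rr).
have x00 : 0 <= x0 by rewrite /x0; nonneg.
pose e0 := G / lam T ^+ 2 + om T ^+ 2 * G.
have e00 : 0 <= e0 by rewrite /e0; nonneg.
pose C1 := V * (8 * x0); pose C2 := V * (32 * c1 ^+ 2 * x0); pose C3 := V * e0.
pose C4 := V * (G / lam 0 ^+ 2).
have C10 : 0 <= C1 by rewrite /C1; nonneg.
have C20 : 0 <= C2 by rewrite /C2; nonneg.
have C30 : 0 <= C3 by rewrite /C3; nonneg.
have C40 : 0 <= C4 by rewrite /C4; nonneg.
pose C := V * G + (C1 + (C2 + (C3 + C4))).
have [le0 le1 le2 le3 le4] := summand_le (mulr_ge0 V0 (ltW G0)) C10 C20 C30 C40.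
rewrite -/C in le0 le1 le2 le3 le4.
exists C; first by apply: lt_le_trans le0; rewrite mulr_gt0// (lt_le_trans ltr01 V1).
move=> k2 y p k20 osc t t0 Z0; have [cy cp hy hp] := osc.
have k1 : 0 < 1 + k2 by rewrite ltr_pwDl.
have Z00 : 0 <= Z0 by rewrite /Z0; nonneg.
have X00 : 0 <= Z0 / (1 + k2) by nonneg.
set kt := Num.min 1 k2.
have kt01 : 0 <= kt <= 1 by rewrite le_min ler01 k20 ge_min lexx.
have one01 : 0 <= (1 : R) <= 1 by rewrite ler01 lexx.
have Bt := B_ge0 t0.
have W0 k : 0 <= k <= 1 -> 0 <= (1 + k * B t) ^- N.
  by move=> /andP[k0 _]; rewrite invr_ge0 exprn_ge0// addr_ge0// mulr_ge0.
have Wt := W0 _ kt01; have W1 := W0 _ one01; rewrite mul1r in W1.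
have P0 : 0 <= k2 * (1 + kt * B t) ^- N * (Z0 / (1 + k2)).
  exact: mulr_ge0 (mulr_ge0 k20 Wt) X00.
have Q0 : 0 <= (1 + B t) ^- N * Z0 by exact: mulr_ge0.
have early' := early _ _ _ k20 osc.
rewrite /initial_size -/Z0 in early'.
have [tT|Tt] := leP t T.
- have [e1 e2] := early' _ t0 tT.
  (* Before [T] the decaying weights are at least [V^-1]. *)
  have VB k : 0 <= k <= 1 -> 1 <= V * (1 + k * B t) ^- N.
    move=> /andP[k0 kle]; rewrite ler_pdivlMr ?mul1r; last first.
      by rewrite exprn_gt0// ltr_pwDl// mulr_ge0.
    apply: lerXn2r; rewrite ?nnegrE ?(le_trans ler01 KB)//.
      by rewrite addr_ge0// mulr_ge0.
    apply: lerD => //; apply: le_trans (B_nondecreasing t0 tT).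
    by rewrite ler_piMl.
  have v1 := VB _ kt01; have v2 := VB _ one01; rewrite mul1r in v2.
  split.
  + apply: le_trans e1 _; rewrite ler_wpM2r//.
    apply: le_trans (ler_wpM2r Wt le0); rewrite -[leLHS]mulr1 [V * G]mulrC -mulrA.
    by rewrite ler_wpM2l// ltW.
  + apply: le_trans e2 _; have lt0 := lam_gt0 t0.
    apply: (@le_trans _ _ (C4 * lam t ^+ 2 * ((1 + B t) ^- N * Z0))).
      have -> : C4 * lam t ^+ 2 * ((1 + B t) ^- N * Z0) =
        (V * (1 + B t) ^- N) * (lam t ^+ 2 / lam 0 ^+ 2) * (G * Z0) by rewrite /C4; ring.
      apply: ler_peMl; first by nonneg.
      rewrite -[leLHS]mulr1; apply: ler_pM => //.
      have := lam_nondecreasing (lexx 0) t0 => lamle.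
      rewrite ler_pdivlMr ?exprn_gt0// mul1r ler_pXn2r ?nnegrE//; exact: ltW.
    apply: ler_pM; [exact: mulr_ge0 C40 (sqr_ge0 _)|exact: Q0| |by rewrite lerDr].
    by apply: ler_wpM2r => //; exact: sqr_ge0.
have [eyT epT] := early' _ T0' (lexx T).
have slow1 s : T <= s -> _ := fun h => let: And5 a _ _ _ _ := slow s h in a.
have slow2 s : T <= s -> _ := fun h => let: And5 _ a _ _ _ := slow s h in a.
have slow3 s : T <= s -> _ := fun h => let: And5 _ _ a _ _ := slow s h in a.
have slow4 s : T <= s -> _ := fun h => let: And5 _ _ _ a _ := slow s h in a.
have slow5 s : T <= s -> _ := fun h => let: And5 _ _ _ _ a := slow s h in a.
have Tt' := ltW Tt.
have ad := @amplitude_decay R lam om rho B dlam dom drho c0 c1 N K T T0 c00 b_continuous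
  lam_gt0 rho_gt0 hom B_ge0 lam_derive om_derive rho_derive B_derive slow1 slow2 slow3
  slow4 slow5 K1 KN k2 y p k20 hy hp t Tt'.
have vd := @velocity_decay R lam om rho B dlam dom drho c0 c1 N K T T0 c00 b_continuous
  lam_gt0 rho_gt0 hom B_ge0 lam_derive om_derive rho_derive B_derive slow1 slow2 slow3
  slow4 slow5 K1 KN k2 y p k20 hy hp t Tt'.
rewrite -/kt in ad vd.
move: ad vd; set XT := (y T ^+ 2 + _); set ET := (_ + om T ^+ 2 * k2 * _).
move=> ad vd.
have XTle : XT <= x0 * (Z0 / (1 + k2)).
  rewrite /XT /x0 mulrDl; apply: lerD => //.
  have d0 : 0 < b T ^+ 2 * (1 + (lam T / rho T) ^+ 2 * k2).
    by rewrite mulr_gt0 ?exprn_gt0// ltr_pwDl//; nonneg.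
  rewrite ler_pdivrMr//; apply: le_trans epT _.
  have -> : G / (b T ^+ 2 * rr) * (Z0 / (1 + k2)) * (b T ^+ 2 * (1 + (lam T / rho T) ^+ 2 * k2)) =
    G * Z0 * ((1 + (lam T / rho T) ^+ 2 * k2) / (rr * (1 + k2))).
    by field; rewrite !lt0r_neq0.
  rewrite ler_peMr//; first by nonneg.
  rewrite ler_pdivlMr ?mulr_gt0// mul1r mulrDr mulr1.
  by apply: lerD => //; exact: ler_wpM2r.
have ETle : ET <= e0 * Z0.
  rewrite /ET /e0 mulrDl; apply: lerD.
    by rewrite [leRHS]mulrAC; apply: ler_wpM2r => //; nonneg.
  have -> : om T ^+ 2 * k2 * y T ^+ 2 = om T ^+ 2 * (k2 * y T ^+ 2) by ring.
  have -> : om T ^+ 2 * G * Z0 = om T ^+ 2 * (G * Z0) by ring.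
  apply: ler_wpM2l; first exact: sqr_ge0.
  apply: le_trans (ler_wpM2l k20 eyT) _.
  have -> : k2 * (G * (Z0 / (1 + k2))) = G * Z0 * (k2 / (1 + k2)) by ring.
  rewrite ler_piMr//; first by nonneg.
  by rewrite ler_pdivrMr// mul1r lerDr.
have XT0 : 0 <= XT.
  rewrite /XT addr_ge0 ?sqr_ge0// divr_ge0 ?sqr_ge0// mulr_ge0 ?sqr_ge0//.
  by rewrite addr_ge0// mulr_ge0 ?sqr_ge0.
have ET0 : 0 <= ET by rewrite /ET; apply: addr_ge0; nonneg.
have v1 := weight_ratio_le N K1 BT Bt kt01.
have := weight_ratio_le N K1 BT Bt one01; rewrite !mul1r => v2.
have D0 := weight_ratio_ge0 N K1 BT Bt kt01.
have := weight_ratio_ge0 N K1 BT Bt one01; rewrite !mul1r => D1.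
rewrite !mul1r in vd.
have m : ((K + kt * B T) / (K + kt * B t)) ^+ N * XT <=
   V * (1 + kt * B t) ^- N * (x0 * (Z0 / (1 + k2))) by exact: ler_pM.
split.
- apply: le_trans ad _; rewrite -mulrA.
  apply: le_trans (ler_wpM2l _ m) _ => //.
  have -> : 8 * (V * (1 + kt * B t) ^- N * (x0 * (Z0 / (1 + k2)))) =
    C1 * (1 + kt * B t) ^- N * (Z0 / (1 + k2)) by rewrite /C1; ring.
  by apply: ler_wpM2r => //; exact: ler_wpM2r.
- have lt0 := lam_gt0 t0.
  rewrite [X in _ <= X]mulrAC -ler_pdivrMr ?exprn_gt0//.
  apply: le_trans vd _; rewrite [leRHS]mulrDr; apply: lerD.
    have -> : 32 * c1 ^+ 2 * k2 * XT * ((K + kt * B T) / (K + kt * B t)) ^+ N =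
      32 * c1 ^+ 2 * k2 * (((K + kt * B T) / (K + kt * B t)) ^+ N * XT) by ring.
    have c2 : 0 <= 32 * c1 ^+ 2 * k2 by nonneg.
    apply: le_trans (ler_wpM2l c2 m) _.
    have -> : 32 * c1 ^+ 2 * k2 * (V * (1 + kt * B t) ^- N * (x0 * (Z0 / (1 + k2)))) =
      C2 * (k2 * (1 + kt * B t) ^- N * (Z0 / (1 + k2))) by rewrite /C2; ring.
    exact: ler_wpM2r.
  apply: le_trans (ler_pM ET0 D1 ETle v2) _.
  have -> : e0 * Z0 * (V * (1 + B t) ^- N) = C3 * ((1 + B t) ^- N * Z0) by rewrite /C3; ring.
  exact: ler_wpM2r.
Qed.

End CoefficientFacts.

(** * Fubini for dominated real functions and for tuples *)

Section DominatedFubini.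
Context d1 d2 (T1 : measurableType d1) (T2 : measurableType d2) (R : realType).
Variables (m1 : {sigma_finite_measure set T1 -> \bar R}).
Variables (m2 : {sigma_finite_measure set T2 -> \bar R}).

Lemma measurable_Rintegral_snd (G : T1 * T2 -> R) : measurable_fun setT G ->
  measurable_fun setT (fun x => \int[m2]_y G (x, y)).
Proof.
move=> mG; rewrite /Rintegral.
pose F : T1 -> \bar R := fubini_F m2 (EFin \o G).
suff h : measurable_fun setT F.
  exact: (measurableT_comp (fine_measurable measurableT) h).
have mE : measurable_fun setT (EFin \o G) by exact/measurable_EFinP.
have -> : F =
  (fun x => \int[m2]_y ((EFin \o G)^\+ (x, y)) - \int[m2]_y ((EFin \o G)^\- (x, y)))%E.
  apply/funext => x; rewrite /F /fubini_F integralE.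
  by congr (_ - _)%E; apply: eq_integral => y _; rewrite ?funeposE ?funenegE.
apply: emeasurable_funB.
  by apply: (@measurable_fun_fubini_tonelli_F _ _ _ _ _ m2) => //; exact: measurable_funepos.
by apply: (@measurable_fun_fubini_tonelli_F _ _ _ _ _ m2) => //; exact: measurable_funeneg.
Qed.

Variables (G : T1 * T2 -> R) (g : T1 -> R) (h : T2 -> R).
Hypothesis mG : measurable_fun setT G.
Hypotheses (ig : m1.-integrable setT (EFin \o g)) (ih : m2.-integrable setT (EFin \o h)).
Hypothesis Ggh : forall x y, `|G (x, y)| <= g x * h y.

Lemma integrable_dominated_prod : (m1 \x m2)%E.-integrable setT (EFin \o G).
Proof.
apply/(integrable12ltyP m1 m2); first exact/measurable_EFinP.
have [mg gfin] := integrableP _ _ _ ig; have [mh hfin] := integrableP _ _ _ ih.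
have {mg}mg : measurable_fun setT g by exact/measurable_EFinP.
have {mh}mh : measurable_fun setT h by exact/measurable_EFinP.
apply: (@le_lt_trans _ _ (\int[m1]_x ((`|g x|)%:E * \int[m2]_y (`|h y|)%:E))%E).
  apply: ge0_le_integral => //.
  - by move=> x _; exact: integral_ge0.
  - apply: (@measurable_fun_fubini_tonelli_F _ _ _ _ _ m2 (fun z => `|(EFin \o G) z|)%E) => //.
    by apply: measurableT_comp => //; exact/measurable_EFinP.
  - apply: emeasurable_funM; last exact: measurable_cst.
    by apply/measurable_EFinP; exact: measurableT_comp.
  move=> x _; rewrite -ge0_integralZl//; last by apply/measurable_EFinP; exact: measurableT_comp.
  apply: ge0_le_integral => //.
  - apply: measurableT_comp => //; apply/measurable_EFinP.
    exact: (measurableT_comp mG (pair1_measurable x)).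
  - apply: emeasurable_funM; first exact: measurable_cst.
    by apply/measurable_EFinP; exact: measurableT_comp.
  move=> y _; rewrite /= lee_fin; apply: le_trans (Ggh x y) _.
  by rewrite -normrM ler_norm.
rewrite ge0_integralZr//; last 2 first.
- by apply/measurable_EFinP; exact: measurableT_comp.
- by apply: integral_ge0 => y _; rewrite lee_fin.
by apply: lte_mul_pinfty => //; [exact: integral_ge0|rewrite ge0_fin_numE// integral_ge0].
Qed.

Lemma dominated_section1 x : m2.-integrable setT (EFin \o (fun y => G (x, y))).
Proof.
apply: (@le_integrable _ _ _ m2 setT measurableT _ (fun y => (g x)%:E * (EFin \o h) y)%E).
- apply/measurable_EFinP; exact: (measurableT_comp mG (pair1_measurable x)).
- move=> y _; rewrite /= lee_fin; apply: le_trans (Ggh x y) _; exact: ler_norm.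
- exact: integrableZl.
Qed.

Lemma dominated_section2 y : m1.-integrable setT (EFin \o (fun x => G (x, y))).
Proof.
apply: (@le_integrable _ _ _ m1 setT measurableT _ (fun x => (h y)%:E * (EFin \o g) x)%E).
- apply/measurable_EFinP; exact: (measurableT_comp mG (pair2_measurable y)).
- move=> x _; rewrite /= lee_fin; apply: le_trans (Ggh x y) _; rewrite mulrC; exact: ler_norm.
- exact: integrableZl.
Qed.

Lemma Rintegral_prod : \int[(m1 \x m2)%E]_z G z = \int[m1]_x \int[m2]_y G (x, y).
Proof.
rewrite /Rintegral; congr fine.
rewrite -(integral12_prod_meas1 integrable_dominated_prod); apply: eq_integral => x _.
by rewrite fineK//; exact: (integrable_fin_num measurableT (dominated_section1 x)).
Qed.

Lemma Rintegral_swap : \int[m1]_x \int[m2]_y G (x, y) = \int[m2]_y \int[m1]_x G (x, y).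
Proof.
rewrite -Rintegral_prod /Rintegral; congr fine.
rewrite -(integral21_prod_meas1 integrable_dominated_prod); apply: eq_integral => y _.
by rewrite fineK//; exact: (integrable_fin_num measurableT (dominated_section2 y)).
Qed.

End DominatedFubini.

Section TupleIntegrals.
Context {R : realType}.
Local Notation leb := (@lebesgue_measure R).
Local Notation lebn := (@lebesgue_measure_n R).

(** [cons_pair] on the product whose first factor carries the Borel structure
    underlying the Lebesgue measure. *)
Definition tuple_cons n (z : measurableTypeR R * n.-tuple R) : n.+1.-tuple R :=
  cons_pair z.

Lemma measurable_tuple_cons n : measurable_fun setT (@tuple_cons n).
Proof. exact: measurable_cons_pair. Qed.

Lemma ge0_integral_tuple_cons n (f : n.+1.-tuple R -> \bar R) :
  measurable_fun setT f -> (forall x, 0 <= f x)%E ->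
  (\int[lebn n.+1]_x f x = \int[leb]_a \int[lebn n]_v f (tuple_cons (a, v)))%E.
Proof.
move=> mf f0; have mp := @measurable_tuple_cons n.
transitivity (\int[(leb \x lebn n)%E]_z f (tuple_cons z))%E.
  have := ge0_integral_pushforward mp (leb \x lebn n)%E measurableT mf (fun y _ => f0 y).
  exact.
have mfc : measurable_fun setT (f \o @tuple_cons n) by exact: measurableT_comp.
by rewrite (@fubini_tonelli1 _ _ _ _ R leb (lebn n) _ mfc)// => z; exact: f0.
Qed.

Lemma Rintegral_tuple_cons n (G : n.+1.-tuple R -> R) (g : R -> R) (h : n.-tuple R -> R) :
  measurable_fun setT G ->
  leb.-integrable setT (EFin \o g) -> (lebn n).-integrable setT (EFin \o h) ->
  (forall a v, `|G (tuple_cons (a, v))| <= g a * h v) ->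
  \int[lebn n.+1]_x G x = \int[leb]_a \int[lebn n]_v G (tuple_cons (a, v)).
Proof.
move=> mG ig ih Ggh; have mp := @measurable_tuple_cons n.
have mGc : measurable_fun setT (G \o @tuple_cons n) by exact: measurableT_comp.
have := @Rintegral_prod _ _ _ _ R leb (lebn n) (G \o @tuple_cons n) g h mGc ig ih Ggh.
move=> <-; rewrite /Rintegral; congr fine.
have ip := @integrable_dominated_prod _ _ _ _ R leb (lebn n) _ g h mGc ig ih Ggh.
have mE : measurable_fun setT (EFin \o G) by exact/measurable_EFinP.
have := integral_pushforward mp mE ip measurableT.
exact.
Qed.

Lemma tuple_consE n (F : 'I_n.+1 -> R -> R) a v :
  \prod_(i < n.+1) F i (tnth (tuple_cons (a, v)) i) =
  F ord0 a * \prod_(i < n) F (lift ord0 i) (tnth v i).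
Proof.
rewrite big_ord_recl; congr (_ * _); apply: eq_bigr => i _.
by rewrite tnthS; congr (F _ (tnth _ _)).
Qed.

Lemma dotv_cons n a (v : n.-tuple R) (z : n.+1.-tuple R) :
  dotv (tuple_cons (a, v)) z = a * tnth z ord0 + dotv v [tuple of behead z].
Proof.
rewrite /dotv big_ord_recl; congr (_ + _); apply: eq_bigr => i _.
rewrite tnthS; congr (tnth _ _ * _).
by rewrite [in LHS](tuple_eta z) tnthS; congr tnth; exact: val_inj.
Qed.

Lemma measurable_prod_tnth n (F : 'I_n -> R -> R) : (forall i, measurable_fun setT (F i)) ->
  measurable_fun setT (fun x : n.-tuple R => \prod_(i < n) F i (tnth x i)).
Proof.
move=> mF; apply: measurable_prod => i _.
by apply: (measurableT_comp (mF i)); exact: measurable_tnth.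
Qed.

Lemma measurable_dotv n (z : n.-tuple R) : measurable_fun setT (fun x => dotv x z).
Proof.
apply: measurable_sum => i.
by apply: measurable_funM => //; exact: measurable_tnth.
Qed.

Lemma ge0_integral_prod_tnth n (F : 'I_n -> R -> R) (c : 'I_n -> R) :
  (forall i, measurable_fun setT (F i)) -> (forall i x, 0 <= F i x) ->
  (forall i, \int[leb]_x (F i x)%:E = (c i)%:E)%E ->
  (\int[lebn n]_x (\prod_(i < n) F i (tnth x i))%:E = (\prod_(i < n) c i)%:E)%E.
Proof.
elim: n F c => [|n IH] F c mF F0 hF.
  rewrite /= integral_dirac//; last first.
    by apply/measurable_EFinP; exact: measurable_prod_tnth.
  by rewrite diracE in_setT mul1e !big_ord0.
rewrite ge0_integral_tuple_cons; last 2 first.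
- by apply/measurable_EFinP; exact: measurable_prod_tnth.
- by move=> x; rewrite lee_fin prodr_ge0.
transitivity (\int[leb]_a ((F ord0 a)%:E * (\prod_(i < n) c (lift ord0 i))%:E))%E.
  apply: eq_integral => a _; rewrite -(IH (fun i => F (lift ord0 i)))//.
  rewrite -ge0_integralZl ?lee_fin//; last 2 first.
  - apply/measurable_EFinP.
    exact: (@measurable_prod_tnth n (fun i => F (lift ord0 i)) (fun i => mF (lift ord0 i))).
  - by move=> x _; rewrite lee_fin prodr_ge0.
  by apply: eq_integral => v _; rewrite tuple_consE EFinM.
have mE : measurable_fun setT (EFin \o F ord0) by exact/measurable_EFinP.
have E0 x : setT x -> (0 <= (EFin \o F ord0) x)%E by move=> _; rewrite lee_fin.
have c0 : (0 <= (\prod_(i < n) c (lift ord0 i))%:E)%E.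
  rewrite lee_fin prodr_ge0// => i _; rewrite -lee_fin -hF integral_ge0// => x _.
  by rewrite lee_fin.
rewrite (ge0_integralZr leb measurableT mE E0 c0).
by rewrite hF -EFinM big_ord_recl.
Qed.

End TupleIntegrals.

(** * The parabolic window and its cosine transform *)

Section WindowKernel.
Context {R : realType}.
Local Notation leb := (@lebesgue_measure R).

Lemma normr_cos_le1 (a : R) : `|cos a| <= 1.
Proof. by rewrite ler_norml cos_geN1 cos_le1. Qed.

Lemma normr_sin_le1 (a : R) : `|sin a| <= 1.
Proof. by rewrite ler_norml sin_geN1 sin_le1. Qed.

Lemma cauchy_kernel_integral (s x : R) : 0 < s ->
  (\int[leb]_y (s / (1 + (s * (y - x)) ^+ 2))%:E = pi%:E)%E.
Proof.
move=> s0; pose F y := s * (y - x); pose G u : R := (oneDsqr u)^-1.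
have dF (y : R) : is_derive y 1 F s.
  have h : is_derive y 1 (fun y : R => y) 1 by exact: is_derive_id.
  notypeclasses refine (is_derive_val _ _); first by rewrite /F; repeat derive_step.
  by rewrite /=; ring.
have F'E : derive1 F = cst s by apply/funext => y; rewrite derive1E; have [_ ->] := dF y.
have G0 u : 0 <= G u by rewrite invr_ge0 ltW// oneDsqr_gt0.
have cG : continuous G by exact: continuous_oneDsqrV.
have h : (\int[leb]_u (G u)%:E = pi%:E)%E.
  rewrite ge0_symfun_integralT//; last by move=> u; rewrite /G /= /oneDsqr sqrrN.
  rewrite -set_itvcy integral0y_oneDsqr -EFinM mulrC divfK//.
rewrite -h (@increasing_ge0_integration_by_substitutionT R F G) ?F'E//.
- by apply: eq_integral => y _; rewrite /= /G /oneDsqr /F mulrC.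
- by move=> a b ab; rewrite /F ltr_pM2l// ltrD2r.
- by move=> y; exact: cst_continuous.
- exact: is_cvg_cst.
- exact: is_cvg_cst.
- apply/cvgrNyPle => A; near=> y.
  rewrite /F mulrC -ler_pdivlMr// lerBlDr; near: y; by apply: nbhs_ninfty_le; rewrite num_real.
- apply/cvgryPge => A; near=> y.
  rewrite /F mulrC -ler_pdivrMr// lerBrDr; near: y; by apply: nbhs_pinfty_ge; rewrite num_real.
Unshelve. all: by end_near. Qed.

(** This cut-off vanishes outside [[-r, r]] and is Lipschitz at its edges, so that
    its cosine transform decays quadratically and is integrable. *)
Definition window (r xi : R) : R := Num.max 0 (1 - (xi / r) ^+ 2).

Lemma window_ge0 r xi : 0 <= window r xi.
Proof. by rewrite le_max lexx. Qed.

Lemma window_restrict r (g : R -> R) xi : 0 < r ->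
  window r xi * g xi = ((fun t => (1 - (t / r) ^+ 2) * g t) \_ `[-r, r]) xi.
Proof.
move=> r0; rewrite patchE mem_setE in_itv /= -ler_norml.
have E : ((xi / r) ^+ 2 <= 1) = (`|xi| <= r).
  rewrite -real_normK ?num_real// expr_le1// normrM [`|r^-1|]ger0_norm ?invr_ge0 ?(ltW r0)//.
  by rewrite ler_pdivrMr// mul1r.
rewrite /window -E; case: leP => h.
  by rewrite max_r// subr_ge0.
by rewrite max_l ?mul0r// subr_le0 ltW.
Qed.

Lemma continuous_cos_affine (z phi : R) : continuous (fun xi : R => cos (xi * z + phi)).
Proof.
move=> xi; apply: (@continuous_comp _ _ _ (fun xi : R => xi * z + phi) cos); last exact: continuous_cos.
by apply: continuousD; [apply: continuousM; [exact: cvg_id|exact: cst_continuous]|exact: cst_continuous].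
Qed.

Lemma continuous_parabola r : continuous (fun t : R => 1 - (t / r) ^+ 2).
Proof.
move=> t.
have ct : {for t, continuous (fun t : R => t / r)}.
  by apply: continuousM; [exact: cvg_id|exact: cst_continuous].
exact (continuousB (@cst_continuous R R 1 t) (continuousM ct ct)).
Qed.

Lemma integrable_window_mul r (g : R -> R) : 0 < r -> continuous g ->
  leb.-integrable setT (EFin \o (fun xi => window r xi * g xi)).
Proof.
move=> r0 cg.
have -> : (fun xi => window r xi * g xi) = (fun t => (1 - (t / r) ^+ 2) * g t) \_ `[-r, r].
  by apply/funext => xi; exact: window_restrict.
rewrite -restrict_EFin; apply/integrable_restrict => //; rewrite setTI.
apply: continuous_compact_integrable; first exact: segment_compact.
apply: continuous_subspaceT => t.
exact (continuousM (@continuous_parabola r t) (cg t)).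
Qed.

Lemma Rintegral_window_mul r (g : R -> R) : 0 < r ->
  \int[leb]_xi (window r xi * g xi) = \int[leb]_(t in `[-r, r]) ((1 - (t / r) ^+ 2) * g t).
Proof.
by move=> r0; rewrite [RHS]Rintegral_mkcond; apply: eq_Rintegral => t _; rewrite window_restrict.
Qed.

Lemma measurable_window r : measurable_fun setT (window r).
Proof.
apply: measurable_maxr => //; apply: measurable_funB => //.
by apply: measurable_funX; exact: measurable_funM.
Qed.

Lemma integrable_window r : 0 < r -> leb.-integrable setT (EFin \o window r).
Proof.
move=> r0; have := integrable_window_mul r0 (@cst_continuous R R 1).
by congr integrable; apply/funext => x; rewrite /= mulr1.
Qed.

Lemma Rintegral_window_cos r (z phi : R) : 0 < r -> z != 0 ->
  \int[leb]_xi (window r xi * cos (xi * z + phi)) =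
  (4 * sin (r * z) / (r ^+ 2 * z ^+ 3) - 4 * cos (r * z) / (r * z ^+ 2)) * cos phi.
Proof.
move=> r0 z0; rewrite Rintegral_window_mul//.
pose A xi := (1 - (xi / r) ^+ 2) * (sin (xi * z + phi) / z)
   - 2 * xi / (r ^+ 2 * z ^+ 2) * cos (xi * z + phi) + 2 / (r ^+ 2 * z ^+ 3) * sin (xi * z + phi).
have r0' : r != 0 by rewrite gt_eqF.
have dA (xi : R) : is_derive xi 1 A ((1 - (xi / r) ^+ 2) * cos (xi * z + phi)).
  have h : is_derive xi 1 (fun y : R => y) 1 by exact: is_derive_id.
  have hl : is_derive xi 1 (fun y : R => y * z + phi) z.
    notypeclasses refine (is_derive_val _ _); first by repeat derive_step.
    by rewrite /=; ring.
  have hs : is_derive xi 1 (fun y : R => sin (y * z + phi)) (z * cos (xi * z + phi)).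
    have hs0 := is_derive_sin (xi * z + phi).
    refine (is_derive_val (f := fun y : R => sin (y * z + phi))
      (@is_derive1_comp R (@sin R) (fun y : R => y * z + phi) xi _ _ hs0 hl) _).
    by rewrite mulrC.
  have hc : is_derive xi 1 (fun y : R => cos (y * z + phi)) (- z * sin (xi * z + phi)).
    have hc0 := is_derive_cos (xi * z + phi).
    refine (is_derive_val (f := fun y : R => cos (y * z + phi))
      (@is_derive1_comp R (@cos R) (fun y : R => y * z + phi) xi _ _ hc0 hl) _).
    by rewrite /=; ring.
  notypeclasses refine (is_derive_val _ _); first by rewrite /A; repeat derive_step.
  by rewrite /=; field; rewrite r0' z0.
have rr : - r < r by rewrite gtrN.
have cA (xi : R) : {for xi, continuous A} by exact: is_derive_continuous (dA xi).
have := @continuous_FTC2 R (fun t => (1 - (t / r) ^+ 2) * cos (t * z + phi)) A (- r) r rr.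
rewrite /Rintegral => ->; last first.
- by move=> x _; rewrite derive1E; have [_ ->] := dA x.
- split; [by move=> x _; have [] := dA x| |].
    exact: cvg_at_right_filter (cA _).
  exact: cvg_at_left_filter (cA _).
- apply: continuous_subspaceT => t.
  exact (continuousM (@continuous_parabola r t) (@continuous_cos_affine z phi t)).
rewrite -EFinB /= /A.
have -> : - r * z + phi = phi - r * z by ring.
rewrite [r * z + phi]addrC cosB cosD sinB sinD.
by field; rewrite r0' z0.
Qed.

Definition window_hat (r z : R) : R := \int[leb]_xi (window r xi * cos (xi * z)).

Lemma Rintegral_window_cos_phase r (z phi : R) : 0 < r ->
  \int[leb]_xi (window r xi * cos (xi * z + phi)) = window_hat r z * cos phi.
Proof.
move=> r0; have [->|z0] := eqVneq z 0.
  rewrite /window_hat -RintegralZr//; last first.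
    apply: integrable_window_mul => //.
    by under eq_fun do rewrite -[_ * _]addr0; exact: continuous_cos_affine.
  by apply: eq_Rintegral => xi _; rewrite !mulr0 add0r cos0 mulr1.
rewrite Rintegral_window_cos// /window_hat; congr (_ * _).
under eq_Rintegral do rewrite -[_ * z]addr0.
by rewrite Rintegral_window_cos// cos0 mulr1.
Qed.

(** The bound is a multiple of the Cauchy density at scale [1 / r], whose mass does
    not depend on [r]: estimates through it survive the opening of the window. Up
    to the scale [1 / r] it comes from the mass of the window, beyond that scale
    from the explicit transform. *)
Lemma window_hat_bound r z : 0 < r -> `|window_hat r z| <= 16 * (r / (1 + (r * z) ^+ 2)).
Proof.
move=> r0.
have D0 : 0 < 1 + (r * z) ^+ 2 by rewrite ltr_pwDl// sqr_ge0.
have [small|big] := leP ((r * z) ^+ 2) 1.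
  apply: (@le_trans _ _ (2 * r)); last first.
    by rewrite mulrA ler_pdivlMr//; have := ler_wpM2l (ltW r0) small; lra.
  have ii : leb.-integrable setT (EFin \o (fun xi => window r xi * cos (xi * z))).
    apply: integrable_window_mul => //.
    by under eq_fun do rewrite -[_ * _]addr0; exact: continuous_cos_affine.
  apply: le_trans (le_normr_Rintegral measurableT ii) _.
  have le1 xi : `|window r xi * cos (xi * z)| <= ((cst 1 : R -> R) \_ `[-r, r]) xi.
    rewrite (window_restrict (fun xi => cos (xi * z)) xi r0) !patchE.
    case: ifPn => [|_]; last by rewrite normr0.
    rewrite mem_setE in_itv /= => h.
    have h' : 0 <= 1 - (xi / r) ^+ 2 <= 1.
      rewrite gerBl sqr_ge0 andbT subr_ge0 -real_normK ?num_real// expr_le1//.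
      rewrite normrM [`|r^-1|]ger0_norm ?invr_ge0 ?(ltW r0)// ler_pdivrMr// mul1r ler_norml; exact: h.
    have /andP[a1 a2] := h'.
    rewrite normrM ger0_norm//; apply: mulr_ile1 => //.
    exact: normr_cos_le1.
  have ic : leb.-integrable setT (EFin \o ((cst 1 : R -> R) \_ `[-r, r])).
    rewrite -restrict_EFin; apply/integrable_restrict => //; rewrite setTI.
    apply: continuous_compact_integrable; first exact: segment_compact.
    by apply: continuous_subspaceT; exact: cst_continuous.
  apply: (@le_trans _ _ (\int[leb]_xi ((cst 1 : R -> R) \_ `[-r, r]) xi)).
    by apply: le_Rintegral => //; exact: integrable_norm ii.
  rewrite -Rintegral_mkcond Rintegral_cst//.
  have E : leb `[- r, r]%classic = (r - - r)%:E.
    by rewrite lebesgue_measure_itv /= lte_fin gtrN// -EFinB.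
  suff : 1 * fine (leb `[- r, r]%classic) <= 2 * r by [].
  rewrite E /=; lra.
have z0 : z != 0 by apply: contraTneq big => ->; rewrite mulr0 expr0n ltr10.
have r0' : r != 0 by rewrite gt_eqF.
have := Rintegral_window_cos 0 r0 z0; rewrite Rintegral_window_cos_phase// cos0 !mulr1 => ->.
have -> : 4 * sin (r * z) / (r ^+ 2 * z ^+ 3) - 4 * cos (r * z) / (r * z ^+ 2) =
  4 * r / (r * z) ^+ 2 * (sin (r * z) / (r * z) - cos (r * z)) by field; rewrite r0' z0.
have az : 1 <= `|r * z|.
  by rewrite leNgt; apply/negP => h; move: big; rewrite -real_normK ?num_real// ltNge expr_le1// ltW.
have m : `|sin (r * z) / (r * z) - cos (r * z)| <= 2.
  apply: le_trans (ler_normB _ _) _; rewrite (_ : 2 = 1 + 1 :> R)//; apply: lerD; last first.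
    exact: normr_cos_le1.
  rewrite normrM normfV ler_pdivrMr; last by apply: lt_le_trans az.
  by rewrite mul1r; apply: le_trans az; exact: normr_sin_le1.
rewrite normrM ger0_norm; last by rewrite divr_ge0 ?sqr_ge0// mulr_ge0// ltW.
apply: (@le_trans _ _ (4 * r / (r * z) ^+ 2 * 2)).
  by apply: ler_wpM2l => //; rewrite divr_ge0 ?sqr_ge0// mulr_ge0// ltW.
have -> : 4 * r / (r * z) ^+ 2 * 2 = 8 * r / (r * z) ^+ 2 by field; rewrite r0' z0.
have X0 : 0 < (r * z) ^+ 2 by apply: lt_trans big.
rewrite mulrA ler_pdivrMr// mulrAC ler_pdivlMr//.
by have := ler_wpM2l (ltW r0) (ltW big); lra.
Qed.

End WindowKernel.

(** * The windowed kernel in several variables *)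

Section WindowProduct.
Context {R : realType} (n : nat) (r : R) (r0 : 0 < r).
Local Notation leb := (@lebesgue_measure R).
Local Notation lebn := (@lebesgue_measure_n R).

Definition window_prod m (xi : m.-tuple R) : R := \prod_(i < m) window r (tnth xi i).

Lemma window_prod_ge0 m (xi : m.-tuple R) : 0 <= window_prod xi.
Proof. by apply: prodr_ge0 => i _; exact: window_ge0. Qed.

Lemma measurable_window_prod m : measurable_fun setT (@window_prod m).
Proof. exact: (@measurable_prod_tnth R m (fun=> window r) (fun=> @measurable_window R r)). Qed.

Lemma integrable_window_prod m : (lebn m).-integrable setT (EFin \o @window_prod m).
Proof.
apply/integrableP; split; first by apply/measurable_EFinP; exact: measurable_window_prod.
under eq_integral do rewrite /= ger0_norm ?window_prod_ge0//.
rewrite (@ge0_integral_prod_tnth R m (fun=> window r) (fun=> \int[leb]_x window r x)) ?ltry//.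
- by move=> i; exact: measurable_window.
- by move=> i x; exact: window_ge0.
by move=> i; rewrite /Rintegral fineK//; exact: (integrable_fin_num measurableT (integrable_window r0)).
Qed.

(** A general phase is needed for the induction on the dimension, which turns the
    contribution of the first coordinate into a phase for the others. *)
Lemma Rintegral_window_prod_cos m (z : m.-tuple R) (phi : R) :
  \int[lebn m]_xi (window_prod xi * cos (dotv xi z + phi)) =
  (\prod_(i < m) window_hat r (tnth z i)) * cos phi.
Proof.
have mG k (w : k.-tuple R) (a : R) :
    measurable_fun setT (fun xi : k.-tuple R => window_prod xi * cos (dotv xi w + a)).
  apply: measurable_funM; first exact: measurable_window_prod.
  apply: (measurableT_comp (continuous_measurable_fun (@continuous_cos R))).
  by apply: measurable_funD => //; exact: measurable_dotv.
have cos1 := @normr_cos_le1 R.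
elim: m z phi => [|m IH] z phi.
  rewrite /Rintegral /= integral_dirac//; last by apply/measurable_EFinP; exact: mG.
  by rewrite diracE in_setT mul1e /= /window_prod /dotv !big_ord0 add0r.
have bc a v : window_prod (tuple_cons (a, v)) = window r a * window_prod v.
  exact: (tuple_consE (fun=> window r)).
rewrite (@Rintegral_tuple_cons R m _ (window r) (@window_prod m) (mG _ z phi)
  (integrable_window r0) (@integrable_window_prod m)); last first.
  move=> a v; rewrite bc normrM ger0_norm ?mulr_ge0 ?window_ge0 ?window_prod_ge0//.
  by rewrite ler_piMr// mulr_ge0 ?window_ge0 ?window_prod_ge0.
transitivity (\int[leb]_a (window r a * cos (a * tnth z ord0 + phi) *
   \prod_(i < m) window_hat r (tnth [tuple of behead z] i))).
  apply: eq_Rintegral => a _.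
  rewrite mulrAC -mulrA -IH -RintegralZl//.
    by apply: eq_Rintegral => v _; rewrite bc dotv_cons mulrA; congr (_ * cos _); ring.
  apply: (@le_integrable _ _ _ (lebn m) setT measurableT _ (EFin \o @window_prod m)).
  - by apply/measurable_EFinP; exact: mG.
  - move=> v _; rewrite /= lee_fin normrM; exact: ler_piMr.
  - exact: integrable_window_prod.
rewrite RintegralZr//; last by apply: integrable_window_mul => //; exact: continuous_cos_affine.
rewrite Rintegral_window_cos_phase// big_ord_recl mulrAC; congr (_ * _ * _).
apply: eq_bigr => i _; congr window_hat.
by rewrite [in RHS](tuple_eta z) tnthS; congr tnth; exact: val_inj.
Qed.

Lemma measurable_window_hat : measurable_fun setT (window_hat r).
Proof.
have mG : measurable_fun setT (fun p : R * measurableTypeR R => window r p.2 * cos (p.2 * p.1)).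
  apply: measurable_funM; first exact: (measurableT_comp (measurable_window r) measurable_snd).
  apply: (measurableT_comp (continuous_measurable_fun (@continuous_cos R))).
  by apply: measurable_funM; [exact: measurable_snd|exact: measurable_fst].
exact: (@measurable_Rintegral_snd _ _ _ _ R leb _ mG).
Qed.

(** Dominates the transform of the window product by a kernel whose sections all
    have the same integral, independent of [r]. *)
Definition schur_kernel m (x y : m.-tuple R) : R :=
  \prod_(i < m) (16 * (r / (1 + (r * (tnth y i - tnth x i)) ^+ 2))).

Lemma schur_kernel_ge0 m (x y : m.-tuple R) : 0 <= schur_kernel x y.
Proof.
apply: prodr_ge0 => i _; rewrite mulr_ge0// divr_ge0 ?(ltW r0)//.
by rewrite addr_ge0 ?sqr_ge0.
Qed.

Lemma schur_kernelC m (x y : m.-tuple R) : schur_kernel x y = schur_kernel y x.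
Proof.
by apply: eq_bigr => i _; rewrite -[X in 1 + X]sqrrN -mulrN opprB.
Qed.

Lemma window_hat_schur m (x y : m.-tuple R) :
  `|\prod_(i < m) window_hat r (tnth x i - tnth y i)| <= schur_kernel x y.
Proof.
rewrite normr_prod; apply: ler_prod => i _; rewrite normr_ge0 /=.
apply: le_trans (window_hat_bound _ r0) _.
by rewrite -[X in 1 + X]sqrrN -mulrN opprB.
Qed.

Lemma measurable_cauchy_density : measurable_fun setT (fun u : R => (1 + (r * u) ^+ 2)^-1).
Proof.
apply: continuous_measurable_fun => u.
have ct : {for u, continuous (fun u : R => r * u)}.
  by apply: continuousM; [exact: cst_continuous|exact: cvg_id].
have cd := continuousD (@cst_continuous R R 1 u) (continuousM ct ct).
by apply: continuousV cd; rewrite gt_eqF// ltr_pwDl// sqr_ge0.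
Qed.

Lemma measurable_schur_kernel : measurable_fun setT
  (fun p : n.-tuple R * n.-tuple R => schur_kernel p.1 p.2).
Proof.
apply: measurable_prod => i _; apply: measurable_funM => //; apply: measurable_funM => //.
apply: (measurableT_comp measurable_cauchy_density).
by apply: measurable_funB; apply: measurableT_comp (measurable_tnth _) _.
Qed.

Lemma integral_schur_kernel m (x : m.-tuple R) :
  (\int[lebn m]_y (schur_kernel x y)%:E = ((16 * pi) ^+ m)%:E)%E.
Proof.
rewrite (@ge0_integral_prod_tnth R m (fun i y => 16 * (r / (1 + (r * (y - tnth x i)) ^+ 2)))
   (fun=> 16 * pi)).
- by rewrite prodr_const card_ord.
- move=> i; apply: measurable_funM => //; apply: measurable_funM => //.
  apply: (measurableT_comp measurable_cauchy_density).
  exact: measurable_funB.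
- move=> i y; rewrite mulr_ge0// divr_ge0 ?(ltW r0)//.
  by rewrite addr_ge0 ?sqr_ge0.
move=> i; under eq_integral do rewrite EFinM.
rewrite ge0_integralZl//.
- by rewrite cauchy_kernel_integral.
- apply/measurable_EFinP; apply: measurable_funM => //.
  apply: (measurableT_comp measurable_cauchy_density).
  exact: measurable_funB.
- by move=> y _; rewrite lee_fin divr_ge0 ?(ltW r0)// addr_ge0 ?sqr_ge0.
Qed.

End WindowProduct.

(** * A Bessel inequality for the Fourier integral *)

Section BesselInequality.
Context {R : realType} (n : nat).
Local Notation leb := (@lebesgue_measure R).
Local Notation lebn := (@lebesgue_measure_n R).
Implicit Types (x y xi : n.-tuple R).

Lemma normr_Rintegral_le d (T : measurableType d) (mu : {measure set T -> \bar R})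
    (f : T -> R) : measurable_fun setT f ->
  (`|\int[mu]_x f x|%:E <= \int[mu]_x `|f x|%:E)%E.
Proof.
move=> mf; have mE : measurable_fun setT (EFin \o f) by exact/measurable_EFinP.
apply: le_trans (le_abse_integral mu measurableT mE); rewrite /Rintegral.
by case: (integral _ _ _) => [s| |] //=; rewrite ?normr0 ?leey.
Qed.

Lemma dotvC x y : dotv x y = dotv y x.
Proof. by apply: eq_bigr => i _; rewrite mulrC. Qed.

Lemma dotvBl x y xi :
  dotv x xi - dotv y xi = dotv xi [tuple tnth x i - tnth y i | i < n].
Proof.
rewrite -sumrB; apply: eq_bigr => i _; rewrite tnth_mktuple; ring.
Qed.

Lemma measurable_dotv2 : measurable_fun setT (fun p : n.-tuple R * n.-tuple R => dotv p.1 p.2).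
Proof.
apply: measurable_sum => i.
by apply: measurable_funM; apply: measurableT_comp (measurable_tnth _) _.
Qed.

Let cosle := @normr_cos_le1 R.
Let sinle := @normr_sin_le1 R.
Let mcos : measurable_fun setT (@cos R).
Proof. exact: continuous_measurable_fun (@continuous_cos R). Qed.
Let msin : measurable_fun setT (@sin R).
Proof. exact: continuous_measurable_fun (@continuous_sin R). Qed.

Lemma measurable_cos_dotv xi : measurable_fun setT (fun x => cos (dotv x xi)).
Proof. by apply: (measurableT_comp mcos); exact: measurable_dotv. Qed.

Lemma measurable_sin_dotv xi : measurable_fun setT (fun x => sin (dotv x xi)).
Proof. by apply: (measurableT_comp msin); exact: measurable_dotv. Qed.

Variable f : n.-tuple R -> R.
Hypotheses (mf : measurable_fun setT f) (intf : (lebn n).-integrable setT (EFin \o f)).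

Definition cos_transform xi : R := \int[lebn n]_x (f x * cos (dotv x xi)).
Definition sin_transform xi : R := \int[lebn n]_x (f x * sin (dotv x xi)).

Lemma measurable_cos_transform : measurable_fun setT cos_transform.
Proof.
have mG : measurable_fun setT (fun p : n.-tuple R * n.-tuple R => f p.2 * cos (dotv p.2 p.1)).
  apply: measurable_funM; first exact: (measurableT_comp mf measurable_snd).
  apply: (measurableT_comp mcos).
  under eq_fun do rewrite dotvC; exact: measurable_dotv2.
exact: (@measurable_Rintegral_snd _ _ _ _ R (lebn n) _ mG).
Qed.

Lemma measurable_sin_transform : measurable_fun setT sin_transform.
Proof.
have mG : measurable_fun setT (fun p : n.-tuple R * n.-tuple R => f p.2 * sin (dotv p.2 p.1)).
  apply: measurable_funM; first exact: (measurableT_comp mf measurable_snd).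
  apply: (measurableT_comp msin).
  under eq_fun do rewrite dotvC; exact: measurable_dotv2.
exact: (@measurable_Rintegral_snd _ _ _ _ R (lebn n) _ mG).
Qed.

Lemma integrable_mul_le1 (u : n.-tuple R -> R) : measurable_fun setT u ->
  (forall x, `|u x| <= 1) -> (lebn n).-integrable setT (EFin \o (fun x => f x * u x)).
Proof.
move=> mu u1; apply: (@le_integrable _ _ _ (lebn n) setT measurableT _ (EFin \o f)) => //.
- by apply/measurable_EFinP; exact: measurable_funM.
- by move=> x _; rewrite /= lee_fin normrM ler_piMr.
Qed.

Let P x xi := cos (dotv x xi) * cos_transform xi + sin (dotv x xi) * sin_transform xi.

Lemma phase_integral x xi : P x xi = \int[lebn n]_y (f y * cos (dotv x xi - dotv y xi)).
Proof.
have ic := integrable_mul_le1 (measurable_cos_dotv xi) (fun y => cosle _).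
have is_ := integrable_mul_le1 (measurable_sin_dotv xi) (fun y => sinle _).
rewrite /P -!RintegralZl// -RintegralD//; last 2 first.
- by have := integrableZl measurableT (cos (dotv x xi)) ic.
- by have := integrableZl measurableT (sin (dotv x xi)) is_.
by apply: eq_Rintegral => y _; rewrite cosB; ring.
Qed.

Let N1 : R := \int[lebn n]_x `|f x|.

Lemma phase_integral_le x xi : `|P x xi| <= N1.
Proof.
rewrite phase_integral.
have m : measurable_fun setT (fun y => cos (dotv x xi - dotv y xi)).
  apply: (measurableT_comp mcos); apply: measurable_funB => //; exact: measurable_dotv.
have ii := integrable_mul_le1 m (fun y => cosle _).
apply: le_trans (le_normr_Rintegral measurableT ii) _.
apply: le_Rintegral => //.
- exact: integrable_norm ii.
- exact: integrable_norm intf.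
by move=> y _; rewrite normrM ler_piMr.
Qed.

Lemma transform_square xi : cos_transform xi ^+ 2 + sin_transform xi ^+ 2 =
  \int[lebn n]_x (f x * P x xi).
Proof.
have ic := integrable_mul_le1 (measurable_cos_dotv xi) (fun y => cosle _).
have is_ := integrable_mul_le1 (measurable_sin_dotv xi) (fun y => sinle _).
rewrite !expr2 {1}/cos_transform {1}/sin_transform -!RintegralZr// -RintegralD//; last 2 first.
- by have := integrableZl measurableT (cos_transform xi) ic; congr integrable;
    apply/funext => x; rewrite /= muleC.
- by have := integrableZl measurableT (sin_transform xi) is_; congr integrable;
    apply/funext => x; rewrite /= muleC.
by apply: eq_Rintegral => y _; rewrite /P; ring.
Qed.

Variables (r : R) (r0 : 0 < r).
Local Notation V := (@window_prod R r n).

Let intN1 : (lebn n).-integrable setT (EFin \o (fun x => `|f x|)).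
Proof. exact: integrable_norm intf. Qed.

Let mphase x : measurable_fun setT (fun p : n.-tuple R * n.-tuple R =>
  cos (dotv x p.1 - dotv p.2 p.1)).
Proof.
apply: (measurableT_comp mcos); apply: measurable_funB.
  under eq_fun do rewrite dotvC.
  by apply: measurableT_comp (measurable_dotv _) _.
by under eq_fun do rewrite dotvC; exact: measurable_dotv2.
Qed.

Let integrable_phase xi : (lebn n).-integrable setT (EFin \o (fun x => f x * P x xi)).
Proof.
apply: (@le_integrable _ _ _ (lebn n) setT measurableT _ (EFin \o (fun x => N1 * `|f x|))) => //.
- apply/measurable_EFinP/measurable_funM => //; apply: measurable_funD; apply: measurable_funM => //.
    exact: measurable_cos_dotv.
  exact: measurable_sin_dotv.
- move=> x _; rewrite /= lee_fin normrM mulrC [X in _ <= X]ger0_norm; last first.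
    by rewrite mulr_ge0//; exact: Rintegral_ge0.
  by apply: ler_wpM2r => //; exact: phase_integral_le.
- exact: (integrableZl measurableT N1 intN1).
Qed.

(** The TT* identity: expanding the square turns the windowed L2 norm of the
    transform into a quadratic form in [f] whose kernel is the transform of the
    window. *)
Lemma window_square : \int[lebn n]_xi (V xi * (cos_transform xi ^+ 2 + sin_transform xi ^+ 2)) =
  \int[lebn n]_x \int[lebn n]_y
    (f x * (f y * \prod_(i < n) window_hat r (tnth x i - tnth y i))).
Proof.
have V0 xi : 0 <= V xi by exact: window_prod_ge0.
have mV := @measurable_window_prod R r n; have iV := @integrable_window_prod R r r0 n.
have N10 : 0 <= N1 by exact: Rintegral_ge0.
have iNf : (lebn n).-integrable setT (EFin \o (fun x => N1 * `|f x|)).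
  exact: (integrableZl measurableT N1 intN1).
transitivity (\int[lebn n]_xi \int[lebn n]_x (V xi * (f x * P x xi))).
  by apply: eq_Rintegral => xi _; rewrite transform_square RintegralZl.
have mG1 : measurable_fun setT (fun p : n.-tuple R * n.-tuple R => V p.1 * (f p.2 * P p.2 p.1)).
  apply: measurable_funM; first exact: (measurableT_comp mV measurable_fst).
  apply: measurable_funM; first exact: (measurableT_comp mf measurable_snd).
  have md : measurable_fun setT (fun p : n.-tuple R * n.-tuple R => dotv p.2 p.1).
    by under eq_fun do rewrite dotvC; exact: measurable_dotv2.
  apply: measurable_funD; apply: measurable_funM.
  - exact: (measurableT_comp mcos md).
  - exact: (measurableT_comp measurable_cos_transform measurable_fst).
  - exact: (measurableT_comp msin md).
  - exact: (measurableT_comp measurable_sin_transform measurable_fst).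
rewrite (@Rintegral_swap _ _ _ _ R (lebn n) (lebn n) (fun p => V p.1 * (f p.2 * P p.2 p.1))
  V (fun x => N1 * `|f x|) mG1 iV iNf) /=; last first.
  move=> xi x /=; rewrite normrM ger0_norm//; apply: ler_wpM2l => //.
  by rewrite normrM mulrC; apply: ler_wpM2r => //; exact: phase_integral_le.
apply: eq_Rintegral => x _.
have mGx : measurable_fun setT (fun p : n.-tuple R * n.-tuple R =>
    V p.1 * (f p.2 * cos (dotv x p.1 - dotv p.2 p.1))).
  apply: measurable_funM; first exact: (measurableT_comp mV measurable_fst).
  by apply: measurable_funM; first exact: (measurableT_comp mf measurable_snd).
have bG xi y : `|V xi * (f y * cos (dotv x xi - dotv y xi))| <= V xi * `|f y|.
  by rewrite normrM ger0_norm//; apply: ler_wpM2l => //; rewrite normrM ler_piMr.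
transitivity (f x * \int[lebn n]_xi \int[lebn n]_y (V xi * (f y * cos (dotv x xi - dotv y xi)))).
  rewrite -RintegralZl//; last first.
    apply: (@le_integrable _ _ _ (lebn n) setT measurableT _ (EFin \o (fun xi => N1 * V xi))).
    - apply/measurable_EFinP.
      exact: (@measurable_Rintegral_snd _ _ _ _ R (lebn n) _ mGx).
    - move=> xi _; rewrite /= lee_fin [X in _ <= X]ger0_norm ?mulr_ge0//.
      rewrite RintegralZl//; last first.
        apply: integrable_mul_le1 => //.
        apply: (measurableT_comp mcos); apply: measurable_funB => //; exact: measurable_dotv.
      rewrite -phase_integral normrM ger0_norm// mulrC.
      by apply: ler_wpM2r => //; exact: phase_integral_le.
    - exact: (integrableZl measurableT N1 iV).
  apply: eq_Rintegral => xi _; rewrite phase_integral RintegralZl//; first by ring.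
  apply: integrable_mul_le1 => //.
  apply: (measurableT_comp mcos); apply: measurable_funB => //; exact: measurable_dotv.
rewrite (@Rintegral_swap _ _ _ _ R (lebn n) (lebn n)
  (fun p => V p.1 * (f p.2 * cos (dotv x p.1 - dotv p.2 p.1))) V (fun y => `|f y|) mGx iV intN1 bG) /=.
have EK y : \prod_(i < n) window_hat r (tnth [tuple tnth x i - tnth y i | i < n] i) =
    \prod_(i < n) window_hat r (tnth x i - tnth y i).
  by apply: eq_bigr => i _; rewrite tnth_mktuple.
have iVc y : (lebn n).-integrable setT
    (EFin \o (fun xi => V xi * cos (dotv xi [tuple tnth x i - tnth y i | i < n] + 0))).
  apply: (@le_integrable _ _ _ (lebn n) setT measurableT _ (EFin \o V)) => //.
  - apply/measurable_EFinP/measurable_funM => //.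
    apply: (measurableT_comp mcos); apply: measurable_funD => //; exact: measurable_dotv.
  - by move=> xi _; rewrite /= lee_fin normrM ler_piMr.
have E y : \int[lebn n]_xi (V xi * (f y * cos (dotv x xi - dotv y xi))) =
   f y * \prod_(i < n) window_hat r (tnth x i - tnth y i).
  transitivity (\int[lebn n]_xi (f y * (V xi * cos (dotv xi [tuple tnth x i - tnth y i | i < n] + 0)))).
    by apply: eq_Rintegral => xi _; rewrite dotvBl addr0; ring.
  by rewrite RintegralZl// Rintegral_window_prod_cos// cos0 mulr1 EK.
under eq_Rintegral do rewrite E.
have iK : (lebn n).-integrable setT
    (EFin \o (fun y => f y * \prod_(i < n) window_hat r (tnth x i - tnth y i))).
  apply: (@le_integrable _ _ _ (lebn n) setT measurableT _
    (EFin \o (fun y => (\int[lebn n]_xi V xi) * `|f y|))).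
  - apply/measurable_EFinP/measurable_funM => //; apply: measurable_prod => i _.
    apply: (measurableT_comp (@measurable_window_hat R r)).
    by apply: measurable_funB => //; exact: measurable_tnth.
  - move=> y _; rewrite /= lee_fin [X in _ <= X]ger0_norm; last first.
      by rewrite mulr_ge0//; exact: Rintegral_ge0.
    rewrite normrM mulrC; apply: ler_wpM2r => //.
    have := Rintegral_window_prod_cos r0 [tuple tnth x i - tnth y i | i < n] 0.
    rewrite cos0 mulr1 EK => <-.
    apply: le_trans (le_normr_Rintegral measurableT (iVc y)) _.
    apply: le_Rintegral => //; first exact: integrable_norm (iVc y).
    by move=> xi _; rewrite normrM (ger0_norm (V0 _)) ler_piMr.
  - exact: (integrableZl measurableT _ intN1).
by rewrite -RintegralZl//; exact: eq_Rintegral.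
Qed.

(** Schur's test for the quadratic form of [window_square]: the product
    [`|f x * f y|] is at most the mean of the squares, and the sections of the kernel
    have mass [(16 * pi) ^+ n]. *)
Lemma windowed_bessel :
  (\int[lebn n]_xi (V xi * (cos_transform xi ^+ 2 + sin_transform xi ^+ 2))%:E
   <= ((16 * pi) ^+ n)%:E * \int[lebn n]_x (f x ^+ 2)%:E)%E.
Proof.
have V0 xi : 0 <= V xi by exact: window_prod_ge0.
have mV := @measurable_window_prod R r n; have iV := @integrable_window_prod R r r0 n.
have N10 : 0 <= N1 by exact: Rintegral_ge0.
pose k2 (x y : n.-tuple R) : R := schur_kernel r x y.
have k20 x y : 0 <= k2 x y by exact: schur_kernel_ge0.
have mk : measurable_fun setT (fun p : n.-tuple R * n.-tuple R => k2 p.1 p.2).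
  exact: measurable_schur_kernel.
have mf1 : measurable_fun setT (fun p : n.-tuple R * n.-tuple R => f p.1).
  exact: (measurableT_comp mf measurable_fst).
have mf2 : measurable_fun setT (fun p : n.-tuple R * n.-tuple R => f p.2).
  exact: (measurableT_comp mf measurable_snd).
have absle xi : V xi * (cos_transform xi ^+ 2 + sin_transform xi ^+ 2) <= V xi * (N1 * N1).
  apply: ler_wpM2l => //; rewrite transform_square.
  have iP := integrable_phase xi.
  apply: le_trans (ler_norm _) _; apply: le_trans (le_normr_Rintegral measurableT iP) _.
  rewrite -[X in _ <= N1 * X]/(\int[lebn n]_x `|f x|) -RintegralZl//.
  apply: le_Rintegral => //; first exact: integrable_norm iP.
    exact: (integrableZl measurableT N1 intN1).
  move=> x _; rewrite normrM mulrC; apply: ler_wpM2r => //; exact: phase_integral_le.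
have i1 : (lebn n).-integrable setT
    (EFin \o (fun xi => V xi * (cos_transform xi ^+ 2 + sin_transform xi ^+ 2))).
  apply: (@le_integrable _ _ _ (lebn n) setT measurableT _ (EFin \o (fun xi => (N1 * N1) * V xi))).
  - apply/measurable_EFinP/measurable_funM => //; apply: measurable_funD; apply: measurable_funX.
      exact: measurable_cos_transform.
    exact: measurable_sin_transform.
  - move=> xi _; rewrite /= lee_fin !ger0_norm ?mulr_ge0 ?addr_ge0 ?sqr_ge0//.
    by rewrite mulrC mulrC [X in _ <= X]mulrC.
  - exact: (integrableZl measurableT _ iV).
apply: (@le_trans _ _ (\int[lebn n]_xi (V xi * (cos_transform xi ^+ 2 + sin_transform xi ^+ 2)))%:E).
  by rewrite /Rintegral fineK//; exact: (integrable_fin_num measurableT i1).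
rewrite window_square.
pose U x := \int[lebn n]_y (f x * (f y * \prod_(i < n) window_hat r (tnth x i - tnth y i))).
have mK : measurable_fun setT (fun p : n.-tuple R * n.-tuple R =>
    f p.1 * (f p.2 * \prod_(i < n) window_hat r (tnth p.1 i - tnth p.2 i))).
  apply: measurable_funM => //; apply: measurable_funM => //; apply: measurable_prod => i _.
  apply: (measurableT_comp (@measurable_window_hat R r)).
  by apply: measurable_funB; apply: measurableT_comp (measurable_tnth _) _.
have mU : measurable_fun setT U by exact: (@measurable_Rintegral_snd _ _ _ _ R (lebn n) _ mK).
apply: (@le_trans _ _ (`|\int[lebn n]_x U x|%:E)%E); first by rewrite lee_fin ler_norm.
apply: le_trans (normr_Rintegral_le (lebn n) mU) _.
pose W1 (p : n.-tuple R * n.-tuple R) : \bar R := (2^-1 * f p.1 ^+ 2 * k2 p.1 p.2)%:E.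
pose W2 (p : n.-tuple R * n.-tuple R) : \bar R := (2^-1 * f p.2 ^+ 2 * k2 p.1 p.2)%:E.
have mW1 : measurable_fun setT W1.
  apply/measurable_EFinP; apply: measurable_funM => //; apply: measurable_funM => //.
  exact: measurable_funX.
have mW2 : measurable_fun setT W2.
  apply/measurable_EFinP; apply: measurable_funM => //; apply: measurable_funM => //.
  exact: measurable_funX.
have W10 p : (0 <= W1 p)%E by rewrite lee_fin mulr_ge0// mulr_ge0// sqr_ge0.
have W20 p : (0 <= W2 p)%E by rewrite lee_fin mulr_ge0// mulr_ge0// sqr_ge0.
have msec x (W : n.-tuple R * n.-tuple R -> \bar R) : measurable_fun setT W ->
    measurable_fun setT (fun y => W (x, y)).
  by move=> mW; exact: (measurableT_comp mW (pair1_measurable x)).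
apply: (@le_trans _ _ (\int[lebn n]_x \int[lebn n]_y (W1 (x, y) + W2 (x, y)))%E).
  apply: ge0_le_integral => //.
  - by apply/measurable_EFinP; exact: measurableT_comp.
  - apply: (@measurable_fun_fubini_tonelli_F _ _ _ _ _ (lebn n) (fun p => W1 p + W2 p)%E).
      exact: emeasurable_funD.
    by move=> p; rewrite adde_ge0.
  move=> x _.
  have mKx : measurable_fun setT
      (fun y => f x * (f y * \prod_(i < n) window_hat r (tnth x i - tnth y i))).
    exact: (measurableT_comp mK (pair1_measurable x)).
  apply: le_trans (normr_Rintegral_le (lebn n) mKx) _.
  apply: ge0_le_integral => //.
  - by apply/measurable_EFinP; exact: measurableT_comp.
  - by apply: emeasurable_funD; exact: msec.
  move=> y _; rewrite /W1 /W2 /= -EFinD lee_fin mulrA normrM.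
  apply: le_trans (ler_wpM2l (normr_ge0 _) (window_hat_schur _ _ _)) _ => //.
  rewrite -/(k2 x y) -mulrDl; apply: ler_wpM2r => //.
  rewrite normrM -(real_normK (num_real (f x))) -(real_normK (num_real (f y))).
  have := sqr_ge0 (`|f x| - `|f y|); lra.
pose A := (16 * pi : R) ^+ n.
have A0 : 0 <= A by rewrite exprn_ge0// mulr_ge0// pi_ge0.
have half : (\int[lebn n]_x \int[lebn n]_y W1 (x, y) = (2^-1 * A)%:E * \int[lebn n]_x (f x ^+ 2)%:E)%E.
  rewrite -ge0_integralZl//; last 3 first.
  - by apply/measurable_EFinP; exact: measurable_funX.
  - by move=> x _; rewrite lee_fin sqr_ge0.
  - by rewrite lee_fin mulr_ge0.
  apply: eq_integral => x _; rewrite /W1 /=.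
  under eq_integral do rewrite EFinM.
  rewrite ge0_integralZl//.
  - by rewrite integral_schur_kernel// -!EFinM -/A; congr EFin; ring.
  - apply/measurable_EFinP; exact: (measurableT_comp mk (pair1_measurable x)).
  - by move=> y _; rewrite lee_fin.
  - by rewrite lee_fin mulr_ge0// sqr_ge0.
have half2 : (\int[lebn n]_x \int[lebn n]_y W2 (x, y) = (2^-1 * A)%:E * \int[lebn n]_x (f x ^+ 2)%:E)%E.
  rewrite -half (@fubini_tonelli _ _ _ _ R (lebn n) (lebn n) W2 mW2 W20).
  apply: eq_integral => x _; apply: eq_integral => y _.
  by rewrite /W1 /W2 /= /k2 schur_kernelC.
have -> : (\int[lebn n]_x \int[lebn n]_y (W1 (x, y) + W2 (x, y)) =
   \int[lebn n]_x (\int[lebn n]_y W1 (x, y) + \int[lebn n]_y W2 (x, y)))%E.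
  by apply: eq_integral => x _; rewrite ge0_integralD//; exact: msec.
rewrite ge0_integralD//; last 4 first.
- by move=> x _; exact: integral_ge0.
- exact: (@measurable_fun_fubini_tonelli_F _ _ _ _ _ (lebn n) W1).
- by move=> x _; exact: integral_ge0.
- exact: (@measurable_fun_fubini_tonelli_F _ _ _ _ _ (lebn n) W2).
have S0 : (0 <= \int[lebn n]_x (f x ^+ 2)%:E)%E.
  by apply: integral_ge0 => x _; rewrite lee_fin sqr_ge0.
rewrite half half2 -ge0_muleDl ?lee_fin ?mulr_ge0// -EFinD -/A.
by rewrite (_ : 2^-1 * A + 2^-1 * A = A)//; field.
Qed.

End BesselInequality.

Section FullBessel.
Context {R : realType} (n : nat).
Local Notation lebn := (@lebesgue_measure_n R).
Implicit Types (xi : n.-tuple R).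

(** Half of Plancherel's theorem, up to a constant. The bound of [windowed_bessel] does
    not depend on the size of the window, and a window twice as large as a cube is
    at least [(3 / 4) ^+ n] on it. *)
Lemma bessel (f : n.-tuple R -> R) : measurable_fun setT f ->
  (lebn n).-integrable setT (EFin \o f) ->
  (\int[lebn n]_xi (cos_transform f xi ^+ 2 + sin_transform f xi ^+ 2)%:E
   <= ((64 / 3 * pi) ^+ n)%:E * \int[lebn n]_x (f x ^+ 2)%:E)%E.
Proof.
move=> mf intf.
set X := fun xi => _; set S2 := (X in (_ * X)%E).
have mX : measurable_fun setT (fun xi => cos_transform f xi ^+ 2 + sin_transform f xi ^+ 2).
  apply: measurable_funD; apply: measurable_funX.
    exact: measurable_cos_transform.
  exact: measurable_sin_transform.
have mXE : measurable_fun setT X by exact/measurable_EFinP.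
have X0 xi : (0 <= X xi)%E by rewrite lee_fin addr_ge0 ?sqr_ge0.
pose F (k : nat) : set (n.-tuple R) := [set xi | forall i, `|tnth xi i| <= k.+1%:R].
have mF k : measurable (F k).
  have -> : F k = \bigcap_(i in [set: 'I_n]) ((@tnth n R)^~ i @^-1` `[- k.+1%:R, k.+1%:R]).
    apply/seteqP; split => xi h i; first by move=> _; rewrite /= in_itv /= -ler_norml; exact: h.
    by have := h i Logic.I; rewrite /= in_itv /= -ler_norml.
  apply: fin_bigcap_measurable => // i _; rewrite -[X in measurable X]setTI.
  by apply: (measurable_tnth i) => //; exact: measurable_itv.
have ndF : nondecreasing_seq F.
  move=> j k jk; apply/subsetPset => xi h i; apply: le_trans (h i) _.
  by rewrite ler_nat ltnS.
have FT : \bigcup_k F k = setT.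
  apply/seteqP; split => // xi _.
  exists (Num.Def.truncn (\sum_(i < n) `|tnth xi i|)) => //= i.
  apply: (@le_trans _ _ (\sum_(i < n) `|tnth xi i|)).
    by rewrite (bigD1 i)//= lerDl sumr_ge0.
  by apply/ltW/truncnS_gt.
have cvgF := @ge0_nondecreasing_set_cvg_integral _ _ R F X (lebn n) ndF mF
  (fun i => measurable_funTS mXE) (fun i xi _ => X0 xi).
rewrite FT in cvgF.
rewrite -(cvg_lim (@ereal_hausdorff R) cvgF); apply: lime_le; first by apply/cvg_ex; eexists; exact: cvgF.
near=> k.
pose r : R := 2 * k.+1%:R.
have r0 : 0 < r by rewrite mulr_gt0.
pose V := @window_prod R r n.
have V0 xi : 0 <= V xi by exact: window_prod_ge0.
have VF xi : F k xi -> (3 / 4) ^+ n <= V xi.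
  move=> h; rewrite -[n in _ ^+ n]card_ord -prodr_const; apply: ler_prod => i _.
  rewrite divr_ge0//=; have h4 : (tnth xi i / r) ^+ 2 <= 4^-1.
    rewrite exprMn exprVn ler_pdivrMr ?exprn_gt0//.
    rewrite -real_normK ?num_real// /r; have := h i.
    have := normr_ge0 (tnth xi i); have : 0 < k.+1%:R :> R by [].
    by nra.
  rewrite /window le_max; apply/orP; right; lra.
have mVX : measurable_fun setT (fun xi => (V xi * (cos_transform f xi ^+ 2 + sin_transform f xi ^+ 2))%:E).
  apply/measurable_EFinP/measurable_funM => //; exact: measurable_window_prod.
have VX0 xi : (0 <= (V xi * (cos_transform f xi ^+ 2 + sin_transform f xi ^+ 2))%:E)%E.
  by rewrite lee_fin mulr_ge0// addr_ge0 ?sqr_ge0.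
apply: (@le_trans _ _ (((4/3) ^+ n)%:E *
   \int[lebn n]_xi (V xi * (cos_transform f xi ^+ 2 + sin_transform f xi ^+ 2))%:E)%E).
  apply: (@le_trans _ _ (\int[lebn n]_(xi in F k) (((4/3) ^+ n)%:E *
     (V xi * (cos_transform f xi ^+ 2 + sin_transform f xi ^+ 2))%:E))%E).
    apply: ge0_le_integral => //.
    - exact: measurable_funTS.
    - by apply: measurable_funTS; apply: emeasurable_funM => //; exact: measurable_cst.
    move=> xi Fxi; rewrite /X -EFinM lee_fin mulrA ler_peMl ?addr_ge0 ?sqr_ge0//.
    apply: le_trans (ler_wpM2l _ (VF _ Fxi)); last by rewrite exprn_ge0// divr_ge0.
    by rewrite -exprMn (_ : 4 / 3 * (3 / 4) = 1 :> R) ?expr1n//; field.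
  have c0 : (0 <= ((4/3 : R) ^+ n)%:E)%E by rewrite lee_fin exprn_ge0// divr_ge0.
  rewrite (ge0_integralZl (lebn n) (mF k) (measurable_funTS mVX) (fun xi _ => VX0 xi) c0).
  apply: lee_wpmul2l; first by rewrite lee_fin exprn_ge0// divr_ge0.
  by apply: ge0_subset_integral => //.
have S20 : (0 <= S2)%E by apply: integral_ge0 => x _; rewrite lee_fin sqr_ge0.
apply: le_trans (lee_wpmul2l _ (windowed_bessel mf intf r0)) _.
  by rewrite lee_fin exprn_ge0// divr_ge0.
rewrite muleA -EFinM -exprMn (_ : 4 / 3 * (16 * pi) = 64 / 3 * pi)//; field.
Unshelve. all: by end_near. Qed.

End FullBessel.

(** * Norms of complex-valued functions *)

Section ComplexNorms.
Context {R : realType} (n : nat).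
Local Notation lebn := (@lebesgue_measure_n R).
Implicit Types (f g : n.-tuple R -> R[i]).

Definition normsq (z : R[i]) : R := complex.Re z ^+ 2 + complex.Im z ^+ 2.

Lemma normsq_ge0 z : 0 <= normsq z.
Proof. by rewrite addr_ge0 ?sqr_ge0. Qed.

Lemma normc_sqrt z : Normc.normc z = Num.sqrt (normsq z).
Proof. by case: z. Qed.

Lemma normc_ge0 (z : R[i]) : 0 <= Normc.normc z.
Proof. by rewrite normc_sqrt sqrtr_ge0. Qed.

Lemma normc_sqr z : Normc.normc z ^+ 2 = normsq z.
Proof. by rewrite normc_sqrt sqr_sqrtr// normsq_ge0. Qed.

Lemma normsq_scale (a : R) z : normsq ((a%:C)%C * z) = a ^+ 2 * normsq z.
Proof. by case: z => x y; rewrite /normsq /=; ring. Qed.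

Lemma normsqD z w : normsq (z + w) <= 2 * normsq z + 2 * normsq w.
Proof.
case: z w => [a b] [c d]; rewrite /normsq /=.
have := sqr_ge0 (a - c); have := sqr_ge0 (b - d); lra.
Qed.

Lemma measurable_normsq (v : n.-tuple R -> R[i]) : measurable_fun setT (fun xi => complex.Re (v xi)) ->
  measurable_fun setT (fun xi => complex.Im (v xi)) -> measurable_fun setT (fun xi => normsq (v xi)).
Proof. by move=> mr mi; apply: measurable_funD; exact: measurable_funX. Qed.

Lemma measurable_normsqB (v w : n.-tuple R -> R[i]) : measurable_fun setT (fun xi => complex.Re (v xi)) ->
  measurable_fun setT (fun xi => complex.Im (v xi)) ->
  measurable_fun setT (fun xi => complex.Re (w xi)) ->
  measurable_fun setT (fun xi => complex.Im (w xi)) ->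
  measurable_fun setT (fun xi => normsq (v xi - w xi)).
Proof.
move=> mvr mvi mwr mwi; apply: measurable_funD; apply: measurable_funX.
  have -> : (fun xi => complex.Re (v xi - w xi)) =
    (fun xi => complex.Re (v xi) - complex.Re (w xi)) by apply/funext => xi; rewrite raddfB.
  exact: measurable_funB.
have -> : (fun xi => complex.Im (v xi - w xi)) =
  (fun xi => complex.Im (v xi) - complex.Im (w xi)) by apply/funext => xi; rewrite raddfB.
exact: measurable_funB.
Qed.

Lemma normsqN (z : R[i]) : normsq (- z) = normsq z.
Proof. by case: z => a b; rewrite /normsq /= !sqrrN. Qed.

Lemma integral_normc_pow (p : R) f : 0 < p ->
  (cLnorm p f `^ p = \int[lebn n]_x (Normc.normc (f x) `^ p)%:E)%E.
Proof.
move=> p0; rewrite /cLnorm (poweR_Lnorm _ _ (lt0r_neq0 p0)).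
by apply: eq_integral => x _; rewrite /= ger0_norm ?normc_ge0.
Qed.

Lemma cLnorm_ge0 p f : (0 <= cLnorm p f)%E.
Proof. exact: Lnorm_ge0. Qed.

Lemma integral_normc_pow_le (p K : R) f : 0 < p -> (cLnorm p f <= K%:E)%E ->
  (\int[lebn n]_x (Normc.normc (f x) `^ p)%:E <= (K `^ p)%:E)%E.
Proof.
move=> p0 h; rewrite -integral_normc_pow// -poweR_EFin.
apply: gt0_ler_poweR => //; rewrite ?in_itv /= ?leey ?andbT.
- exact: ltW.
- exact: cLnorm_ge0.
- exact: le_trans (cLnorm_ge0 _ _) h.
Qed.

Lemma integral_normsq f : (\int[lebn n]_x (normsq (f x))%:E = cLnorm 2 f `^ 2)%E.
Proof.
rewrite integral_normc_pow//; apply: eq_integral => x _.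
by rewrite powR_mulrn ?normc_ge0// normc_sqr.
Qed.

Lemma cLnorm2_le f (K : R) : 0 <= K ->
  (\int[lebn n]_x (normsq (f x))%:E <= (K ^+ 2)%:E)%E -> (cLnorm 2 f <= K%:E)%E.
Proof.
move=> K0; rewrite integral_normsq => h.
have := @gt0_ler_poweR R 2^-1 _ _ _ _ _ h; rewrite -poweRrM mulfV// poweRe1 ?cLnorm_ge0//.
rewrite poweR_EFin powR12_sqrt ?sqr_ge0// sqrtr_sqr ger0_norm//; apply.
- by rewrite invr_ge0.
- by rewrite in_itv /= leey poweR_ge0.
- by rewrite in_itv /= leey lee_fin sqr_ge0.
Qed.

Lemma integral_normsq_le f (K : R) : (cLnorm 2 f <= K%:E)%E ->
  (\int[lebn n]_x (normsq (f x))%:E <= (K ^+ 2)%:E)%E.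
Proof.
move=> h; have K0 : 0 <= K by rewrite -lee_fin; exact: le_trans (cLnorm_ge0 _ _) h.
rewrite integral_normsq integral_normc_pow//.
by have := integral_normc_pow_le (ltr0n R 2) h; rewrite powR_mulrn.
Qed.

End ComplexNorms.

(** * Euclidean balls *)

Section EuclideanBall.
Context {R : realType} (n : nat).
Local Notation leb := (@lebesgue_measure R).
Local Notation lebn := (@lebesgue_measure_n R).
Implicit Types x : n.-tuple R.

Lemma enorm_ge0 x : 0 <= enorm x.
Proof. exact: sqrtr_ge0. Qed.

Lemma tnth_le_enorm x i : `|tnth x i| <= enorm x.
Proof.
rewrite -sqrtr_sqr ler_wsqrtr// /dotv (bigD1 i)//= expr2 lerDl sumr_ge0// => j _.
by rewrite -expr2 sqr_ge0.
Qed.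

Lemma measurable_dotv_diag : measurable_fun setT (fun x => dotv x x).
Proof.
by apply: measurable_sum => i; apply: measurable_funM; exact: measurable_tnth.
Qed.

Lemma measurable_enorm : measurable_fun setT (@enorm R n).
Proof.
apply: (measurableT_comp _ measurable_dotv_diag).
exact: continuous_measurable_fun (@sqrt_continuous R).
Qed.

Definition eball r : set (n.-tuple R) := [set x | enorm x <= r].

Lemma measurable_eball r : measurable (eball r).
Proof.
have -> : eball r = setT `&` @enorm R n @^-1` [set` `]-oo, r]].
  by apply/seteqP; split=> x; rewrite /eball /= in_itv /=; [split|case].
by apply: measurable_enorm => //; exact: measurable_itv.
Qed.

Lemma eball_finite r : (lebn n (eball r) < +oo)%E.
Proof.
have mb : measurable [set x : n.-tuple R | forall i, [set` `[-r, r]] (tnth x i)].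
  have -> : [set x : n.-tuple R | forall i, [set` `[-r, r]] (tnth x i)] =
      \bigcap_(i in [set: 'I_n]) ((@tnth n R)^~ i @^-1` `[- r, r]).
    by apply/seteqP; split => x h i => [_|]; exact: h.
  apply: fin_bigcap_measurable => // i _; rewrite -[X in measurable X]setTI.
  by apply: (measurable_tnth i) => //; exact: measurable_itv.
apply: (@le_lt_trans _ _ (lebn n [set x | forall i, [set` `[-r, r]] (tnth x i)])).
  apply: le_measure; rewrite ?inE//; first exact: measurable_eball.
  move=> x h i; rewrite /= in_itv /= -ler_norml; exact: le_trans (tnth_le_enorm _ _) h.
rewrite (@lebesgue_measure_n_box R n (fun=> [set` `[-r, r]])); last by move=> i; exact: measurable_itv.
have [l hl] : exists l : R, leb [set` `[- r, r]] = l%:E.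
  rewrite lebesgue_measure_itv /=; case: ifP => _; last by exists 0.
  by exists (r - - r); rewrite EFinB.
under eq_bigr do rewrite hl.
by rewrite prodEFin ltry.
Qed.

End EuclideanBall.

(** * The truncated Fourier transform and the resolvent weight *)

Section TruncatedTransform.
Context {R : realType} (n : nat).
Local Notation leb := (@lebesgue_measure R).
Local Notation lebn := (@lebesgue_measure_n R).
Implicit Types (x xi : n.-tuple R) (u v : n.-tuple R -> R).

Definition transform_sq u xi : R := cos_transform u xi ^+ 2 + sin_transform u xi ^+ 2.

Lemma transform_sq_ge0 u xi : 0 <= transform_sq u xi.
Proof. by rewrite addr_ge0 ?sqr_ge0. Qed.

Lemma measurable_transform_sq u : measurable_fun setT u -> measurable_fun setT (transform_sq u).
Proof.
move=> mu; apply: measurable_funD; apply: measurable_funX.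
  exact: measurable_cos_transform.
exact: measurable_sin_transform.
Qed.

Lemma transform_sq_le u xi (N1 : R) : measurable_fun setT u ->
  (lebn n).-integrable setT (EFin \o u) -> \int[lebn n]_x `|u x| <= N1 ->
  transform_sq u xi <= 2 * N1 ^+ 2.
Proof.
move=> mu iu hN.
have key (t : n.-tuple R -> R) : measurable_fun setT t -> (forall x, `|t x| <= 1) ->
    (\int[lebn n]_x (u x * t x)) ^+ 2 <= N1 ^+ 2.
  move=> mt t1; have ii := integrable_mul_le1 mu iu mt t1.
  rewrite -real_normK ?num_real// ler_pXn2r ?nnegrE//; last first.
    by apply: le_trans hN; exact: Rintegral_ge0.
  apply: le_trans (le_normr_Rintegral measurableT ii) _; apply: le_trans hN.
  apply: le_Rintegral => //; [exact: integrable_norm ii|exact: integrable_norm iu|].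
  by move=> x _; rewrite normrM ler_piMr.
have h1 := key _ (measurable_cos_dotv xi) (fun x => normr_cos_le1 _).
have h2 := key _ (measurable_sin_dotv xi) (fun x => normr_sin_le1 _).
rewrite /transform_sq /cos_transform /sin_transform; lra.
Qed.

Lemma cos_transformD u v xi : measurable_fun setT u -> measurable_fun setT v ->
  (lebn n).-integrable setT (EFin \o u) -> (lebn n).-integrable setT (EFin \o v) ->
  cos_transform (fun x => u x + v x) xi = cos_transform u xi + cos_transform v xi.
Proof.
move=> mu mv iu iv.
have i1 := integrable_mul_le1 mu iu (measurable_cos_dotv xi) (fun x => normr_cos_le1 _).
have i2 := integrable_mul_le1 mv iv (measurable_cos_dotv xi) (fun x => normr_cos_le1 _).
by rewrite /cos_transform -RintegralD//; apply: eq_Rintegral => x _; rewrite mulrDl.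
Qed.

Lemma sin_transformD u v xi : measurable_fun setT u -> measurable_fun setT v ->
  (lebn n).-integrable setT (EFin \o u) -> (lebn n).-integrable setT (EFin \o v) ->
  sin_transform (fun x => u x + v x) xi = sin_transform u xi + sin_transform v xi.
Proof.
move=> mu mv iu iv.
have i1 := integrable_mul_le1 mu iu (measurable_sin_dotv xi) (fun x => normr_sin_le1 _).
have i2 := integrable_mul_le1 mv iv (measurable_sin_dotv xi) (fun x => normr_sin_le1 _).
by rewrite /sin_transform -RintegralD//; apply: eq_Rintegral => x _; rewrite mulrDl.
Qed.

Definition fourier_cst : R := (2 * pi) `^ (- (n%:R / 2)).

Lemma fourier_truncE (f : n.-tuple R -> R[i]) (r : R) xi :
  let a := (fun x => complex.Re (f x)) \_ (@eball R n r) in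
  let b := (fun x => complex.Im (f x)) \_ (@eball R n r) in
  measurable_fun setT a -> measurable_fun setT b ->
  (lebn n).-integrable setT (EFin \o a) -> (lebn n).-integrable setT (EFin \o b) ->
  fourier_trunc r f xi =
  (fourier_cst * (cos_transform a xi + sin_transform b xi)
   +i* (fourier_cst * (cos_transform b xi - sin_transform a xi)))%C.
Proof.
move=> a b ma mb ia ib.
have i1 := integrable_mul_le1 ma ia (measurable_cos_dotv xi) (fun x => normr_cos_le1 _).
have i2 := integrable_mul_le1 ma ia (measurable_sin_dotv xi) (fun x => normr_sin_le1 _).
have i3 := integrable_mul_le1 mb ib (measurable_cos_dotv xi) (fun x => normr_cos_le1 _).
have i4 := integrable_mul_le1 mb ib (measurable_sin_dotv xi) (fun x => normr_sin_le1 _).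
rewrite /fourier_trunc /=; congr (_ +i* _)%C; congr (_ * _).
  rewrite /cos_transform /sin_transform -RintegralD// [LHS]Rintegral_mkcond.
  apply: eq_Rintegral => x _; rewrite /a /b !patchE; case: ifP => _ //.
  by rewrite !mul0r addr0.
rewrite /cos_transform /sin_transform -RintegralB// [LHS]Rintegral_mkcond.
apply: eq_Rintegral => x _; rewrite /a /b !patchE; case: ifP => _ //.
by rewrite !mul0r subr0.
Qed.

(** A stand-in for the heat multiplier [exp (- S * `|xi| ^+ 2)]. As a product over the
    coordinates it is integrated by Fubini, and it is bounded below by a power of
    [1 + S * `|xi| ^+ 2]. *)
Definition resolvent_weight (S : R) xi : R := \prod_(i < n) (1 + S * tnth xi i ^+ 2)^-1.

Lemma resolvent_weight_ge0 S xi : 0 <= S -> 0 <= resolvent_weight S xi.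
Proof.
move=> S0; apply: prodr_ge0 => i _.
by rewrite invr_ge0 addr_ge0// mulr_ge0// sqr_ge0.
Qed.

Lemma resolvent_weight_le1 S xi : 0 <= S -> resolvent_weight S xi <= 1.
Proof.
move=> S0; suff /andP[] : 0 <= resolvent_weight S xi <= 1 by [].
apply: (big_ind (fun t : R => 0 <= t <= 1)); first by rewrite ler01 lexx.
  move=> u v /andP[u0 u1] /andP[v0 v1]; rewrite mulr_ge0//=; exact: mulr_ile1.
move=> i _; have d1 : 1 <= 1 + S * tnth xi i ^+ 2 by rewrite lerDl mulr_ge0// sqr_ge0.
by rewrite invr_ge0 invf_le1 ?d1 ?(le_trans ler01 d1)// (lt_le_trans ltr01 d1).
Qed.

Let measurable_resolvent_factor (S : R) : 0 <= S ->
  measurable_fun setT (fun t : R => (1 + S * t ^+ 2)^-1).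
Proof.
move=> S0; apply: continuous_measurable_fun => t.
have ct : {for t, continuous (fun t : R => t)} by exact: cvg_id.
have cS := continuousM (@cst_continuous R R S t) (continuousM ct ct).
apply: continuousV (continuousD (@cst_continuous R R 1 t) cS).
have d : 0 < 1 + S * t ^+ 2 by rewrite ltr_pwDl// mulr_ge0// sqr_ge0.
exact: (lt0r_neq0 d).
Qed.

Lemma measurable_resolvent_weight S : 0 <= S -> measurable_fun setT (resolvent_weight S).
Proof.
move=> S0; exact: (@measurable_prod_tnth R n (fun _ t => (1 + S * t ^+ 2)^-1)
  (fun=> measurable_resolvent_factor S0)).
Qed.

Lemma integral_resolvent_weight S : 0 < S ->
  (\int[lebn n]_xi (resolvent_weight S xi)%:E = (pi ^+ n * S `^ (- (n%:R / 2)))%:E)%E.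
Proof.
move=> S0; have S0' := ltW S0.
have s0 : 0 < Num.sqrt S by rewrite sqrtr_gt0.
rewrite (@ge0_integral_prod_tnth R n (fun _ t => (1 + S * t ^+ 2)^-1) (fun=> pi / Num.sqrt S)).
- rewrite prodr_const card_ord exprMn; congr (_ * _)%:E.
  rewrite -powR12_sqrt// -powRN -powR_mulrn ?powR_ge0// -powRrM.
  by congr (_ `^ _); rewrite mulNr mulrC.
- by move=> i; exact: measurable_resolvent_factor.
- by move=> i t; rewrite invr_ge0 addr_ge0// mulr_ge0// sqr_ge0.
move=> i.
have h := cauchy_kernel_integral 0 s0.
have mE : measurable_fun setT (EFin \o (fun t : R => Num.sqrt S / (1 + (Num.sqrt S * (t - 0)) ^+ 2))).
  apply/measurable_EFinP; apply: measurable_funM => //.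
  by have := measurable_resolvent_factor S0'; apply: eq_measurable_fun => t _;
    rewrite subr0 exprMn sqr_sqrtr.
have := @ge0_integralZl _ _ R leb setT measurableT _ mE (Num.sqrt S)^-1%:E.
rewrite h -EFinM mulrC => <-.
- apply: eq_integral => t _; rewrite /= subr0 exprMn sqr_sqrtr// -EFinM; congr EFin.
  by rewrite mulKf// gt_eqF.
- by move=> t _; rewrite lee_fin divr_ge0 ?addr_ge0 ?sqr_ge0// ltW.
- by rewrite lee_fin invr_ge0 ltW.
Qed.

End TruncatedTransform.

(** * A weighted substitute for the Hausdorff-Young inequality *)

Section WeightedHausdorffYoung.
Context {R : realType} (n : nat).
Local Notation leb := (@lebesgue_measure R).
Local Notation lebn := (@lebesgue_measure_n R).
Implicit Types (x xi : n.-tuple R) (f g : n.-tuple R -> R[i]).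

Section Split.
Variables (f : n.-tuple R -> R[i]) (m tau A r : R).
Hypotheses (hm : 1 <= m < 2) (tau0 : 0 < tau) (A0 : 0 < A).
Hypotheses (mRe : measurable_fun setT (fun x => complex.Re (f x))).
Hypotheses (mIm : measurable_fun setT (fun x => complex.Im (f x))).
Hypothesis hA : (cLnorm m f <= A%:E)%E.

Let low : set (n.-tuple R) := [set x | Normc.normc (f x) <= tau].
Let B := @eball R n r.

Lemma measurable_normc : measurable_fun setT (fun x => Normc.normc (f x)).
Proof.
under eq_fun do rewrite normc_sqrt.
apply: (measurableT_comp (continuous_measurable_fun (@sqrt_continuous R))).
by apply: measurable_funD; exact: measurable_funX.
Qed.

Let mlow : measurable low.
Proof.
have -> : low = setT `&` (fun x => Normc.normc (f x)) @^-1` [set` `]-oo, tau]].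
  by apply/seteqP; split=> x; rewrite /low /= in_itv /=; [split|case].
by apply: measurable_normc => //; exact: measurable_itv.
Qed.

Let mB : measurable B. Proof. exact: measurable_eball. Qed.

Let m0 : 0 < m. Proof. by case/andP : hm => h _; exact: lt_le_trans h. Qed.

Let mpow : measurable_fun setT (fun x => Normc.normc (f x) `^ m).
Proof. exact: (measurableT_comp (measurable_powR m) measurable_normc). Qed.

Let ipow : (lebn n).-integrable setT (EFin \o (fun x => Normc.normc (f x) `^ m)).
Proof.
apply/integrableP; split; first exact/measurable_EFinP.
under eq_integral do rewrite /= ger0_norm ?powR_ge0//.
by apply: le_lt_trans (integral_normc_pow_le m0 hA) _; rewrite ltry.
Qed.

Let low_part (u : n.-tuple R -> R) := u \_ (B `&` low).
Let high_part (u : n.-tuple R -> R) := u \_ (B `&` ~` low).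

Variable u : n.-tuple R -> R.
Hypotheses (mu : measurable_fun setT u) (hu : forall x, `|u x| <= Normc.normc (f x)).

Let m_restrict (D : set (n.-tuple R)) : measurable D -> measurable_fun setT (u \_ D).
Proof. by move=> mD; apply/(measurable_restrictT _ mD); exact: measurable_funTS. Qed.

Lemma ball_split x : (u \_ B) x = low_part u x + high_part u x.
Proof.
rewrite /low_part /high_part !patchE !in_setI in_setC.
by case: (x \in B) => /=; rewrite ?addr0//; case: (x \in low); rewrite /= ?addr0 ?add0r.
Qed.

Lemma measurable_low_part : measurable_fun setT (low_part u).
Proof. by apply: m_restrict; exact: measurableI. Qed.

Lemma measurable_high_part : measurable_fun setT (high_part u).
Proof. by apply: m_restrict; apply: measurableI => //; exact: measurableC. Qed.

Lemma integrable_low_part : (lebn n).-integrable setT (EFin \o low_part u).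
Proof.
have mD : measurable (B `&` low) by exact: measurableI.
rewrite /low_part -restrict_EFin; apply/integrable_restrict => //; rewrite setTI.
apply: measurable_bounded_integrable => //.
- apply: le_lt_trans (eball_finite n r); apply: le_measure; rewrite ?inE//.
- exact: measurable_funTS.
exists tau; split; first exact: num_real.
by move=> M tM x /= [_ lx]; apply: le_trans (hu x) _; apply: le_trans lx (ltW tM).
Qed.

Lemma high_part_le x : `|high_part u x| <= tau `^ (1 - m) * Normc.normc (f x) `^ m.
Proof.
rewrite /high_part patchE; case: ifPn => [|_]; last by rewrite normr0 mulr_ge0// powR_ge0.
rewrite inE => -[_ /= /negP]; rewrite -ltNge => h; apply: le_trans (hu x) _.
have N0 : 0 < Normc.normc (f x) by exact: lt_trans h.
rewrite [leLHS](_ : _ = Normc.normc (f x) `^ (1 - m) * Normc.normc (f x) `^ m); last first.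
  rewrite -powRD ?subrK ?powRr1 ?(ltW N0)//.
  by rewrite oner_eq0.
apply: ler_wpM2r; first exact: powR_ge0.
have /andP[m1 _] := hm.
rewrite -[1 - m]opprB !powRN lef_pV2 ?posrE ?powR_gt0//.
by apply: ge0_ler_powR; rewrite ?nnegrE ?subr_ge0// ltW.
Qed.

Lemma integrable_high_part : (lebn n).-integrable setT (EFin \o high_part u).
Proof.
apply: (@le_integrable _ _ _ (lebn n) setT measurableT _
  (EFin \o (fun x => tau `^ (1 - m) * Normc.normc (f x) `^ m))).
- by apply/measurable_EFinP; exact: measurable_high_part.
- move=> x _; rewrite /= lee_fin; apply: le_trans (high_part_le x) (ler_norm _).
- exact: (integrableZl measurableT _ ipow).
Qed.

Lemma high_part_L1 : \int[lebn n]_x `|high_part u x| <= tau `^ (1 - m) * A `^ m.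
Proof.
have ii := integrableZl measurableT (tau `^ (1 - m)) ipow.
apply: (@le_trans _ _ (\int[lebn n]_x (tau `^ (1 - m) * Normc.normc (f x) `^ m))).
  apply: le_Rintegral => //; first exact: integrable_norm integrable_high_part.
  by move=> x _; exact: high_part_le.
rewrite RintegralZl//; apply: ler_wpM2l; first exact: powR_ge0.
rewrite -lee_fin /Rintegral fineK; first exact: (integral_normc_pow_le m0 hA).
exact: (integrable_fin_num measurableT ipow).
Qed.

Lemma low_part_L2 : (\int[lebn n]_x (low_part u x ^+ 2)%:E <= (tau `^ (2 - m) * A `^ m)%:E)%E.
Proof.
apply: (@le_trans _ _ (\int[lebn n]_x ((tau `^ (2 - m))%:E * (Normc.normc (f x) `^ m)%:E))%E).
  apply: ge0_le_integral => //.
  - by move=> x _; rewrite lee_fin sqr_ge0.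
  - by apply/measurable_EFinP; apply: measurable_funX; exact: measurable_low_part.
  - by apply: emeasurable_funM; [exact: measurable_cst|exact/measurable_EFinP].
  move=> x _; rewrite -EFinM lee_fin /low_part patchE; case: ifPn => [|_]; last first.
    by rewrite expr0n mulr_ge0// powR_ge0.
  rewrite inE => -[_ /= lx].
  rewrite -real_normK ?num_real//.
  apply: (@le_trans _ _ (Normc.normc (f x) ^+ 2)).
    by rewrite ler_pXn2r ?nnegrE ?normc_ge0.
  have [N0|Npos] := eqVneq (Normc.normc (f x)) 0.
    by rewrite N0 expr0n mulr_ge0// powR_ge0.
  have -> : Normc.normc (f x) ^+ 2 = Normc.normc (f x) `^ (2 - m) * Normc.normc (f x) `^ m.
    rewrite -powRD ?subrK ?powR_mulrn ?normc_ge0//.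
    by rewrite Npos implybT.
  apply: ler_wpM2r; first exact: powR_ge0.
  have /andP[_ m2] := hm.
  by apply: ge0_ler_powR; rewrite ?nnegrE ?subr_ge0 ?normc_ge0// ltW.
rewrite ge0_integralZl//.
- rewrite EFinM; apply: lee_wpmul2l; first by rewrite lee_fin powR_ge0.
  exact: (integral_normc_pow_le m0 hA).
- exact/measurable_EFinP.
- by move=> x _; rewrite lee_fin powR_ge0.
- by rewrite lee_fin powR_ge0.
Qed.

End Split.

Let cK : R := fourier_cst n ^+ 2 * (8 * (64 / 3 * pi) ^+ n + 16 * pi ^+ n).

(** Marcinkiewicz's splitting at the height [tau]. The part of [f] above [tau] is
    integrable, its transform is bounded, and the weight has mass of order
    [S `^ (- (n / 2))]. The part below is square integrable: there the weight is
    dropped and [bessel] applies. With the chosen [tau] both contributions scale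
    in the same way in [S]. *)
Lemma trunc_weighted f (m A S r : R) : 1 <= m < 2 -> 0 < A -> 0 < S ->
  measurable_fun setT (fun x => complex.Re (f x)) ->
  measurable_fun setT (fun x => complex.Im (f x)) -> (cLnorm m f <= A%:E)%E ->
  [/\ measurable_fun setT (fun xi => complex.Re (fourier_trunc r f xi)),
      measurable_fun setT (fun xi => complex.Im (fourier_trunc r f xi)) &
  (\int[lebn n]_xi (resolvent_weight S xi * normsq (fourier_trunc r f xi))%:E
   <= (cK * (A ^+ 2 * S `^ (- n%:R * (m^-1 - 2^-1))))%:E)%E].
Proof.
move=> hm A0 S0 mRe mIm hA; have /andP[m1 m2] := hm.
have m0 : 0 < m by exact: lt_le_trans m1.
pose tau := A * S `^ (- (n%:R / (2 * m))).
have tau0 : 0 < tau by rewrite mulr_gt0// powR_gt0.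
pose a x := complex.Re (f x); pose b x := complex.Im (f x).
have ha x : `|a x| <= Normc.normc (f x).
  by rewrite normc_sqrt -sqrtr_sqr ler_wsqrtr// lerDl sqr_ge0.
have hb x : `|b x| <= Normc.normc (f x).
  by rewrite normc_sqrt -sqrtr_sqr ler_wsqrtr// lerDr sqr_ge0.
pose B := @eball R n r; pose low : set (n.-tuple R) := [set x | Normc.normc (f x) <= tau].
pose al := a \_ (B `&` low); pose ah := a \_ (B `&` ~` low).
pose bl := b \_ (B `&` low); pose bh := b \_ (B `&` ~` low).
have mal : measurable_fun setT al by exact: measurable_low_part.
have mah : measurable_fun setT ah by exact: measurable_high_part.
have mbl : measurable_fun setT bl by exact: measurable_low_part.
have mbh : measurable_fun setT bh by exact: measurable_high_part.
have ial := integrable_low_part tau r mRe mIm mRe ha.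
have ibl := integrable_low_part tau r mRe mIm mIm hb.
have iah := integrable_high_part r hm tau0 mRe mIm hA mRe ha.
have ibh := integrable_high_part r hm tau0 mRe mIm hA mIm hb.
have L1a := high_part_L1 r hm tau0 mRe mIm hA mRe ha.
have L1b := high_part_L1 r hm tau0 mRe mIm hA mIm hb.
have L2a := low_part_L2 r hm tau0 mRe mIm hA mRe ha.
have L2b := low_part_L2 r hm tau0 mRe mIm hA mIm hb.
rewrite -/al in ial L2a; rewrite -/bl in ibl L2b.
have aB : a \_ B = (fun x => al x + ah x) by apply/funext => x; exact: ball_split.
have bB : b \_ B = (fun x => bl x + bh x) by apply/funext => x; exact: ball_split.
have maB : measurable_fun setT (a \_ B) by rewrite aB; exact: measurable_funD.
have mbB : measurable_fun setT (b \_ B) by rewrite bB; exact: measurable_funD.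
have iaB : (lebn n).-integrable setT (EFin \o (a \_ B)).
  by rewrite aB; exact: (integrableD measurableT ial iah).
have ibB : (lebn n).-integrable setT (EFin \o (b \_ B)).
  by rewrite bB; exact: (integrableD measurableT ibl ibh).
have TE xi := @fourier_truncE R n f r xi maB mbB iaB ibB.
have c0 := sqr_ge0 (fourier_cst n : R).
pose X := A ^+ 2 * S `^ (- n%:R * (m^-1 - 2^-1)).
pose N1 := tau `^ (1 - m) * A `^ m.
have T1 xi : normsq (fourier_trunc r f xi) <= fourier_cst n ^+ 2 *
   (4 * (transform_sq al xi + transform_sq bl xi) + 16 * N1 ^+ 2).
  rewrite TE /normsq /= aB bB !cos_transformD// !sin_transformD//.
  have ea := transform_sq_le xi mah iah L1a; have eb := transform_sq_le xi mbh ibh L1b.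
  rewrite -/N1 in ea eb; rewrite /transform_sq in ea eb *.
  set P := (X in (_ * X) ^+ 2 + _ <= _); set Q := (X in _ + (_ * X) ^+ 2 <= _).
  have -> : (fourier_cst n * P) ^+ 2 + (fourier_cst n * Q) ^+ 2 =
    fourier_cst n ^+ 2 * (P ^+ 2 + Q ^+ 2) by ring.
  apply: ler_wpM2l => //; rewrite /P /Q.
  move: ea eb.
  set p1 := cos_transform al xi; set p2 := cos_transform ah xi.
  set p3 := sin_transform bl xi; set p4 := sin_transform bh xi.
  set p5 := cos_transform bl xi; set p6 := cos_transform bh xi.
  set p7 := sin_transform al xi; set p8 := sin_transform ah xi.
  move=> ea eb.
  have sq4 (w x y z : R) : (w + x + (y + z)) ^+ 2 <= 4 * (w ^+ 2 + x ^+ 2 + y ^+ 2 + z ^+ 2).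
    have := sqr_ge0 (w - x); have := sqr_ge0 (w - y); have := sqr_ge0 (w - z).
    have := sqr_ge0 (x - y); have := sqr_ge0 (x - z); have := sqr_ge0 (y - z); lra.
  have e1 := sq4 p1 p2 p3 p4; have e2 := sq4 p5 p6 (- p7) (- p8).
  lra.
have mca := measurable_cos_transform maB; have msa := measurable_sin_transform maB.
have mcb := measurable_cos_transform mbB; have msb := measurable_sin_transform mbB.
have mTr : measurable_fun setT (fun xi => complex.Re (fourier_trunc r f xi)).
  under eq_fun do rewrite TE /=.
  by apply: measurable_funM => //; exact: measurable_funD.
have mTi : measurable_fun setT (fun xi => complex.Im (fourier_trunc r f xi)).
  under eq_fun do rewrite TE /=.
  by apply: measurable_funM => //; exact: measurable_funB.
split => //.
have mT := measurable_normsq mTr mTi.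
have W0 xi : 0 <= resolvent_weight S xi by apply: resolvent_weight_ge0; exact: ltW.
have mW := @measurable_resolvent_weight R n S (ltW S0).
have mtal := measurable_transform_sq mal; have mtbl := measurable_transform_sq mbl.
pose c2 := fourier_cst n ^+ 2 : R.
apply: (@le_trans _ _ (\int[lebn n]_xi ((4 * c2)%:E * ((transform_sq al xi)%:E + (transform_sq bl xi)%:E)
    + (16 * c2 * N1 ^+ 2)%:E * (resolvent_weight S xi)%:E))%E).
  apply: ge0_le_integral => //.
  - by move=> xi _; rewrite lee_fin mulr_ge0// normsq_ge0.
  - by apply/measurable_EFinP/measurable_funM.
  - apply: emeasurable_funD; apply: emeasurable_funM; try exact: measurable_cst.
      by apply: emeasurable_funD; exact/measurable_EFinP.
    exact/measurable_EFinP.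
  move=> xi _; rewrite -?EFinD -?EFinM -?EFinD lee_fin.
  apply: le_trans (ler_wpM2l (W0 xi) (T1 xi)) _.
  have W1 := @resolvent_weight_le1 R n S xi (ltW S0).
  have q0 : 0 <= transform_sq al xi + transform_sq bl xi by rewrite addr_ge0 ?transform_sq_ge0.
  have q1 := mulr_ge0 c0 q0.
  have : resolvent_weight S xi * (c2 * (transform_sq al xi + transform_sq bl xi)) <=
     c2 * (transform_sq al xi + transform_sq bl xi) by rewrite ler_piMl.
  rewrite -/c2; lra.
have t0 (w : n.-tuple R -> R) xi : (0 <= (transform_sq w xi)%:E)%E by rewrite lee_fin transform_sq_ge0.
have k1 : (0 <= (4 * c2)%:E)%E by rewrite lee_fin mulr_ge0.
have k2 : (0 <= (16 * c2 * N1 ^+ 2)%:E)%E.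
  by rewrite lee_fin; apply: mulr_ge0; [exact: mulr_ge0|exact: sqr_ge0].
have mEa : measurable_fun setT (EFin \o transform_sq al) by exact/measurable_EFinP.
have mEb : measurable_fun setT (EFin \o transform_sq bl) by exact/measurable_EFinP.
have mEw : measurable_fun setT (EFin \o @resolvent_weight R n S) by exact/measurable_EFinP.
rewrite ge0_integralD//; last 4 first.
- by move=> xi _; rewrite mule_ge0// adde_ge0.
- by apply: emeasurable_funM; [exact: measurable_cst|exact: emeasurable_funD].
- by move=> xi _; rewrite mule_ge0// lee_fin.
- by apply: emeasurable_funM; [exact: measurable_cst|].
rewrite ge0_integralZl//; last 2 first.
- exact: emeasurable_funD.
- by move=> xi _; rewrite adde_ge0.
rewrite ge0_integralD// [X in (_ + X)%E]ge0_integralZl//; last by move=> xi _; rewrite lee_fin.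
rewrite integral_resolvent_weight//.
have Cn0 : (0 <= ((64 / 3 * pi : R) ^+ n)%:E)%E.
  by rewrite lee_fin exprn_ge0// mulr_ge0// ?divr_ge0// pi_ge0.
have ba := le_trans (bessel mal ial) (lee_wpmul2l Cn0 L2a).
have bb := le_trans (bessel mbl ibl) (lee_wpmul2l Cn0 L2b).
apply: (@le_trans _ _ ((4 * c2)%:E * (((64 / 3 * pi) ^+ n)%:E * (tau `^ (2 - m) * A `^ m)%:E
   + ((64 / 3 * pi) ^+ n)%:E * (tau `^ (2 - m) * A `^ m)%:E) +
   (16 * c2 * N1 ^+ 2)%:E * (pi ^+ n * S `^ (- (n%:R / 2)))%:E)%E).
  exact: (leeD (lee_wpmul2l k1 (leeD ba bb)) (lexx _)).
rewrite -?EFinM -?EFinD -?EFinM -?EFinD lee_fin.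
have tau_pow (s : R) : tau `^ s = A `^ s * S `^ (- (n%:R / (2 * m)) * s).
  by rewrite powRM ?powR_ge0 ?(ltW A0)// powRrM.
have An0 : A != 0 by rewrite gt_eqF.
have Sn0 : S != 0 by rewrite gt_eqF.
have mn0 : m != 0 by rewrite gt_eqF.
have E1 : tau `^ (2 - m) * A `^ m = X.
  rewrite tau_pow mulrAC -powRD ?An0 ?implybT// subrK powR_mulrn ?(ltW A0)//.
  by congr (_ * _ `^ _); field.
have E2 : N1 ^+ 2 * S `^ (- (n%:R / 2)) = X.
  set e := - (n%:R / (2 * m)) * (1 - m).
  have -> : N1 = A * S `^ e.
    by rewrite /N1 tau_pow mulrAC -powRD ?An0 ?implybT// subrK powRr1 ?(ltW A0).
  rewrite exprMn.
  have -> : (S `^ e) ^+ 2 = S `^ (e * 2) by rewrite [RHS]powRrM powR_mulrn// powR_ge0.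
  have -> : A ^+ 2 * S `^ (e * 2) * S `^ (- (n%:R / 2)) =
    A ^+ 2 * (S `^ (e * 2) * S `^ (- (n%:R / 2))) by ring.
  rewrite -powRD ?Sn0 ?implybT// /X; congr (_ * _ `^ _).
  by rewrite /e; field.
rewrite -/X E1 /cK -/c2.
have -> : 16 * c2 * N1 ^+ 2 * (pi ^+ n * S `^ (- (n%:R / 2))) = 16 * c2 * pi ^+ n * X.
  by rewrite -E2; ring.
by apply: eq_ler; ring.
Qed.

(** The truncated integrals approximate [g] in L2 and the weight is at most one, so
    the estimate of [trunc_weighted], uniform in the radius, passes to the limit. *)
Lemma fourier_weighted (m : R) : 1 <= m < 2 -> exists2 C : R, 0 < C &
  forall (S A : R) f g, 0 < S -> 0 < A -> is_fourier f g -> in_Lp m f ->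
  (cLnorm m f <= A%:E)%E ->
  (\int[lebn n]_xi (resolvent_weight S xi * normsq (g xi))%:E
   <= (C * (A ^+ 2 * S `^ (- n%:R * (m^-1 - 2^-1))))%:E)%E.
Proof.
move=> hm; have cK0 : 0 < cK.
  rewrite mulr_gt0 ?exprn_gt0 ?powR_gt0 ?mulr_gt0 ?pi_gt0// addr_gt0// mulr_gt0// exprn_gt0 ?pi_gt0//.
  by rewrite mulr_gt0 ?divr_gt0 ?pi_gt0.
exists (2 * cK); first exact: mulr_gt0.
move=> S A f g S0 A0 [_ [mgr mgi _] cv] [mRe mIm _] hA.
have W0 xi : 0 <= resolvent_weight S xi by apply: resolvent_weight_ge0; exact: ltW.
have W1 xi := @resolvent_weight_le1 R n S xi (ltW S0).
have mW := @measurable_resolvent_weight R n S (ltW S0).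
set Y := A ^+ 2 * _.
have mg := measurable_normsq mgr mgi.
apply/lee_addgt0Pr => e e0.
have d0 : 0 < Num.sqrt (e / 2) by rewrite sqrtr_gt0 divr_gt0.
move/fine_cvgP : cv => [hfin cv0].
have hlt := cvgr_lt _ cv0 _ d0.
have [N _ hN] : \forall N \near \oo, (cLnorm 2 (fun xi => (g xi - fourier_trunc N%:R f xi)%R)
    <= (Num.sqrt (e / 2))%:E)%E.
  apply: filterS2 hfin (hlt _) => N h1 h2.
  by rewrite -(fineK h1) lee_fin ltW.
have {}hN := hN N (leqnn N).
have [mTr mTi bT] := trunc_weighted N%:R hm A0 S0 mRe mIm hA.
have mT := measurable_normsq mTr mTi.
have h2 := integral_normsq_le hN; rewrite sqr_sqrtr ?divr_ge0 ?(ltW e0)// in h2.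
set D := fun xi => normsq (g xi - fourier_trunc N%:R f xi) in h2.
have mD : measurable_fun setT D by exact: (measurable_normsqB mgr mgi mTr mTi).
apply: (@le_trans _ _ (\int[lebn n]_xi (2%:E * (D xi)%:E +
   2%:E * (resolvent_weight S xi * normsq (fourier_trunc N%:R f xi))%:E))%E).
  apply: ge0_le_integral => //.
  - by move=> xi _; rewrite lee_fin mulr_ge0// normsq_ge0.
  - by apply/measurable_EFinP/measurable_funM.
  - apply: emeasurable_funD; apply: emeasurable_funM; try exact: measurable_cst.
      exact/measurable_EFinP.
    exact/measurable_EFinP/measurable_funM.
  move=> xi _; rewrite -?EFinM -?EFinD lee_fin.
  have : normsq (g xi) <= 2 * D xi + 2 * normsq (fourier_trunc N%:R f xi).
    by rewrite -[in leLHS](subrK (fourier_trunc N%:R f xi) (g xi)) normsqD.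
  move=> h; apply: le_trans (ler_wpM2l (W0 xi) h) _.
  rewrite mulrDr; apply: lerD; last by rewrite mulrCA.
  by rewrite ler_piMl ?W1// mulr_ge0// normsq_ge0.
rewrite ge0_integralD//; last 4 first.
- by move=> xi _; rewrite mule_ge0// lee_fin normsq_ge0.
- by apply: emeasurable_funM; [exact: measurable_cst|exact/measurable_EFinP].
- by move=> xi _; rewrite mule_ge0// lee_fin mulr_ge0// normsq_ge0.
- by apply: emeasurable_funM; [exact: measurable_cst|exact/measurable_EFinP/measurable_funM].
rewrite ge0_integralZl//; last 2 first.
- exact/measurable_EFinP.
- by move=> xi _; rewrite lee_fin normsq_ge0.
rewrite ge0_integralZl//; last 2 first.
- exact/measurable_EFinP/measurable_funM.
- by move=> xi _; rewrite lee_fin mulr_ge0// normsq_ge0.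
have two0 : (0 <= 2%:E :> \bar R)%E by rewrite lee_fin.
apply: le_trans (leeD (lee_wpmul2l two0 h2) (lee_wpmul2l two0 bT)) _.
rewrite -?EFinM -?EFinD lee_fin -/Y; lra.
Qed.

End WeightedHausdorffYoung.

(** * Sobolev norms on the Fourier side *)

Section SobolevNorms.
Context {R : realType} (n : nat).
Local Notation lebn := (@lebesgue_measure_n R).
Implicit Types (x xi : n.-tuple R) (f g v w : n.-tuple R -> R[i]).

(** Both functions are L2 limits of the same truncated integrals, which are measurable
    by [trunc_weighted]. *)
Lemma fourier_unique (m A : R) f g1 g2 : 1 <= m < 2 -> 0 < A -> (cLnorm m f <= A%:E)%E ->
  in_Lp m f -> is_fourier f g1 -> is_fourier f g2 ->
  {ae lebn n, forall xi, g1 xi = g2 xi}.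
Proof.
move=> hm A0 hA [mRe mIm _] [_ [mr1 mi1 _] cv1] [_ [mr2 mi2 _] cv2].
have md : measurable_fun setT (fun xi => normsq (g1 xi - g2 xi)).
  by apply: (measurable_normsqB mr1 mi1 mr2 mi2).
have I0 : (\int[lebn n]_xi (normsq (g1 xi - g2 xi))%:E <= 0)%E.
  apply/lee_addgt0Pr => e e0; rewrite add0e.
  have d0 : 0 < Num.sqrt (e / 4) by rewrite sqrtr_gt0 divr_gt0.
  have small g : cLnorm 2 (fun xi => g xi - fourier_trunc N%:R f xi) @[N --> \oo] --> 0%E ->
      \forall N \near \oo,
        (cLnorm 2 (fun xi => (g xi - fourier_trunc N%:R f xi)%R) <= (Num.sqrt (e / 4))%:E)%E.
    move=> /fine_cvgP[hfin cv0]; have hlt := cvgr_lt _ cv0 _ d0.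
    apply: filterS2 hfin (hlt _) => N h1 h2.
    by rewrite -(fineK h1) lee_fin ltW.
  have [N _ hN] : \forall N \near \oo,
    (cLnorm 2 (fun xi => (g1 xi - fourier_trunc N%:R f xi)%R) <= (Num.sqrt (e / 4))%:E)%E /\
    (cLnorm 2 (fun xi => (g2 xi - fourier_trunc N%:R f xi)%R) <= (Num.sqrt (e / 4))%:E)%E.
    by apply: filterS2 (small _ cv1) (small _ cv2) => N.
  have [h1 h2] := hN N (leqnn N).
  have [mTr mTi _] := trunc_weighted N%:R hm A0 ltr01 mRe mIm hA.
  have {}h1 := integral_normsq_le h1; have {}h2 := integral_normsq_le h2.
  rewrite sqr_sqrtr ?divr_ge0 ?(ltW e0)// in h1 h2.
  have mD g : measurable_fun setT (fun xi => complex.Re (g xi)) ->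
      measurable_fun setT (fun xi => complex.Im (g xi)) ->
      measurable_fun setT (fun xi => (normsq (g xi - fourier_trunc N%:R f xi))%:E).
    by move=> mr mi; apply/measurable_EFinP; exact: (measurable_normsqB mr mi mTr mTi).
  have m1 := mD _ mr1 mi1; have m2 := mD _ mr2 mi2.
  apply: (@le_trans _ _ (\int[lebn n]_xi (2%:E * (normsq (g1 xi - fourier_trunc N%:R f xi))%:E +
     2%:E * (normsq (g2 xi - fourier_trunc N%:R f xi))%:E))%E).
    apply: ge0_le_integral => //.
    - by move=> xi _; rewrite lee_fin normsq_ge0.
    - exact/measurable_EFinP.
    - by apply: emeasurable_funD; apply: emeasurable_funM => //; exact: measurable_cst.
    move=> xi _; rewrite -?EFinM -?EFinD lee_fin.
    set z := fourier_trunc _ _ _.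
    have -> : g1 xi - g2 xi = (g1 xi - z) + - (g2 xi - z) by rewrite opprB addrA subrK.
    by rewrite -[in leRHS](normsqN (g2 xi - z)); exact: normsqD.
  have p0 g xi : (0 <= (normsq (g xi - fourier_trunc N%:R f xi))%:E)%E by rewrite lee_fin normsq_ge0.
  have two0 : (0 <= 2%:E :> \bar R)%E by rewrite lee_fin.
  rewrite ge0_integralD//; last 4 first.
  - by move=> xi _; rewrite mule_ge0.
  - by apply: emeasurable_funM => //; exact: measurable_cst.
  - by move=> xi _; rewrite mule_ge0.
  - by apply: emeasurable_funM => //; exact: measurable_cst.
  rewrite ge0_integralZl// [X in (_ + X)%E]ge0_integralZl//.
  apply: le_trans (leeD (lee_wpmul2l two0 h1) (lee_wpmul2l two0 h2)) _.
  rewrite -?EFinM -?EFinD lee_fin; lra.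
have mE : measurable_fun setT (fun xi => (normsq (g1 xi - g2 xi))%:E) by exact/measurable_EFinP.
have I1 : (\int[lebn n]_xi `|(normsq (g1 xi - g2 xi))%:E| = 0)%E.
  apply/eqP; rewrite eq_le integral_ge0 ?andbT//.
  by under eq_integral do rewrite gee0_abs ?lee_fin ?normsq_ge0//.
have := (ae_eq_integral_abs (lebn n) measurableT mE).1 I1.
apply: filterS => xi /(_ Logic.I) [] h.
have : Normc.normc (g1 xi - g2 xi) = 0 by rewrite normc_sqrt h sqrtr0.
by move/Normc.eq0_normc/eqP; rewrite subr_eq0 => /eqP.
Qed.

Lemma normsq_weight (s : R) xi (z : R[i]) :
  normsq ((((1 + enorm xi ^+ 2) `^ (s / 2))%:C)%C * z) = (1 + enorm xi ^+ 2) `^ s * normsq z.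
Proof.
rewrite normsq_scale -powR_mulrn ?powR_ge0// -powRrM; congr (_ `^ _ * _).
by rewrite divfK.
Qed.

Lemma measurable_weight (s : R) : measurable_fun setT (fun xi : n.-tuple R => (1 + enorm xi ^+ 2) `^ s).
Proof.
apply: (measurableT_comp (measurable_powR s)); apply: measurable_funD => //.
by apply: measurable_funX; exact: measurable_enorm.
Qed.

(** The infimum in the definition of the Sobolev norm ranges over transforms of [f],
    and all of them have the same weighted norm by [fourier_unique]. *)
Lemma sobolev_norm_transform (m A s : R) f g : 1 <= m < 2 -> 0 < A -> (cLnorm m f <= A%:E)%E ->
  in_Lp m f -> is_fourier f g -> (sobolev_norm s f <= A%:E)%E ->
  (\int[lebn n]_xi ((1 + enorm xi ^+ 2) `^ s * normsq (g xi))%:E <= (A ^+ 2)%:E)%E.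
Proof.
move=> hm A0 hA hf hg hs.
apply: (@le_trans _ _ (\int[lebn n]_xi
   (normsq ((((1 + enorm xi ^+ 2) `^ (s / 2))%:C)%C * g xi))%:E)%E).
  by under [leRHS]eq_integral do rewrite normsq_weight.
apply: integral_normsq_le; apply: le_trans hs.
apply: le_ereal_inf_tmp => _ [g' hg' <-].
have ae := fourier_unique hm A0 hA hf hg hg'.
have [_ [mr mi _] _] := hg; have [_ [mr' mi' _] _] := hg'.
suff E : (\int[lebn n]_xi (normsq ((((1 + enorm xi ^+ 2) `^ (s / 2))%:C)%C * g xi))%:E =
  \int[lebn n]_xi (normsq ((((1 + enorm xi ^+ 2) `^ (s / 2))%:C)%C * g' xi))%:E)%E.
  by move: E; rewrite !integral_normsq => /(congr1 (fun y => (y `^ 2^-1)%E));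
    rewrite -!poweRrM !mulfV// !poweRe1 ?cLnorm_ge0// => ->.
under eq_integral do rewrite normsq_weight.
under [RHS]eq_integral do rewrite normsq_weight.
apply: ae_eq_integral => //.
- by apply/measurable_EFinP/measurable_funM; [exact: measurable_weight|exact: measurable_normsq].
- by apply/measurable_EFinP/measurable_funM; [exact: measurable_weight|exact: measurable_normsq].
by apply: filterS ae => xi -> _.
Qed.

End SobolevNorms.

(** * From frequency bounds to norms *)

Section EnergySplitting.
Context {R : realType} (n : nat).
Local Notation lebn := (@lebesgue_measure_n R).
Implicit Types (x xi : n.-tuple R) (f g v w : n.-tuple R -> R[i]).

Lemma integral_combination_le (c1 c2 a1 a2 : R) (f1 f2 : n.-tuple R -> R) : 0 <= c1 -> 0 <= c2 ->
  (forall xi, 0 <= f1 xi) -> (forall xi, 0 <= f2 xi) ->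
  measurable_fun setT f1 -> measurable_fun setT f2 ->
  (\int[lebn n]_xi (f1 xi)%:E <= a1%:E)%E -> (\int[lebn n]_xi (f2 xi)%:E <= a2%:E)%E ->
  (\int[lebn n]_xi (c1 * f1 xi + c2 * f2 xi)%:E <= (c1 * a1 + c2 * a2)%:E)%E.
Proof.
move=> c10 c20 f10 f20 m1 m2 h1 h2.
have c1E : (0 <= c1%:E :> \bar R)%E by rewrite lee_fin.
have c2E : (0 <= c2%:E :> \bar R)%E by rewrite lee_fin.
have mE1 : measurable_fun setT (fun xi => (f1 xi)%:E) by exact/measurable_EFinP.
have mE2 : measurable_fun setT (fun xi => (f2 xi)%:E) by exact/measurable_EFinP.
under eq_integral do rewrite EFinD 2!EFinM.
rewrite ge0_integralD//; last 4 first.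
- by move=> xi _; rewrite mule_ge0// lee_fin.
- by apply: emeasurable_funM => //; exact: measurable_cst.
- by move=> xi _; rewrite mule_ge0// lee_fin.
- by apply: emeasurable_funM => //; exact: measurable_cst.
rewrite ge0_integralZl//; last by move=> xi _; rewrite lee_fin.
rewrite [X in (_ + X)%E]ge0_integralZl//; last by move=> xi _; rewrite lee_fin.
by rewrite EFinD 2!EFinM; apply: leeD; exact: lee_wpmul2l.
Qed.

Lemma sobolev_norm_ge0 (s : R) f : (0 <= sobolev_norm s f)%E.
Proof. by apply: le_ereal_inf_tmp => _ [g _ <-]; exact: cLnorm_ge0. Qed.

(** The terms with the resolvent weight are measured in the L^m norms by
    [fourier_weighted], the others in the Sobolev norms; both have the factor
    [S `^ (- theta - n * (1 / m - 1 / 2))]. *)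
Lemma norm_of_frequency_bound (m theta s0 s1 C0 : R) : 1 <= m < 2 -> 0 < C0 ->
  exists2 C : R, 0 < C & forall (S L : R) u0 u1 g0 g1 v, 0 < S -> 0 < L ->
  is_fourier u0 g0 -> is_fourier u1 g1 -> in_LpHs m s0 u0 -> in_LpHs m s1 u1 ->
  measurable_fun setT (fun xi => complex.Re (v xi)) ->
  measurable_fun setT (fun xi => complex.Im (v xi)) ->
  {ae lebn n, forall xi, normsq (v xi) <= C0 * L ^+ 2 *
    (S `^ (- theta) * (resolvent_weight S xi * (normsq (g0 xi) + normsq (g1 xi))) +
     S `^ (- theta - n%:R * (m^-1 - 2^-1)) *
       ((1 + enorm xi ^+ 2) `^ s0 * normsq (g0 xi) + (1 + enorm xi ^+ 2) `^ s1 * normsq (g1 xi)))} ->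
  (cLnorm 2 v <= (C * L * S `^ ((- theta - n%:R * (m^-1 - 2^-1)) / 2))%:E *
    (LpHs_norm m s0 u0 + LpHs_norm m s1 u1))%E.
Proof.
move=> hm C00; have [C1 C10 hC1] := @fourier_weighted R n m hm.
set nu := n%:R * _.
exists (Num.sqrt (C0 * (2 * C1 + 2))) => [|S L u0 u1 g0 g1 v S0 L0 F0 F1 [hp0 hs0] [hp1 hs1] vr vi hv].
  by rewrite sqrtr_gt0 mulr_gt0// addr_gt0// mulr_gt0.
set K := _ * L * _.
have K0 : 0 < K.
  by rewrite !mulr_gt0 ?powR_gt0// sqrtr_gt0 mulr_gt0// addr_gt0// mulr_gt0.
have KE : K ^+ 2 = C0 * (2 * C1 + 2) * L ^+ 2 * S `^ (- theta - nu).
  rewrite !exprMn sqr_sqrtr ?mulr_ge0 ?addr_ge0 ?mulr_ge0 ?ltW// -[(_ `^ _) ^+ 2]powR_mulrn ?powR_ge0//.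
  by rewrite -powRrM divfK.
have fin (y : \bar R) : (0 <= y)%E -> (y < +oo)%E -> y = (fine y)%:E.
  by move=> y0 y1; rewrite fineK// ge0_fin_numE.
have [_ _ fp0] := hp0; have [_ _ fp1] := hp1.
have P0 := fin _ (cLnorm_ge0 m u0) fp0.
have P1 := fin _ (cLnorm_ge0 m u1) fp1.
have Q0 := fin _ (sobolev_norm_ge0 s0 u0) hs0.
have Q1 := fin _ (sobolev_norm_ge0 s1 u1) hs1.
have p0 := cLnorm_ge0 m u0; have p1 := cLnorm_ge0 m u1.
have q0 := sobolev_norm_ge0 s0 u0; have q1 := sobolev_norm_ge0 s1 u1.
move: P0 P1 Q0 Q1 p0 p1 q0 q1; rewrite /LpHs_norm.
move: (fine _) (fine _) (fine _) (fine _) => b1 b0 a1 a0 P0 P1 Q0 Q1.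
rewrite P0 P1 Q0 Q1 !lee_fin => a00 a10 b00 b10.
rewrite -!EFinD -EFinM.
(* A strict upper bound [A] of the norms is positive even when all of them vanish. *)
have main A : a0 + b0 + (a1 + b1) < A -> (cLnorm 2 v <= (K * A)%:E)%E.
  move=> hA.
  have A0 : 0 < A by lra.
  apply: cLnorm2_le; first by rewrite mulr_ge0// ltW.
  have [_ [r0 i0 _] _] := F0; have [_ [r1 i1 _] _] := F1.
  have m0 := measurable_normsq r0 i0; have m1 := measurable_normsq r1 i1.
  have mW := @measurable_resolvent_weight R n S (ltW S0).
  have W0 xi := @resolvent_weight_ge0 R n S xi (ltW S0).
  have hp0' : (cLnorm m u0 <= A%:E)%E by rewrite P0 lee_fin; lra.
  have hp1' : (cLnorm m u1 <= A%:E)%E by rewrite P1 lee_fin; lra.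
  have hs0' : (sobolev_norm s0 u0 <= A%:E)%E by rewrite Q0 lee_fin; lra.
  have hs1' : (sobolev_norm s1 u1 <= A%:E)%E by rewrite Q1 lee_fin; lra.
  have I0 := hC1 S A u0 g0 S0 A0 F0 hp0 hp0'.
  have I1 := hC1 S A u1 g1 S0 A0 F1 hp1 hp1'.
  have J0 := sobolev_norm_transform hm A0 hp0' hp0 F0 hs0'.
  have J1 := sobolev_norm_transform hm A0 hp1' hp1 F1 hs1'.
  have mw0 : measurable_fun setT (fun xi => resolvent_weight S xi * normsq (g0 xi)).
    exact: measurable_funM.
  have mw1 : measurable_fun setT (fun xi => resolvent_weight S xi * normsq (g1 xi)).
    exact: measurable_funM.
  have ms0 : measurable_fun setT (fun xi => (1 + enorm xi ^+ 2) `^ s0 * normsq (g0 xi)).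
    by apply: measurable_funM => //; exact: measurable_weight.
  have ms1 : measurable_fun setT (fun xi => (1 + enorm xi ^+ 2) `^ s1 * normsq (g1 xi)).
    by apply: measurable_funM => //; exact: measurable_weight.
  have w0 xi : 0 <= resolvent_weight S xi * normsq (g0 xi) by rewrite mulr_ge0 ?normsq_ge0.
  have w1 xi : 0 <= resolvent_weight S xi * normsq (g1 xi) by rewrite mulr_ge0 ?normsq_ge0.
  have z0 xi : 0 <= (1 + enorm xi ^+ 2) `^ s0 * normsq (g0 xi).
    by rewrite mulr_ge0 ?normsq_ge0 ?powR_ge0.
  have z1 xi : 0 <= (1 + enorm xi ^+ 2) `^ s1 * normsq (g1 xi).
    by rewrite mulr_ge0 ?normsq_ge0 ?powR_ge0.
  have I := integral_combination_le (@ler01 R) (@ler01 R) w0 w1 mw0 mw1 I0 I1.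
  have J := integral_combination_le (@ler01 R) (@ler01 R) z0 z1 ms0 ms1 J0 J1.
  pose c1 := C0 * L ^+ 2 * S `^ (- theta); pose c2 := C0 * L ^+ 2 * S `^ (- theta - nu).
  have c10 : 0 <= c1 by rewrite mulr_ge0 ?powR_ge0// mulr_ge0 ?sqr_ge0// ltW.
  have c20 : 0 <= c2 by rewrite mulr_ge0 ?powR_ge0// mulr_ge0 ?sqr_ge0// ltW.
  have mI : measurable_fun setT (fun xi => 1 * (resolvent_weight S xi * normsq (g0 xi)) +
      1 * (resolvent_weight S xi * normsq (g1 xi))).
    by apply: measurable_funD; apply: measurable_funM.
  have mJ : measurable_fun setT (fun xi => 1 * ((1 + enorm xi ^+ 2) `^ s0 * normsq (g0 xi)) +
      1 * ((1 + enorm xi ^+ 2) `^ s1 * normsq (g1 xi))).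
    by apply: measurable_funD; apply: measurable_funM.
  have H := integral_combination_le c10 c20 _ _ mI mJ I J.
  apply: le_trans (le_trans (H _ _) _); last first.
  - rewrite lee_fin exprMn KE /c1 /c2.
    have -> : S `^ (- theta - nu) = S `^ (- theta) * S `^ (- nu) by rewrite powRD// (gt_eqF S0) implybT.
    rewrite mulNr -/nu.
    by apply: eq_ler; ring.
  - by move=> xi; rewrite addr_ge0 ?mul1r.
  - by move=> xi; rewrite addr_ge0 ?mul1r.
  apply: ae_ge0_le_integral => //.
  - by move=> xi _; rewrite lee_fin normsq_ge0.
  - by apply/measurable_EFinP; exact: measurable_normsq vr vi.
  - move=> xi _; rewrite lee_fin addr_ge0// mulr_ge0// addr_ge0 ?mul1r//.
  - by apply/measurable_EFinP/measurable_funD; apply: measurable_funM.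
  apply: filterS hv => xi h _; rewrite lee_fin; apply: le_trans h _.
  by apply: eq_ler; rewrite /c1 /c2 -/nu; ring.
apply/lee_addgt0Pr => e e0.
have := main (a0 + b0 + (a1 + b1) + e / K); rewrite mulrDr [K * (e / K)]mulrC divfK ?gt_eqF//.
by rewrite -EFinD; apply; rewrite ltrDl divr_gt0.
Qed.

End EnergySplitting.

(** * Low and high frequencies *)

Section FrequencySplitting.
Context {R : realType} (n : nat).
Implicit Types (xi : n.-tuple R).

Lemma powR_opp_nat (a : R) (N : nat) : 0 <= a -> a `^ (- N%:R) = a ^- N.
Proof. by move=> a0; rewrite powRN powR_mulrn. Qed.

Lemma resolvent_weight_lb (S : R) xi : 0 <= S -> (1 + S * enorm xi ^+ 2) ^- n <= resolvent_weight S xi.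
Proof.
move=> S0; rewrite /resolvent_weight -exprVn.
have -> : (1 + S * enorm xi ^+ 2)^-1 ^+ n = \prod_(i < n) (1 + S * enorm xi ^+ 2)^-1.
  by rewrite prodr_const card_ord.
apply: ler_prod => i _.
have h0 : 0 < 1 + S * tnth xi i ^+ 2 by rewrite ltr_pwDl// mulr_ge0// sqr_ge0.
have h1 : 0 < 1 + S * enorm xi ^+ 2 by rewrite ltr_pwDl// mulr_ge0// sqr_ge0.
rewrite invr_ge0 ltW//= lef_pV2 ?posrE// lerD2l ler_wpM2l//.
rewrite -[leLHS]real_normK ?num_real// lerXn2r ?nnegrE ?enorm_ge0//.
exact: tnth_le_enorm.
Qed.

Variables (B : R) (xi : n.-tuple R).
Hypothesis B0 : 0 <= B.
Local Notation S := (1 + B).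
Local Notation k2 := (enorm xi ^+ 2).

Let S1 : 1 <= S. Proof. by rewrite lerDl. Qed.
Let S0 : 0 < S. Proof. exact: lt_le_trans ltr01 S1. Qed.
Let k20 : 0 <= k2. Proof. exact: sqr_ge0. Qed.

(** With [D = 1 + S * k2] the decay factor is at most a multiple of [D ^- N]. Of these
    [N] powers, [theta] turn [k2 `^ theta] into [S `^ (- theta)] and [n] make up the
    resolvent weight. *)
Lemma low_frequency_weight (theta : R) (N : nat) : 0 <= theta -> theta + n%:R <= N%:R -> k2 <= 1 ->
  k2 `^ theta * (1 + Num.min 1 k2 * B) ^- N <= 2 ^+ N * (S `^ (- theta) * resolvent_weight S xi).
Proof.
move=> th0 thN k21; rewrite (min_idPr k21).
set D := 1 + S * k2.
have D1 : 1 <= D by rewrite lerDl mulr_ge0// ltW.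
have D0 : 0 < D := lt_le_trans ltr01 D1.
have D2 : D <= 2 * (1 + k2 * B) by rewrite /D; have := mulr_ge0 k20 B0; lra.
have W0 : 0 < 1 + k2 * B by rewrite ltr_pwDl// mulr_ge0.
have hW : (1 + k2 * B) ^- N <= 2 ^+ N * D ^- N.
  rewrite ler_pdivlMr ?exprn_gt0// mulrC ler_pdivrMr ?exprn_gt0// -exprMn.
  by rewrite lerXn2r ?nnegrE ?mulr_ge0 ?(ltW W0) ?(ltW D0).
have hN : D ^- N <= D `^ (- theta) * D ^- n.
  rewrite -(powR_opp_nat N (ltW D0)) -(powR_opp_nat n (ltW D0)) -powRD ?(gt_eqF D0) ?implybT//.
  by rewrite ler_powR// -opprD lerN2.
have hr : D ^- n <= resolvent_weight S xi by apply: resolvent_weight_lb; exact: ltW.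
have hk : k2 `^ theta * D `^ (- theta) <= S `^ (- theta).
  rewrite !powRN ler_pdivrMr ?powR_gt0// mulrC ler_pdivlMr ?powR_gt0//.
  have h0 : 0 <= k2 * S := mulr_ge0 k20 (ltW S0).
  rewrite -powRM// ?(ltW S0)// ge0_ler_powR// ?nnegrE ?h0 ?(ltW D0)//.
  by rewrite mulrC lerDr.
apply: le_trans (ler_wpM2l (powR_ge0 _ _) (le_trans hW (ler_wpM2l _ hN))) _; first exact: exprn_ge0.
rewrite mulrCA ler_wpM2l ?exprn_ge0// mulrA; apply: ler_pM => //; last by rewrite invr_ge0 exprn_ge0// ltW.
by rewrite mulr_ge0 ?powR_ge0.
Qed.

Lemma natural_power_le (theta : R) (N : nat) : theta <= N%:R -> S ^- N <= S `^ (- theta).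
Proof. by move=> h; rewrite -(powR_opp_nat _ (ltW S0)) ler_powR// lerN2. Qed.

(** At low frequency [1 + S * k2 <= 2 * S], so the resolvent weight is at least of the
    order of [S ^- n]. *)
Lemma resolvent_weight_low (theta : R) (N : nat) : theta + n%:R <= N%:R -> k2 <= 1 ->
  S ^- N <= 2 ^+ n * (S `^ (- theta) * resolvent_weight S xi).
Proof.
move=> thN k21.
have D0 : 0 < 1 + S * k2 by rewrite ltr_pwDl// mulr_ge0// ltW.
have D2 : 1 + S * k2 <= 2 * S.
  have : S * k2 <= S by rewrite ler_piMr// ltW.
  by move: S1; lra.
apply: le_trans (natural_power_le thN) _.
rewrite opprD powRD ?(gt_eqF S0) ?implybT// mulrCA ler_wpM2l ?powR_ge0// (powR_opp_nat _ (ltW S0)).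
apply: le_trans (ler_wpM2l (exprn_ge0 _ _) (resolvent_weight_lb xi (ltW S0))) => //.
rewrite ler_pdivlMr ?exprn_gt0// mulrC ler_pdivrMr ?exprn_gt0// -exprMn.
by rewrite lerXn2r ?nnegrE ?mulr_ge0 ?(ltW S0) ?(ltW D0).
Qed.

Variables (sigma nu n0 n1 : R) (N : nat).
Hypotheses (sigma0 : 0 <= sigma) (nu0 : 0 <= nu) (n00 : 0 <= n0) (n10 : 0 <= n1).
Hypothesis hN : sigma + 1 + n%:R + nu <= N%:R.
Local Notation W := ((1 + Num.min 1 k2 * B) ^- N).
Local Notation Z0 := (n1 + (1 + k2) * n0).

Let N1 : 1 <= (2 ^+ N : R). Proof. by rewrite exprn_ege1// ler1n. Qed.
Let rw0 : 0 <= resolvent_weight S xi. Proof. by apply: resolvent_weight_ge0; exact: ltW. Qed.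
Let k1p : 0 < 1 + k2. Proof. by rewrite ltr_pwDl. Qed.
Let Z00 : 0 <= Z0. Proof. by rewrite addr_ge0// mulr_ge0// ltW. Qed.
Let W0 : 0 <= W.
Proof. by rewrite invr_ge0; apply/exprn_ge0/addr_ge0/mulr_ge0 => //; rewrite le_min ler01 k20. Qed.
Let nn : 0 <= n%:R :> R. Proof. exact: ler0n. Qed.

(** For [k2 <= 1] this is [low_frequency_weight]. For [k2 > 1] the decay factor is
    [S ^- N], which is more than needed; the powers of [k2] are left to the Sobolev
    norms, where the division by [1 + k2] lowers the order of the velocity datum
    by one, down to zero at most. *)
Lemma displacement_splitting :
  k2 `^ sigma * (W * (Z0 / (1 + k2))) <= 2 ^+ N *
   (S `^ (- sigma) * (resolvent_weight S xi * (n0 + n1)) +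
    S `^ (- sigma - nu) * ((1 + k2) `^ sigma * n0 + (1 + k2) `^ (Num.max (sigma - 1) 0) * n1)).
Proof.
set H := S `^ (- sigma - nu) * _.
have hi0 : 0 <= H.
  by rewrite mulr_ge0 ?powR_ge0// addr_ge0 ?mulr_ge0 ?powR_ge0.
have lo0 : 0 <= S `^ (- sigma) * (resolvent_weight S xi * (n0 + n1)).
  by rewrite mulr_ge0 ?powR_ge0// mulr_ge0 ?addr_ge0.
have XE : Z0 / (1 + k2) = n0 + n1 / (1 + k2) by field; rewrite gt_eqF.
have [k21|] := boolP (k2 <= 1).
  have h := @low_frequency_weight sigma N sigma0 _ k21.
  rewrite [X in X <= _]mulrA.
  apply: (@le_trans _ _ (2 ^+ N * (S `^ (- sigma) * resolvent_weight S xi) * (n0 + n1))).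
    apply: ler_pM => //.
    - exact: mulr_ge0 (powR_ge0 _ _) W0.
    - by rewrite divr_ge0// ltW.
    - by apply: h; move: hN nu0; lra.
    by rewrite XE lerD2l ler_pdivrMr// ler_peMr// lerDl.
  by rewrite -!mulrA ler_wpM2l ?exprn_ge0// lerDl.
rewrite -ltNge => k21; rewrite (min_idPl (ltW k21)) mul1r.
apply: le_trans (_ : H <= _); last first.
  by rewrite -[leLHS]mul1r; apply: ler_pM => //; rewrite lerDr.
rewrite mulrCA; apply: ler_pM.
- by rewrite invr_ge0 exprn_ge0// ltW.
- by rewrite mulr_ge0 ?powR_ge0// divr_ge0// ltW.
- by rewrite -opprD; apply: natural_power_le; move: hN nn; lra.
have hk : k2 `^ sigma <= (1 + k2) `^ sigma by rewrite ge0_ler_powR ?nnegrE ?lerDr// ltW.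
rewrite XE mulrDr; apply: lerD; first exact: ler_wpM2r.
rewrite mulrA mulrAC ler_wpM2r// ler_pdivrMr//; apply: le_trans hk _.
have -> : (1 + k2) `^ (Num.max (sigma - 1) 0) * (1 + k2) = (1 + k2) `^ (Num.max (sigma - 1) 0 + 1).
  by rewrite powRD ?(gt_eqF k1p) ?implybT// powRr1// ltW.
by rewrite ler_powR ?lerDl// -lerBlDr le_max lexx.
Qed.

(** As in [displacement_splitting], with one more power of [S ^- 1]: at low frequency
    it is paid by the factor [k2] of the first term, while the second term decays
    as fast as one likes. *)
Lemma velocity_splitting :
  k2 `^ sigma * (k2 * W * (Z0 / (1 + k2)) + S ^- N * Z0) <= 3 * 2 ^+ N *
   (S `^ (- (sigma + 1)) * (resolvent_weight S xi * (n0 + n1)) +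
    S `^ (- (sigma + 1) - nu) * ((1 + k2) `^ (sigma + 1) * n0 + (1 + k2) `^ sigma * n1)).
Proof.
have hi0 : 0 <= S `^ (- (sigma + 1) - nu) * ((1 + k2) `^ (sigma + 1) * n0 + (1 + k2) `^ sigma * n1).
  by rewrite mulr_ge0 ?powR_ge0// addr_ge0 ?mulr_ge0 ?powR_ge0.
have lo0 : 0 <= S `^ (- (sigma + 1)) * (resolvent_weight S xi * (n0 + n1)).
  by rewrite mulr_ge0 ?powR_ge0// mulr_ge0 ?addr_ge0.
have XE : Z0 / (1 + k2) = n0 + n1 / (1 + k2) by field; rewrite gt_eqF.
have [k21|] := boolP (k2 <= 1).
  have hX : k2 `^ sigma * (k2 * W * (Z0 / (1 + k2))) <=
    2 ^+ N * (S `^ (- (sigma + 1)) * resolvent_weight S xi) * (n0 + n1).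
    have -> : k2 `^ sigma * (k2 * W * (Z0 / (1 + k2))) = k2 `^ (sigma + 1) * W * (Z0 / (1 + k2)).
      by rewrite powRD ?(addr_ge0 sigma0) ?paddr_eq0 ?oner_eq0 ?andbF// powRr1// !mulrA.
    apply: ler_pM => //.
    - exact: mulr_ge0 (powR_ge0 _ _) W0.
    - by rewrite divr_ge0// ltW.
    - apply: low_frequency_weight => //; first by rewrite addr_ge0.
      by move: hN nu0; lra.
    by rewrite XE lerD2l ler_pdivrMr// ler_peMr// lerDl.
  have hZ : k2 `^ sigma * (S ^- N * Z0) <=
    2 ^+ N * (S `^ (- (sigma + 1)) * resolvent_weight S xi) * (2 * (n0 + n1)).
    apply: (@le_trans _ _ (S ^- N * Z0)).
      rewrite ler_piMl ?mulr_ge0 ?invr_ge0 ?exprn_ge0 ?(ltW S0)//.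
      have <- : 1 `^ sigma = 1 :> R by rewrite powR1.
      by rewrite ge0_ler_powR ?nnegrE.
    apply: ler_pM => //.
    - by rewrite invr_ge0 exprn_ge0// ltW.
    - apply: le_trans (@resolvent_weight_low (sigma + 1) N _ k21) _; first by move: hN nu0; lra.
      rewrite ler_wpM2r ?mulr_ge0 ?powR_ge0// ler_weXn2l ?ler1n//.
      by rewrite -(ler_nat R); move: hN nu0 sigma0; lra.
    have : k2 * n0 <= n0 by rewrite ler_piMl.
    by move: n00 n10; lra.
  rewrite mulrDr; apply: le_trans (lerD hX hZ) _.
  have -> : 2 ^+ N * (S `^ (- (sigma + 1)) * resolvent_weight S xi) * (n0 + n1) +
    2 ^+ N * (S `^ (- (sigma + 1)) * resolvent_weight S xi) * (2 * (n0 + n1)) =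
    3 * 2 ^+ N * (S `^ (- (sigma + 1)) * (resolvent_weight S xi * (n0 + n1))) by ring.
  by rewrite ler_wpM2l ?mulr_ge0 ?exprn_ge0// lerDl.
rewrite -ltNge => k21; rewrite (min_idPl (ltW k21)) mul1r.
set H := S `^ (- (sigma + 1) - nu) * _ in hi0 *.
suff hH : k2 `^ sigma * (S ^- N * Z0) <= H.
  have hX : k2 * S ^- N * (Z0 / (1 + k2)) <= S ^- N * Z0.
    rewrite [k2 * _]mulrC -mulrA ler_wpM2l ?invr_ge0 ?exprn_ge0 ?(ltW S0)//.
    by rewrite mulrA ler_pdivrMr// mulrC ler_wpM2l// lerDr.
  apply: (@le_trans _ _ (2 * H)).
    have := ler_wpM2l (powR_ge0 k2 sigma) hX.
    by rewrite mulrDr; lra.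
  apply: ler_pM => //; first by move: N1; lra.
  by rewrite lerDr.
rewrite mulrCA; apply: ler_pM.
- by rewrite invr_ge0 exprn_ge0// ltW.
- by rewrite mulr_ge0 ?powR_ge0.
- by rewrite -opprD; apply: natural_power_le; move: hN nn; lra.
have hk : k2 `^ sigma <= (1 + k2) `^ sigma by rewrite ge0_ler_powR ?nnegrE ?lerDr// ltW.
rewrite mulrDr [leRHS]addrC; apply: lerD; first exact: ler_wpM2r.
by rewrite mulrA ler_wpM2r// powRD ?(gt_eqF k1p) ?implybT// powRr1 ?(ltW k1p)// ler_wpM2r// ltW.
Qed.

End FrequencySplitting.

(** * Complex amplitudes and the main estimates *)

Section ComplexFrequency.
Context {R : realType}.

Lemma Re_scale (a : R) (z : R[i]) : complex.Re ((a%:C)%C * z) = a * complex.Re z.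
Proof. by case: z => x y /=; rewrite mul0r subr0. Qed.

Lemma Im_scale (a : R) (z : R[i]) : complex.Im ((a%:C)%C * z) = a * complex.Im z.
Proof. by case: z => x y /=; rewrite mul0r addr0. Qed.

(** Real and imaginary parts separately solve the real equation. *)
Lemma complex_frequency_estimate (M N : nat) (lam om rho mu Xi Th : R -> R) :
  (2 <= M)%N -> condA1 M lam -> condA2 M lam om Xi Th -> condB1 lam rho mu ->
  condB2 M lam mu -> condB3 lam mu -> condB5 lam om rho mu Th ->
  exists2 C : R, 0 < C & forall (k2 : R) (v : R -> R[i]), 0 <= k2 ->
  (forall t : R, 0 <= t -> cderivable v t /\ cderivable (cderive v) t) ->
  (forall t : R, 0 <= t -> cderive (cderive v) t + ((lam t ^+ 2 * om t ^+ 2 * k2)%:C)%C * v t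
     + ((rho t * om t)%:C)%C * cderive v t = 0) ->
  forall t : R, 0 <= t ->
  let Z0 := normsq (cderive v 0) + (1 + k2) * normsq (v 0) in
  let W := (1 + Num.min 1 k2 * Blam lam rho t) ^- N in
  normsq (v t) <= C * (W * (Z0 / (1 + k2))) /\
  normsq (cderive v t) <= C * lam t ^+ 2 * (k2 * W * (Z0 / (1 + k2)) + (1 + Blam lam rho t) ^- N * Z0).
Proof.
move=> hM hA1 hA2 hB1 hB2 hB3 hB5.
have [C C0 hC] := frequency_estimate hM hA1 hA2 hB1 hB2 hB3 hB5 N.
exists C => // k2 v k20 hd hode t t0 Z0 W.
have osc (re : R[i] -> R) : (re = @complex.Re R \/ re = @complex.Im R) ->
    oscillation lam om rho k2 (fun s => re (v s)) (fun s => re (cderive v s)).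
  move=> hre; have dv s : 0 <= s -> derivable_from 0 (fun s => re (v s)) s /\
      derivable_from 0 (fun s => re (cderive v s)) s.
    by move=> s0; case: hre => ->; have [[? ?] [? ?]] := hd s s0.
  split.
  - by apply: derivable_from_continuous => s s0; exact: (dv s s0).1.
  - by apply: derivable_from_continuous => s s0; exact: (dv s s0).2.
  - move=> s s0; have := derivable_from_is_derive s0 (dv s (ltW s0)).1.
    by case: hre => ->.
  - move=> s s0; apply: is_derive_val (derivable_from_is_derive s0 (dv s (ltW s0)).2) _.
    case: hre => ->.
      have := congr1 (@complex.Re R) (hode s (ltW s0)); rewrite !raddfD /= !Re_scale /=; lra.
    have := congr1 (@complex.Im R) (hode s (ltW s0)); rewrite !raddfD /= !Im_scale /=; lra.
have [yr pr] := hC k2 _ _ k20 (osc _ (or_introl erefl)) t t0.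
have [yi pi0] := hC k2 _ _ k20 (osc _ (or_intror erefl)) t t0.
split.
  apply: le_trans (lerD yr yi) _.
  by apply: eq_ler; rewrite /W /Z0 /normsq; ring.
apply: le_trans (lerD pr pi0) _.
by apply: eq_ler; rewrite /W /Z0 /normsq; ring.
Qed.

Lemma measurable_scale_Re n (a : n.-tuple R -> R) (v : n.-tuple R -> R[i]) :
  measurable_fun setT a -> measurable_fun setT (fun xi => complex.Re (v xi)) ->
  measurable_fun setT (fun xi => complex.Re (((a xi)%:C)%C * v xi)).
Proof. by move=> ma mv; under eq_fun do rewrite Re_scale; exact: measurable_funM. Qed.

Lemma measurable_scale_Im n (a : n.-tuple R -> R) (v : n.-tuple R -> R[i]) :
  measurable_fun setT a -> measurable_fun setT (fun xi => complex.Im (v xi)) ->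
  measurable_fun setT (fun xi => complex.Im (((a xi)%:C)%C * v xi)).
Proof. by move=> ma mv; under eq_fun do rewrite Im_scale; exact: measurable_funM. Qed.

Lemma measurable_riesz_weight n (s : R) : measurable_fun setT (fun xi : n.-tuple R => enorm xi `^ s).
Proof. exact: (measurableT_comp (measurable_powR s) (@measurable_enorm R n)). Qed.

Lemma normsq_riesz n (s : R) (xi : n.-tuple R) (z : R[i]) :
  normsq (((enorm xi `^ s)%:C)%C * z) = (enorm xi ^+ 2) `^ s * normsq z.
Proof.
rewrite normsq_scale -[(_ `^ _) ^+ 2]powR_mulrn ?powR_ge0// -powRrM [s * _]mulrC powRrM.
by rewrite powR_mulrn ?enorm_ge0.
Qed.

Lemma nat_above (x : R) : exists N : nat, x <= N%:R.
Proof. by exists (Num.truncn x).+1; rewrite ltW// truncnS_gt. Qed.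

End ComplexFrequency.

Theorem theorem1 (R : realType) (n : nat) (m sigma : R) (M : nat)
    (lam om rho mu Xi Th F : R -> R)
    (hn : (1 <= n)%N) (hm : 1 <= m < 2) (hsigma : 0 <= sigma) (hM : (2 <= M)%N)
    (hA1 : condA1 M lam) (hA2 : condA2 M lam om Xi Th) (hA3 : condA3 lam om Th)
    (hA4 : condA4 M lam Xi Th) (hA5 : condA5 lam Xi F)
    (hB1 : condB1 lam rho mu) (hB2 : condB2 M lam mu) (hB3 : condB3 lam mu)
    (hB4 : condB4 lam rho) (hB5 : condB5 lam om rho mu Th)
    (hB6 : condB6 lam rho F) :
  (exists2 C : R, 0 < C &
    forall (u0 u1 : n.-tuple R -> R[i]) (u uhat : R -> n.-tuple R -> R[i]),
      in_LpHs m sigma u0 -> in_LpHs m (Num.max (sigma - 1) 0) u1 ->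
      sobolev_solution lam om rho u0 u1 u uhat ->
      forall t : R, 0 <= t ->
        (dot_sobolev_norm sigma (u t) <=
         (C * (1 + Blam lam rho t)
            `^ (- (sigma / 2) - n%:R / 2 * (m^-1 - 2^-1)))%:E
         * (LpHs_norm m sigma u0 + LpHs_norm m (Num.max (sigma - 1) 0)%R u1))%E) /\
  (exists2 C : R, 0 < C &
    forall (u0 u1 : n.-tuple R -> R[i]) (u uhat ut : R -> n.-tuple R -> R[i]),
      in_LpHs m (sigma + 1) u0 -> in_LpHs m sigma u1 ->
      sobolev_solution lam om rho u0 u1 u uhat ->
      time_derivative uhat ut ->
      forall t : R, 0 <= t ->
        (dot_sobolev_norm sigma (ut t) <=
         (C * lam t * (1 + Blam lam rho t)
            `^ (- (sigma / 2) - n%:R / 2 * (m^-1 - 2^-1) - 2^-1))%:E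
         * (LpHs_norm m (sigma + 1)%R u0 + LpHs_norm m sigma u1))%E).
Proof.
have nu0 : 0 <= n%:R * (m^-1 - 2^-1).
  case/andP: hm => m1 m2; rewrite mulr_ge0// subr_ge0 lef_pV2 ?posrE//; first exact: ltW.
  exact: lt_le_trans ltr01 m1.
(* At low frequency [N] pays for [sigma + 1] powers of the frequency and for the
   resolvent weight, at high frequency for the whole decay. *)
have [N hN] := nat_above (sigma + 1 + n%:R + n%:R * (m^-1 - 2^-1)).
have [C C0 hC] := complex_frequency_estimate N hM hA1 hA2 hB1 hB2 hB3 hB5.
have Bge0 t : 0 <= t -> 0 <= Blam lam rho t by move=> t0; exact: (B_ge0 hB1 t0).
have nn0 (z : R[i]) : 0 <= normsq z := normsq_ge0 z.
split.
- have CN0 : 0 < C * 2 ^+ N by rewrite mulr_gt0// exprn_gt0.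
  have [C' C'0 hC'] := @norm_of_frequency_bound R n m sigma sigma (Num.max (sigma - 1) 0) _ hm CN0.
  exists C' => // u0 u1 u uhat h0 h1 [hF [g0 [g1 [F0 F1 hae]]]] t t0.
  have [_ [mr mi _] _] := hF t t0.
  apply: le_trans (ereal_inf_lbound _) _.
    by exists (uhat t); [exact: hF|].
  have S0 : 0 < 1 + Blam lam rho t by rewrite ltr_pwDl// Bge0.
  have -> : C' * (1 + Blam lam rho t) `^ (- (sigma / 2) - n%:R / 2 * (m^-1 - 2^-1)) =
    C' * 1 * (1 + Blam lam rho t) `^ ((- sigma - n%:R * (m^-1 - 2^-1)) / 2).
    by rewrite mulr1; congr (_ * _ `^ _); lra.
  apply: (hC' _ 1 u0 u1 g0 g1) => //.
  + exact: measurable_scale_Re (measurable_riesz_weight sigma) mr.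
  + exact: measurable_scale_Im (measurable_riesz_weight sigma) mi.
  apply: filterS hae => xi /= [hd hode hv0 hv1].
  have [hy _] := hC _ (fun s => uhat s xi) (sqr_ge0 _) hd hode t t0.
  rewrite hv0 hv1 in hy.
  rewrite normsq_riesz expr1n mulr1.
  apply: le_trans (ler_wpM2l (powR_ge0 _ _) hy) _.
  rewrite mulrCA -[C * 2 ^+ N * _]mulrA ler_wpM2l ?(ltW C0)//.
  exact: (@displacement_splitting R n _ xi (Bge0 t t0) sigma _ (normsq (g0 xi)) (normsq (g1 xi)) N
    hsigma nu0 (nn0 _) (nn0 _) hN).
have CN0 : 0 < C * (3 * 2 ^+ N) by rewrite mulr_gt0// mulr_gt0// exprn_gt0.
have [C' C'0 hC'] := @norm_of_frequency_bound R n m (sigma + 1) (sigma + 1) sigma _ hm CN0.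
exists C' => // u0 u1 u uhat ut h0 h1 [hF [g0 [g1 [F0 F1 hae]]]] hut t t0.
have [w hw hwae] := hut t t0.
have [_ [mr mi _] _] := hw.
apply: le_trans (ereal_inf_lbound _) _; first by exists w.
have S0 : 0 < 1 + Blam lam rho t by rewrite ltr_pwDl// Bge0.
have L0 : 0 < lam t by have [_ + _ _] := hA1; exact.
have -> : C' * lam t * (1 + Blam lam rho t) `^ (- (sigma / 2) - n%:R / 2 * (m^-1 - 2^-1) - 2^-1) =
  C' * lam t * (1 + Blam lam rho t) `^ ((- (sigma + 1) - n%:R * (m^-1 - 2^-1)) / 2).
  by congr (_ * _ `^ _); lra.
apply: (hC' _ (lam t) u0 u1 g0 g1) => //.
+ exact: measurable_scale_Re (measurable_riesz_weight sigma) mr.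
+ exact: measurable_scale_Im (measurable_riesz_weight sigma) mi.
apply: filterS2 hae hwae => xi /= [hd hode hv0 hv1] hwx.
have [_ hp] := hC _ (fun s => uhat s xi) (sqr_ge0 _) hd hode t t0.
rewrite hv0 hv1 in hp.
rewrite normsq_riesz hwx.
apply: le_trans (ler_wpM2l (powR_ge0 _ _) hp) _.
rewrite mulrCA -[C * lam t ^+ 2 * _]mulrA.
rewrite -[C * (3 * 2 ^+ N) * lam t ^+ 2 * _]mulrA -[C * (3 * 2 ^+ N) * _]mulrA.
rewrite ler_wpM2l ?(ltW C0)// [leRHS]mulrCA ler_wpM2l ?sqr_ge0//.
exact: (@velocity_splitting R n _ xi (Bge0 t t0) sigma _ (normsq (g0 xi)) (normsq (g1 xi)) N
  hsigma nu0 (nn0 _) (nn0 _) hN).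
Qed.
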